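(* Let $X,U,Y$ be real Hilbert spaces, let $A,f,g,h,C$ be as in the context, and suppose that the assumptions (ISS), (Smooth) and (Lyap) of the context hold. Let $\mathcal{M}\in\mathcal{C}^1(X,Y)$ be the unique solution with $\mathcal{M}(0)=0$ to $$\mathrm{d}\mathcal{M}(x)(Ax+f(x))=Cx+h(x),\qquad\forall x\in\mathcal{D}(A).$$ Suppose that $$\operatorname{Range}\,CA^{-1}g(0)=Y.$$ Then there exists $r>0$ such that for any $y_{\mathrm{ref}}\in Y$ with $\|y_{\mathrm{ref}}\|_Y<r$, the closed-loop system $$\dot{x}=Ax+f(x)+g(x)u,\qquad\dot{z}=Cx+h(x)-y_{\mathrm{ref}},\qquad u=g(x)^*\,\mathrm{d}\mathcal{M}(x)^*[z-\mathcal{M}(x)]$$ possesses an equilibrium $[x^\star,z^\star]\in\mathcal{D}(A)\times Y$ that is locally exponentially stable in $X\times Y$, satisfies $Cx^\star+h(x^\star)=y_{\mathrm{ref}}$, and whose basin of attraction contains the origin of $X\times Y$.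
   Context: Conventions. $\mathcal{L}(E_1,E_2)$ is the space of bounded linear operators between normed spaces, with the operator norm; $\mathcal{C}^1(E_1,E_2)$ is the space of continuously Fréchet differentiable maps, with differential $\mathrm{d}f: E_1\to\mathcal{L}(E_1,E_2)$. A map is called locally Lipschitz continuous if it is Lipschitz continuous on every bounded subset. $L^*$ denotes the Hilbert adjoint of $L$. Data. $A:\mathcal{D}(A)\to X$ is the infinitesimal generator of a strongly continuous semigroup $\{e^{tA}\}_{t\geq 0}$ on $X$, and $\mathcal{D}(A)$ carries the graph norm; $f:X\to X$ is locally Lipschitz continuous with $f(0)=0$; $g:X\to\mathcal{L}(U,X)$ is locally Lipschitz continuous; $h:X\to Y$ is locally Lipschitz continuous with $h(0)=0$; $C\in\mathcal{L}(\mathcal{D}(A),Y)$. A functional $V\in\mathcal{C}^1(X,\mathbb{R})$ is quadratic-like if there exist $m_1,m_2>0$ with $m_1\|x\|_X^2\leq V(x)\leq m_2\|x\|_X^2$ for all $x\in X$. (ISS) There exist a quadratic-like $V\in\mathcal{C}^1(X,\mathbb{R})$ and $\beta>0$ such that $\mathrm{d}V(x)[Ax+f(x)+g(x)u]\leq\beta\|u\|_U^2$ for all $x\in\mathcal{D}(A)$, $u\in U$. Moreover, for any bounded open set $\mathcal{B}\subset X$ there exist a quadratic-like $V_{\mathcal{B}}\in\mathcal{C}^1(X,\mathbb{R})$ and $\alpha_{\mathcal{B}},\beta_{\mathcal{B}}>0$ such that $\mathrm{d}V_{\mathcal{B}}(x)[Ax+f(x)+g(x)u]\leq-\alpha_{\mathcal{B}}V_{\mathcal{B}}(x)+\beta_{\mathcal{B}}\|u\|_U^2$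 for all $x\in\mathcal{D}(A)\cap\mathcal{B}$, $u\in U$. (Smooth) The maps $f$ and $h$ are Fréchet differentiable with locally Lipschitz continuous differentials, $\mathrm{d}f(0)=0$ and $\mathrm{d}h(0)=0$. (Lyap) There exist a coercive self-adjoint operator $P\in\mathcal{L}(X)$ (i.e., $\langle Px,x\rangle_X\geq c\|x\|_X^2$ for some $c>0$ and all $x\in X$) and $\mu>0$ such that $\langle Ax,Px\rangle_X\leq-\mu\|x\|_X^2$ for all $x\in\mathcal{D}(A)$. In particular $\{e^{tA}\}_{t\geq0}$ is exponentially stable and $A$ is boundedly invertible. The map $\mathcal{M}$. Under (ISS), (Smooth), (Lyap) the map $\mathcal{M}$ in the claim exists, is unique, has locally Lipschitz continuous differential, and is given by $\mathcal{M}(x)=CA^{-1}x+\int_0^{+\infty}[CA^{-1}f(\mathcal{T}_tx)-h(\mathcal{T}_tx)]\,\mathrm{d}t$, where $t\mapsto\mathcal{T}_tx_0$ is the unique global mild solution of $\dot{x}=Ax+f(x)$, $x(0)=x_0$. Solutions. The closed-loop system has a unique global mild solution $[x,z]\in\mathcal{C}([0,\infty),X\times Y)$ for each initial datum in $X\times Y$, where the closed loop is viewed as a locally Lipschitz perturbation of the strongly continuous semigroup on $X\times Y$ generated by $[x,z]\mapsto[Ax,Cx]$ with domain $\mathcal{D}(A)\times Y$; mild solutions are those of the corresponding variation-of-constants formula. Stability notions. An equilibrium $[x^\star,z^\star]\in\mathcal{D}(A)\times Y$ is a point at which the right-hand sides of the closed-loop equations vanish. It is locally exponentially stable if there exist $\delta,K,\omega>0$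 such that every solution with $\|[x_0-x^\star,z_0-z^\star]\|_{X\times Y}<\delta$ satisfies $\|[x(t)-x^\star,z(t)-z^\star]\|_{X\times Y}\leq Ke^{-\omega t}\|[x_0-x^\star,z_0-z^\star]\|_{X\times Y}$ for all $t\geq0$. Its basin of attraction is the set of initial data whose solution converges to $[x^\star,z^\star]$ in $X\times Y$ as $t\to+\infty$. *)

(* Defs.v *)
From Stdlib Require Import Reals Lra FunctionalExtensionality ProofIrrelevance.
From Coquelicot Require Import Coquelicot.

Open Scope R_scope.

(* [is_linear] includes boundedness. *)
Record bounded_op (E F : NormedModule R_AbsRing) := mk_bounded_op {
  bo_fun :> E -> F;
  bo_linear : is_linear bo_fun
}.
Arguments mk_bounded_op {E F}.
Arguments bo_fun {E F}.
Arguments bo_linear {E F}.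

Section BoundedOp.
Context {E F : NormedModule R_AbsRing}.
Implicit Types L S T : bounded_op E F.

Lemma bo_ext S T : (forall x, S x = T x) -> S = T.
Proof.
destruct S as [s Hs], T as [t Ht]; simpl; intros H.
assert (H' : s = t) by (apply functional_extensionality; exact H).
subst t; f_equal; apply proof_irrelevance.
Qed.

Lemma bo_plus_linear S T : is_linear (fun x => plus (S x) (T x)).
Proof.
exact (is_linear_comp (fun x => (S x, T x)) (fun p => plus (fst p) (snd p))
  (is_linear_prod _ _ (bo_linear S) (bo_linear T)) is_linear_plus).
Qed.

Lemma bo_scal_linear (a : R_AbsRing) S : is_linear (fun x => scal a (S x)).
Proof.
exact (is_linear_comp S (fun y => scal a y) (bo_linear S)
  (is_linear_scal_r a Rmult_comm)).
Qed.

Definition bo_plus S T := mk_bounded_op _ (bo_plus_linear S T).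
Definition bo_opp S :=
  mk_bounded_op _ (is_linear_comp S opp (bo_linear S) is_linear_opp).
Definition bo_zero : bounded_op E F := mk_bounded_op _ is_linear_zero.
Definition bo_scal (a : R_AbsRing) S := mk_bounded_op _ (bo_scal_linear a S).

Definition op_norm L : R :=
  real (Lub_Rbar (fun r => exists x, norm x <= 1 /\ r = norm (L x))).

Lemma op_norm_lub L :
  is_lub (fun r => exists x, norm x <= 1 /\ r = norm (L x)) (op_norm L).
Proof.
unfold op_norm; set (P := fun r => _).
assert (HL : is_lub_Rbar P (Lub_Rbar P)) by apply Lub_Rbar_correct.
destruct (linear_norm _ (bo_linear L)) as [M [M0 HM]].
destruct (Lub_Rbar P) as [l| |]; simpl.
- destruct HL as [H1 H2]; split.
  + intros r Hr; exact (H1 r Hr).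
  + intros b Hb; apply (H2 (Finite b)); intros r Hr; exact (Hb r Hr).
- exfalso; destruct HL as [_ H2]; apply (H2 (Finite M)).
  intros r [x [Hx ->]]; simpl; specialize (HM x); nra.
- exfalso; destruct HL as [H1 _]; apply (H1 0); exists zero; split.
  + rewrite norm_zero; lra.
  + rewrite (linear_zero _ (bo_linear L)), norm_zero; reflexivity.
Qed.

Lemma op_norm_ge0 L : 0 <= op_norm L.
Proof.
apply (proj1 (op_norm_lub L)); exists zero.
rewrite (linear_zero _ (bo_linear L)), !norm_zero; split; [lra | reflexivity].
Qed.

Lemma op_norm_bound L x : norm (L x) <= op_norm L * norm x.
Proof.
destruct (Req_dec (norm x) 0) as [H0|H0].
  rewrite (norm_eq_zero x H0), (linear_zero _ (bo_linear L)), !norm_zero.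
  rewrite Rmult_0_r; apply Rle_refl.
assert (Hp : 0 < norm x) by (pose proof (norm_ge_0 x); lra).
set (a := norm x : R_AbsRing); set (b := / norm x : R_AbsRing).
assert (Hb : abs b = / norm x)
  by (apply Rabs_pos_eq, Rlt_le, Rinv_0_lt_compat, Hp).
assert (Hx : x = scal a (scal b x)).
  rewrite scal_assoc; replace (mult a b) with (one : R_AbsRing).
    now rewrite scal_one.
  symmetry; exact (Rinv_r _ H0).
assert (Hn : norm (scal b x) <= 1).
  eapply Rle_trans; [apply norm_scal|].
  rewrite Hb, Rinv_l; [apply Rle_refl | exact H0].
assert (H : norm (L (scal b x)) <= op_norm L).
  apply (proj1 (op_norm_lub L)); now exists (scal b x).
rewrite Hx at 1; rewrite (linear_scal _ (bo_linear L)).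
eapply Rle_trans; [apply norm_scal|].
replace (abs a) with (norm x) by (symmetry; apply Rabs_pos_eq; lra).
rewrite Rmult_comm; apply Rmult_le_compat_r; [apply norm_ge_0 | exact H].
Qed.

Lemma op_norm_le L M :
  0 <= M -> (forall x, norm (L x) <= M * norm x) -> op_norm L <= M.
Proof.
intros HM H; apply (proj2 (op_norm_lub L)); intros r [x [Hx ->]].
specialize (H x); nra.
Qed.

Definition bo_AbelianMonoid_mixin : AbelianMonoid.mixin_of (bounded_op E F).
Proof.
refine (AbelianMonoid.Mixin _ bo_plus bo_zero _ _ _);
  intros; apply bo_ext; intros t; simpl.
- apply plus_comm.
- apply plus_assoc.
- apply plus_zero_r.
Defined.

Definition bo_AbelianGroup_mixin : AbelianGroup.mixin_of
  (AbelianMonoid.Pack (bounded_op E F) bo_AbelianMonoid_mixin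
     (bounded_op E F)).
Proof.
refine (AbelianGroup.Mixin
  (AbelianMonoid.Pack _ bo_AbelianMonoid_mixin (bounded_op E F)) bo_opp _).
intros S; apply bo_ext; intros z; exact (plus_opp_r (bo_fun S z)).
Defined.

Definition bo_AbelianGroup_class : AbelianGroup.class_of (bounded_op E F) :=
  AbelianGroup.Class _ bo_AbelianMonoid_mixin bo_AbelianGroup_mixin.

Definition bo_ModuleSpace_mixin : ModuleSpace.mixin_of R_AbsRing
  (AbelianGroup.Pack (bounded_op E F) bo_AbelianGroup_class (bounded_op E F)).
Proof.
refine (ModuleSpace.Mixin R_AbsRing
  (AbelianGroup.Pack _ bo_AbelianGroup_class (bounded_op E F))
  bo_scal _ _ _ _);
  intros; apply bo_ext; intros t; simpl.
- exact (scal_assoc x y (bo_fun u t)).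
- exact (scal_one (bo_fun u t)).
- exact (scal_distr_l x (bo_fun u t) (bo_fun v t)).
- exact (scal_distr_r x y (bo_fun u t)).
Defined.

Definition bo_ModuleSpace_class :
  ModuleSpace.class_of R_AbsRing (bounded_op E F) :=
  ModuleSpace.Class R_AbsRing _ bo_AbelianGroup_class bo_ModuleSpace_mixin.

Definition bo_ball (S : bounded_op E F) (e : R) (T : bounded_op E F) : Prop :=
  op_norm (bo_plus T (bo_opp S)) < e.

Lemma op_norm_triangle S T : op_norm (bo_plus S T) <= op_norm S + op_norm T.
Proof.
pose proof (op_norm_ge0 S); pose proof (op_norm_ge0 T).
apply op_norm_le; [lra|]; intros x; simpl.
eapply Rle_trans; [apply norm_triangle|].
pose proof (op_norm_bound S x); pose proof (op_norm_bound T x); lra.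
Qed.

Lemma op_norm_scal (a : R_AbsRing) S : op_norm (bo_scal a S) <= Rabs a * op_norm S.
Proof.
pose proof (op_norm_ge0 S); pose proof (Rabs_pos a).
apply op_norm_le; [nra|]; intros x; simpl.
eapply Rle_trans; [apply norm_scal|].
rewrite Rmult_assoc; apply Rmult_le_compat_l; auto.
apply op_norm_bound.
Qed.

Lemma op_norm_sub_sym S T :
  op_norm (bo_plus S (bo_opp T)) <= op_norm (bo_plus T (bo_opp S)).
Proof.
apply op_norm_le; [apply op_norm_ge0|]; intros x.
eapply Rle_trans; [|apply op_norm_bound]; simpl.
change (norm (minus (S x) (T x)) <= norm (minus (T x) (S x))).
rewrite <- (norm_opp (minus (T x) (S x))).
rewrite (opp_minus (G := NormedModule.AbelianGroup _ F)).
apply Rle_refl.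
Qed.

Definition bo_UniformSpace_mixin : UniformSpace.mixin_of (bounded_op E F).
Proof.
refine (UniformSpace.Mixin _ bo_zero bo_ball _ _ _); unfold bo_ball.
- intros S e; apply Rle_lt_trans with 0; [|apply cond_pos].
  apply op_norm_le; [lra|]; intros x.
  change (norm (minus (S x) (S x)) <= 0 * norm x).
  rewrite (minus_eq_zero (G := NormedModule.AbelianGroup _ F)), Rmult_0_l.
  right; exact (norm_zero (V := F)).
- intros S T e H; eapply Rle_lt_trans; [apply op_norm_sub_sym | exact H].
- intros S T W e1 e2 H1 H2.
  apply Rle_lt_trans with
    (op_norm (bo_plus T (bo_opp S)) + op_norm (bo_plus W (bo_opp T))); [|lra].
  rewrite Rplus_comm; eapply Rle_trans; [|apply op_norm_triangle].
  right; f_equal; apply bo_ext; intros x.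
  exact (minus_trans (G := NormedModule.AbelianGroup _ F) (T x) (W x) (S x)).
Defined.

Definition bo_NormedModuleAux_class :
  NormedModuleAux.class_of R_AbsRing (bounded_op E F) :=
  NormedModuleAux.Class R_AbsRing _ bo_ModuleSpace_class bo_UniformSpace_mixin.

Definition bo_NormedModule_mixin : NormedModule.mixin_of R_AbsRing
  (NormedModuleAux.Pack R_AbsRing (bounded_op E F)
     bo_NormedModuleAux_class (bounded_op E F)).
Proof.
refine (NormedModule.Mixin R_AbsRing
  (NormedModuleAux.Pack R_AbsRing _ bo_NormedModuleAux_class (bounded_op E F))
  op_norm 1 _ _ _ _ _).
- exact op_norm_triangle.
- exact op_norm_scal.
- intros S T e H; exact H.
- intros S T e H; rewrite Rmult_1_l; exact H.
- intros S H; apply bo_ext; intros x; apply norm_eq_zero.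
  apply Rle_antisym; [|apply norm_ge_0].
  pose proof (op_norm_bound S x) as Hx.
  rewrite H, Rmult_0_l in Hx; exact Hx.
Defined.

End BoundedOp.

Canonical bo_AbelianMonoid (E F : NormedModule R_AbsRing) :=
  AbelianMonoid.Pack (bounded_op E F) bo_AbelianMonoid_mixin (bounded_op E F).
Canonical bo_AbelianGroup (E F : NormedModule R_AbsRing) :=
  AbelianGroup.Pack (bounded_op E F) bo_AbelianGroup_class (bounded_op E F).
Canonical bo_ModuleSpace (E F : NormedModule R_AbsRing) :=
  ModuleSpace.Pack R_AbsRing (bounded_op E F)
    bo_ModuleSpace_class (bounded_op E F).
Canonical bo_UniformSpace (E F : NormedModule R_AbsRing) :=
  UniformSpace.Pack (bounded_op E F) bo_UniformSpace_mixin (bounded_op E F).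
Canonical bo_NormedModuleAux (E F : NormedModule R_AbsRing) :=
  NormedModuleAux.Pack R_AbsRing (bounded_op E F)
    bo_NormedModuleAux_class (bounded_op E F).
Canonical bo_NormedModule (E F : NormedModule R_AbsRing) :
    NormedModule R_AbsRing :=
  NormedModule.Pack R_AbsRing (bounded_op E F)
    (NormedModule.Class R_AbsRing _
       bo_NormedModuleAux_class bo_NormedModule_mixin)
    (bounded_op E F).

Record Hilbert := mk_Hilbert {
  hilbert_module :> CompleteNormedModule R_AbsRing;
  inner : hilbert_module -> hilbert_module -> R;
  inner_sym : forall x y, inner x y = inner y x;
  inner_plus : forall x y z, inner (plus x y) z = inner x z + inner y z;
  inner_scal : forall (a : R) x y, inner (scal a x) y = a * inner x y;
  inner_norm : forall x, inner x x = norm x ^ 2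
}.
Arguments inner {h}.

(* Value at [y] of the Hilbert adjoint of [L]: by the Riesz theorem there is
   exactly one such [x]. *)
Definition adjoint {E F : Hilbert} (L : bounded_op E F) (y : F) : E :=
  iota (fun x : E => forall v : E, inner (L v) y = inner v x).

Section Maps.
Context {E F : NormedModule R_AbsRing}.

Definition bounded_set (B : E -> Prop) : Prop :=
  exists r, forall x, B x -> norm x <= r.

Definition locally_lipschitz (f : E -> F) : Prop :=
  forall B : E -> Prop, bounded_set B ->
  exists k, forall x y, B x -> B y ->
    norm (minus (f x) (f y)) <= k * norm (minus x y).

Definition has_differential (f : E -> F) (df : E -> bounded_op E F) : Prop :=
  forall x, filterdiff f (locally x) (df x).

Definition C1_with (f : E -> F) (df : E -> bounded_op E F) : Prop :=
  has_differential f df /\ forall x, continuous df x.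

End Maps.

(* Only the values of [uo_fun] on [uo_dom] are meaningful. *)
Record unbounded_op (E : NormedModule R_AbsRing) := mk_unbounded_op {
  uo_dom : E -> Prop;
  uo_fun :> E -> E
}.
Arguments mk_unbounded_op {E}.
Arguments uo_dom {E}.
Arguments uo_fun {E}.

Section Semigroups.
Context {E : NormedModule R_AbsRing}.

(* Only the values of [T] at nonnegative times are meaningful. *)
Definition C0_semigroup (T : R -> bounded_op E E) : Prop :=
  (forall x, T 0 x = x) /\
  (forall s t, 0 <= s -> 0 <= t -> forall x, T (s + t) x = T s (T t x)) /\
  (forall x, filterlim (fun t => T t x) (at_right 0) (locally x)).

Definition generates (A : unbounded_op E) (T : R -> bounded_op E E) : Prop :=
  forall x y,
    (uo_dom A x /\ A x = y) <->
    filterlim (fun t => scal (/ t) (minus (T t x) x))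
      (at_right 0) (locally y).

Definition infinitesimal_generator (A : unbounded_op E) : Prop :=
  exists T, C0_semigroup T /\ generates A T.

Definition graph_norm (A : unbounded_op E) (x : E) : R :=
  sqrt (norm x ^ 2 + norm (A x) ^ 2).

(* [C] belongs to L(D(A), F), where D(A) carries the graph norm; values of [C]
   outside D(A) are irrelevant. *)
Definition bounded_on_domain {F : NormedModule R_AbsRing}
    (A : unbounded_op E) (C : E -> F) : Prop :=
  (forall x y, uo_dom A x -> uo_dom A y -> C (plus x y) = plus (C x) (C y)) /\
  (forall (a : R) x, uo_dom A x -> C (scal a x) = scal a (C x)) /\
  (exists k, forall x, uo_dom A x -> norm (C x) <= k * graph_norm A x).

(* Mild solutions on [0, +oo) of w' = A w + F(w), w(0) = w0. The semigroup
   generated by [A] is unique at nonnegative times, so the existential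
   quantifier only names it. *)
Definition mild_solution (A : unbounded_op E) (F : E -> E) (w0 : E)
    (w : R -> E) : Prop :=
  exists T, C0_semigroup T /\ generates A T /\
  (forall t, 0 <= t ->
     filterlim w (within (fun s => 0 <= s) (locally t)) (locally (w t))) /\
  (forall t, 0 <= t ->
     is_RInt (fun s => T (t - s) (F (w s))) 0 t (minus (w t) (T t w0))).

Definition equilibrium (A : unbounded_op E) (F : E -> E) (p : E) : Prop :=
  uo_dom A p /\ plus (A p) (F p) = zero.

Definition locally_exponentially_stable (A : unbounded_op E) (F : E -> E)
    (p : E) : Prop :=
  exists delta K omega, 0 < delta /\ 0 < K /\ 0 < omega /\
  forall w0 w, norm (minus w0 p) < delta -> mild_solution A F w0 w ->
  forall t, 0 <= t ->
    norm (minus (w t) p) <= K * exp (- omega * t) * norm (minus w0 p).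

Definition basin_of_attraction (A : unbounded_op E) (F : E -> E) (p : E) :
    E -> Prop :=
  fun w0 => exists w, mild_solution A F w0 w /\
    filterlim w (Rbar_locally p_infty) (locally p).

End Semigroups.

Definition uo_inv {E : CompleteNormedModule R_AbsRing} (A : unbounded_op E)
    (y : E) : E :=
  iota (fun x : E => uo_dom A x /\ A x = y).

Definition quadratic_like {E : NormedModule R_AbsRing} (V : E -> R) : Prop :=
  exists m1 m2, 0 < m1 /\ 0 < m2 /\
  forall x, m1 * norm x ^ 2 <= V x <= m2 * norm x ^ 2.

Definition ISS {X U : Hilbert} (A : unbounded_op X) (f : X -> X)
    (g : X -> bounded_op U X) : Prop :=
  (exists (V : X -> R) (dV : X -> bounded_op X R_NormedModule) (beta : R),
     C1_with V dV /\ quadratic_like V /\ 0 < beta /\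
     forall x u, uo_dom A x ->
       dV x (plus (plus (A x) (f x)) (g x u)) <= beta * norm u ^ 2) /\
  (forall B : X -> Prop, bounded_set B -> open B ->
   exists (V : X -> R) (dV : X -> bounded_op X R_NormedModule)
     (alpha beta : R),
     C1_with V dV /\ quadratic_like V /\ 0 < alpha /\ 0 < beta /\
     forall x u, uo_dom A x -> B x ->
       dV x (plus (plus (A x) (f x)) (g x u)) <=
         - alpha * V x + beta * norm u ^ 2).

Definition smooth_with_zero_differential {E F : NormedModule R_AbsRing}
    (f : E -> F) : Prop :=
  exists df : E -> bounded_op E F,
    has_differential f df /\ locally_lipschitz df /\ df zero = zero.

Definition Lyap {X : Hilbert} (A : unbounded_op X) : Prop :=
  exists (P : bounded_op X X) (c mu : R),
    0 < c /\ 0 < mu /\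
    (forall x y, inner (P x) y = inner x (P y)) /\
    (forall x, c * norm x ^ 2 <= inner (P x) x) /\
    (forall x, uo_dom A x -> inner (A x) (P x) <= - mu * norm x ^ 2).

Definition cascade_op {X Y : Hilbert} (A : unbounded_op X) (C : X -> Y) :
    unbounded_op (prod_NormedModule R_AbsRing X Y) :=
  mk_unbounded_op (E := prod_NormedModule R_AbsRing X Y)
    (fun p => uo_dom A (fst p)) (fun p => (A (fst p), C (fst p))).

Definition feedback {X U Y : Hilbert} (g : X -> bounded_op U X)
    (M : X -> Y) (dM : X -> bounded_op X Y) (x : X) (z : Y) : U :=
  adjoint (g x) (adjoint (dM x) (minus z (M x))).

Definition closed_loop {X U Y : Hilbert} (f : X -> X)
    (g : X -> bounded_op U X) (h : X -> Y) (M : X -> Y)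
    (dM : X -> bounded_op X Y) (yref : Y) (p : X * Y) : X * Y :=
  let (x, z) := p in
  (plus (f x) (g x (feedback g M dM x z)), minus (h x) yref).

(* Main.v *)
Require Import Defs.
From Stdlib Require Import Reals Lra Lia List Classical ClassicalEpsilon.
From Coquelicot Require Import Coquelicot.
Open Scope R_scope.

(** Everything takes place near the origin. Put [eta = z - M x]. The equation of [M]
    cancels [C x] against [dM x (A x)], and the closed loop becomes
      [x' = A x + f x + G x eta],   [eta' = - yref - Q x eta],
    with [G x = g x (g x)^* (dM x)^*] and [Q x = dM x (G x)]. The equation of [M],
    linearised at [0], says that [dM 0 (A x) = C x], so that [dM 0] plays the part
    of [C A^-1] and the range condition says that [B = dM 0 (g 0)] is onto. By
    uniform boundedness [B^*] is then bounded below, and [Q 0 = B B^*] is coercive.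
    Let [p x = sqrt <P x, x>], where [P] is the Lyapunov operator: the semigroup of
    [A] contracts [p] exponentially. At first order the system is thus a cascade of
    two exponentially stable systems, and for a large weight [kp] the norm [p x + kp
    * norm eta] of the difference of two solutions decays exponentially as long as
    both stay in a small ball, because the remaining terms have a small Lipschitz
    constant there ([gap_dini]).

    The theorem follows from this contraction alone. The trajectory from the origin
    stays in the ball when [yref] is small ([trajectory_from_origin]). It approaches
    its own translates in time, hence converges; the limit of a mild solution is an
    equilibrium ([trajectory_limit]), at which the second equation reads [C xs + h
    xs = yref]. The contraction towards this equilibrium is local exponential
    stability ([equilibrium_stable]).

    Two points need care. First, mild solutions are not differentiable, since [x t]
    need not be in the domain of [A]. What they do satisfy is [x (t + s) = T s (x t)
    + s * l + o(s)] ([duhamel_expansion]). This is enough to bound the upper right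
    Dini derivative of [p (x t)], and also to differentiate [M x - dM 0 x] along a
    solution ([derivative_along_perturbed_semigroup]): its derivative along the
    semigroup is [h x - dM x (f x)], where [A] does not appear, and the chain rule
    extends from the domain by density. All estimates then come from one fact: a
    continuous function whose Dini derivative is not positive does not increase
    ([dini_nonincreasing]). The cascade [(A, C)] generates the explicit semigroup
    [(x, z) |-> (T t x, z + dM 0 (T t x - x))], and a generator determines its
    semigroup ([semigroup_unique]), so the variation of constants can always be
    written with this one.

    Secondly, the existence of solutions needs [dM] to be Lipschitz near the origin,
    while [M] is only given as a solution of class C1 of its equation. The equation
    says that the derivative of [M x - dM 0 x] along the flow of [A + f] is [h x -
    dM 0 (f x)]. Second differences of the flow are of order [norm v ^ 2] and decay
    exponentially, because [f] has a Lipschitz differential; integrating along the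
    flow, the second differences of [M x - dM 0 x] are of order [norm v ^ 2] too
    ([second_difference_bound]). For a C1 map this bounds the Lipschitz constant of
    the differential ([differential_lipschitz_of_second_difference]). *)

(** * Vectors of a real normed space *)

(** The operations of a normed space, seen from the normed space itself: the
    generic ones are reached through several equal but distinct chains of
    structures, which would prevent equal norms from being recognised. *)
Section VectorOperations.
Context {E : NormedModule R_AbsRing}.
Definition vadd (x y : E) : E := plus x y.
Definition vsub (x y : E) : E := minus x y.
Definition vscal (a : R) (x : E) : E := scal (a : R_AbsRing) x.
Definition vopp (x : E) : E := opp x.
Definition vzero : E := zero.
End VectorOperations.

Infix "[+]" := vadd (at level 50, left associativity).
Infix "[-]" := vsub (at level 50, left associativity).
Infix "[*]" := vscal (at level 40, left associativity).

Section VectorIdentities.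
Context {V : NormedModule R_AbsRing}.

Inductive vexp :=
  | VAtom (n : nat) | VZero | VPlus (a b : vexp) | VOpp (a : vexp)
  | VScal (c : R) (a : vexp).

Fixpoint vden (env : list V) (e : vexp) : V :=
  match e with
  | VAtom n => nth n env vzero
  | VZero => vzero
  | VPlus a b => vden env a [+] vden env b
  | VOpp a => vopp (vden env a)
  | VScal c a => c [*] vden env a
  end.

Fixpoint vcoef (e : vexp) (i : nat) : R :=
  match e with
  | VAtom n => if Nat.eqb i n then 1 else 0
  | VZero => 0
  | VPlus a b => vcoef a i + vcoef b i
  | VOpp a => - vcoef a i
  | VScal c a => c * vcoef a i
  end.

Fixpoint vlin (env : list V) (c : nat -> R) : V :=
  match env with
  | nil => vzero
  | v :: env' => c O [*] v [+] vlin env' (fun i => c (S i))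
  end.

Fixpoint vsame (n : nat) (c d : nat -> R) : Prop :=
  match n with
  | O => True
  | S n' => c O = d O /\ vsame n' (fun i => c (S i)) (fun i => d (S i))
  end.

Lemma vadd_comm (x y : V) : x [+] y = y [+] x.
Proof. exact (plus_comm x y). Qed.

Lemma vadd_assoc (x y z : V) : x [+] (y [+] z) = x [+] y [+] z.
Proof. exact (plus_assoc x y z). Qed.

Lemma vadd_0_r (x : V) : x [+] vzero = x.
Proof. exact (plus_zero_r x). Qed.

Lemma vscal_0_l (x : V) : 0 [*] x = vzero.
Proof. exact (scal_zero_l x). Qed.

Lemma vscal_0_r a : a [*] vzero = (vzero : V).
Proof. exact (scal_zero_r (a : R_AbsRing)). Qed.

Lemma vlin_zero env : vlin env (fun _ => 0) = vzero.
Proof.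
induction env as [|v env IH]; simpl; [reflexivity|].
now rewrite IH, vadd_0_r, vscal_0_l.
Qed.

Lemma vlin_plus env c d :
  vlin env (fun i => c i + d i) = vlin env c [+] vlin env d.
Proof.
revert c d; induction env as [|v env IH]; intros c d; simpl.
- now rewrite vadd_0_r.
- rewrite (IH (fun i => c (S i)) (fun i => d (S i))).
  rewrite (scal_distr_r (c O : R_AbsRing) (d O) v
    : (c O + d O) [*] v = c O [*] v [+] d O [*] v).
  rewrite <- !vadd_assoc; f_equal.
  now rewrite !vadd_assoc, (vadd_comm (_ [*] v)).
Qed.

Lemma vlin_scal env c k : vlin env (fun i => k * c i) = k [*] vlin env c.
Proof.
revert c; induction env as [|v env IH]; intros c; simpl.
- now rewrite vscal_0_r.
- rewrite (IH (fun i => c (S i))).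
  rewrite <- (scal_assoc (k : R_AbsRing) (c O) v : k [*] (c O [*] v) = (k * c O) [*] v).
  symmetry; exact (scal_distr_l (k : R_AbsRing) _ _).
Qed.

Lemma vlin_opp env c : vlin env (fun i => - c i) = vopp (vlin env c).
Proof.
revert c; induction env as [|v env IH]; intros c; simpl.
- symmetry; exact opp_zero.
- rewrite (IH (fun i => c (S i))).
  rewrite (scal_opp_l (c O : R_AbsRing) v : (- c O) [*] v = vopp (c O [*] v)).
  symmetry; exact (opp_plus _ _).
Qed.

Lemma vlin_atom env n :
  vlin env (fun i => if Nat.eqb i n then 1 else 0) = nth n env vzero.
Proof.
revert n; induction env as [|v env IH]; intros [|n]; simpl; try reflexivity.
- rewrite vlin_zero, vadd_0_r; exact (scal_one v).
- now rewrite IH, vscal_0_l, vadd_comm, vadd_0_r.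
Qed.

Lemma vden_vlin env e : vden env e = vlin env (vcoef e).
Proof.
induction e as [n| |a IHa b IHb|a IHa|c a IHa]; simpl.
- symmetry; apply vlin_atom.
- symmetry; apply vlin_zero.
- now rewrite IHa, IHb, <- vlin_plus.
- now rewrite IHa, <- vlin_opp.
- now rewrite IHa, <- vlin_scal.
Qed.

Lemma vden_eq env e1 e2 :
  vsame (length env) (vcoef e1) (vcoef e2) -> vden env e1 = vden env e2.
Proof.
rewrite !vden_vlin; generalize (vcoef e1), (vcoef e2).
induction env as [|v env IH]; simpl; intros c d H; [reflexivity|].
destruct H as [-> H]; f_equal; apply IH, H.
Qed.

End VectorIdentities.

Ltac vmem x l :=
  lazymatch l with
  | nil => constr:(false)
  | cons ?y ?l' =>
    match constr:(Set) with
    | _ => let _ := match constr:(Set) with _ => constr_eq_strict x y end in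
           constr:(true)
    | _ => vmem x l'
    end
  end.

Ltac vatoms t l :=
  lazymatch t with
  | vadd ?a ?b => let l := vatoms a l in vatoms b l
  | vsub ?a ?b => let l := vatoms a l in vatoms b l
  | vopp ?a => vatoms a l
  | vscal _ ?a => vatoms a l
  | vzero => l
  | _ => let b := vmem t l in
         lazymatch b with true => l | false => constr:(cons t l) end
  end.

Ltac vindex x l :=
  lazymatch l with
  | cons ?y ?l' =>
    match constr:(Set) with
    | _ => let _ := match constr:(Set) with _ => constr_eq_strict x y end in
           constr:(O)
    | _ => let n := vindex x l' in constr:(S n)
    end
  end.

Ltac vreify t l :=
  lazymatch t with
  | vadd ?a ?b =>
    let a := vreify a l in let b := vreify b l in constr:(VPlus a b)
  | vsub ?a ?b =>
    let a := vreify a l in let b := vreify b l in constr:(VPlus a (VOpp b))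
  | vopp ?a => let a := vreify a l in constr:(VOpp a)
  | vscal ?c ?a => let a := vreify a l in constr:(VScal c a)
  | vzero => constr:(VZero)
  | _ => let n := vindex t l in constr:(VAtom n)
  end.

(** Decides equalities between two linear combinations of vectors by comparing
    coefficients; those that are not equal as ring expressions are returned. *)
Ltac vec :=
  lazymatch goal with
  | |- @eq ?T ?a ?b =>
    let l := vatoms a (@nil T) in
    let l := vatoms b l in
    let a' := vreify a l in
    let b' := vreify b l in
    refine (vden_eq l a' b' _);
    cbn [vsame length vcoef Nat.eqb];
    repeat split; try ring
  end.

(** * Elementary estimates *)

Lemma mul_div_le k x e : 0 < k -> x <= e / k -> k * x <= e.
Proof.
intros Hk Hx; replace e with (k * (e / k)) by (field; lra).
apply Rmult_le_compat_l; lra.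
Qed.

Lemma mul_div_lt k x e : 0 < k -> x < e / k -> k * x < e.
Proof.
intros Hk Hx; replace e with (k * (e / k)) by (field; lra).
apply Rmult_lt_compat_l; lra.
Qed.

Lemma le_div k x e : 0 < k -> k * x <= e -> x <= e / k.
Proof.
intros Hk Hx; apply Rmult_le_reg_l with k; auto.
replace (k * (e / k)) with e by (field; lra); auto.
Qed.

Lemma exp_decay_le_1 w t : 0 <= w -> 0 <= t -> exp (- w * t) <= 1.
Proof.
intros Hw Ht; rewrite <- exp_0.
destruct (Req_dec (- w * t) 0) as [->|Hn]; [lra|].
apply Rlt_le, exp_increasing; nra.
Qed.

Lemma exp_opp_mult w t : exp (- w * t) * exp (w * t) = 1.
Proof. rewrite <- exp_plus, <- exp_0; f_equal; ring. Qed.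

Lemma exp_decay_small C w e :
  0 <= C -> 0 < w -> 0 < e -> exists t, 0 <= t /\ exp (- w * t) * C < e.
Proof.
intros HC Hw He; set (b := (C + 1) / e).
assert (Hb : 0 < b) by (apply Rdiv_lt_0_compat; lra).
exists (b / w); split; [apply Rlt_le, Rdiv_lt_0_compat; auto|].
pose proof (exp_opp_mult w (b / w)) as Hinv; pose proof (exp_pos (- w * (b / w))).
assert (Hexp : 1 + b < exp (w * (b / w))).
  replace (w * (b / w)) with b by (field; lra); apply exp_ineq1; lra.
set (em := exp (- w * (b / w))) in *.
assert (em * (1 + b) < 1) by (rewrite <- Hinv; apply Rmult_lt_compat_l; lra).
assert (C + 1 = e * b) by (unfold b; field; lra); nra.
Qed.

Lemma half_pow_small C e : 0 <= C -> 0 < e -> exists n, C * (/ 2) ^ n < e.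
Proof.
intros HC He.
destruct (pow_lt_1_zero (/ 2) ltac:(rewrite Rabs_pos_eq; lra) (e / (C + 1)))
  as [n Hn]; [apply Rdiv_lt_0_compat; lra|].
exists n; specialize (Hn n (Nat.le_refl n)); pose proof (pow_lt (/ 2) n ltac:(lra)).
rewrite Rabs_pos_eq in Hn by lra; apply mul_div_lt in Hn; lra.
Qed.

(** * Norm estimates and one-sided expansions *)

Section Norms.
Context {E : NormedModule R_AbsRing}.
Implicit Types x y z : E.

Lemma norm_vzero : norm (vzero : E) = 0.
Proof. exact norm_zero. Qed.

Lemma norm_vopp x : norm (vopp x) = norm x.
Proof. exact (norm_opp x). Qed.

Lemma norm_le_plus x y z : x = y [+] z -> norm x <= norm y + norm z.
Proof. intros ->; exact (norm_triangle y z). Qed.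

Lemma norm_add_le x y : norm (x [+] y) <= norm x + norm y.
Proof. exact (norm_triangle x y). Qed.

Lemma norm_minus_sym x y : norm (x [-] y) = norm (y [-] x).
Proof. rewrite <- (norm_vopp (x [-] y)); f_equal; vec. Qed.

Lemma norm_minus_le x y : norm (x [-] y) <= norm x + norm y.
Proof. rewrite <- (norm_vopp y); exact (norm_triangle x (vopp y)). Qed.

Lemma norm_scal_eq (a : R) x : norm (a [*] x) = Rabs a * norm x.
Proof.
apply Rle_antisym; [exact (norm_scal (a : R_AbsRing) x)|].
destruct (Req_dec a 0) as [->|Ha].
  rewrite Rabs_R0, Rmult_0_l; apply norm_ge_0.
replace (norm x) with (norm ((/ a) [*] (a [*] x)))
  by (f_equal; vec; field; auto).
assert (H := norm_scal ((/ a)%R : R_AbsRing) (a [*] x)).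
change (norm ((/ a) [*] (a [*] x)) <= Rabs (/ a) * norm (a [*] x)) in H.
rewrite Rabs_inv in H.
assert (Hp : 0 < Rabs a) by now apply Rabs_pos_lt.
apply Rle_trans with (Rabs a * (/ Rabs a * norm (a [*] x))).
  apply Rmult_le_compat_l; lra.
right; field; lra.
Qed.

Lemma norm_scal_pos (a : R) x : 0 <= a -> norm (a [*] x) = a * norm x.
Proof. intros Ha; rewrite norm_scal_eq; f_equal; apply Rabs_pos_eq, Ha. Qed.

Lemma norm_minus_lt0 x y : norm (x [-] y) <= 0 -> x = y.
Proof.
intros H; assert (H0 : x [-] y = vzero).
  apply norm_eq_zero; pose proof (norm_ge_0 (x [-] y)); lra.
transitivity ((x [-] y) [+] y); [vec|rewrite H0; vec].
Qed.

Lemma eq_of_small_distance x y :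
  (forall e, 0 < e -> norm (x [-] y) <= e) -> x = y.
Proof.
intros H; apply norm_minus_lt0, Rnot_lt_le; intros Hn.
specialize (H (norm (x [-] y) / 2)); lra.
Qed.

End Norms.

Section Expansions.
Context {E : NormedModule R_AbsRing}.

(** [r s = o(s)] as [s] decreases to [0]. *)
Definition small_o (r : R -> E) : Prop :=
  forall e, 0 < e -> exists d, 0 < d /\ forall s, 0 < s < d -> norm (r s) <= e * s.

Lemma small_o_ext (q r : R -> E) :
  (forall s, 0 < s -> q s = r s) -> small_o q -> small_o r.
Proof.
intros Heq Hq e He; destruct (Hq e He) as [d [Hd H]].
exists d; split; auto; intros s Hs; rewrite <- Heq; [auto|lra].
Qed.

Lemma small_o_plus (q r : R -> E) :
  small_o q -> small_o r -> small_o (fun s => q s [+] r s).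
Proof.
intros Hq Hr e He.
destruct (Hq (e / 2)) as [d [Hd H]]; [lra|].
destruct (Hr (e / 2)) as [d' [Hd' H']]; [lra|].
exists (Rmin d d'); split; [now apply Rmin_glb_lt|]; intros s [Hs0 Hs].
pose proof (Rmin_l d d'); pose proof (Rmin_r d d').
specialize (H s ltac:(lra)); specialize (H' s ltac:(lra)).
pose proof (norm_add_le (q s) (r s)); lra.
Qed.

Lemma small_o_zero : small_o (fun _ => vzero).
Proof.
intros e He; exists 1; split; [lra|]; intros s Hs.
rewrite norm_vzero; nra.
Qed.

Lemma small_o_vanishing (c : R -> E) :
  (forall e, 0 < e -> exists d, 0 < d /\ forall s, 0 < s < d -> norm (c s) <= e) ->
  small_o (fun s => s [*] c s).
Proof.
intros H e He; destruct (H e He) as [d [Hd Hc]]; exists d; split; auto.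
intros s Hs; rewrite norm_scal_pos by lra; specialize (Hc s Hs); nra.
Qed.

End Expansions.

Lemma small_o_le {E F : NormedModule R_AbsRing} (k d0 : R) (q : R -> E) (r : R -> F) :
  0 < d0 -> (forall s, 0 < s < d0 -> norm (r s) <= k * norm (q s)) ->
  small_o q -> small_o r.
Proof.
intros Hd0 Hle Hq e He.
assert (Hk : 0 < Rabs k + 1) by (pose proof (Rabs_pos k); lra).
destruct (Hq (e / (Rabs k + 1))) as [d [Hd H]].
  now apply Rdiv_lt_0_compat.
exists (Rmin d d0); split; [now apply Rmin_glb_lt|]; intros s Hs.
pose proof (Rmin_l d d0); pose proof (Rmin_r d d0).
specialize (H s ltac:(lra)); specialize (Hle s ltac:(lra)).
pose proof (norm_ge_0 (q s)); pose proof (Rle_abs k).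
assert (k * norm (q s) <= (Rabs k + 1) * (e / (Rabs k + 1) * s)) by nra.
replace (e * s) with ((Rabs k + 1) * (e / (Rabs k + 1) * s)) by (field; lra).
lra.
Qed.

Section BoundedOperators.
Context {E F : NormedModule R_AbsRing}.
Implicit Types S T : bounded_op E F.

Lemma bo_add S x y : S (x [+] y) = S x [+] S y.
Proof. apply (linear_plus _ (bo_linear S)). Qed.

Lemma bo_scale S (a : R) x : S (a [*] x) = a [*] S x.
Proof. apply (linear_scal _ (bo_linear S)). Qed.

Lemma bo_0 S : S vzero = vzero.
Proof. apply (linear_zero _ (bo_linear S)). Qed.

Lemma bo_neg S x : S (vopp x) = vopp (S x).
Proof. apply (linear_opp _ _ (bo_linear S)). Qed.

Lemma bo_sub S x y : S (x [-] y) = S x [-] S y.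
Proof. change (S (x [+] vopp y) = S x [+] vopp (S y)); now rewrite bo_add, bo_neg. Qed.

Lemma small_o_map S (r : R -> E) : small_o r -> small_o (fun s => S (r s)).
Proof.
apply (small_o_le (op_norm S) 1); [lra|]; intros s _; apply op_norm_bound.
Qed.

End BoundedOperators.

Ltac bo_linear := repeat (rewrite bo_add || rewrite bo_sub || rewrite bo_scale
  || rewrite bo_neg || rewrite bo_0).

(** The expansion to first order of a mild solution [v] of [v' = A v + l] at time
    [t], where [T] is the semigroup of [A]: it makes sense without [v t] being in the domain. *)
Definition mild_derivative {E : NormedModule R_AbsRing} (T : R -> bounded_op E E)
  (v : R -> E) (t : R) (l : E) : Prop :=
  small_o (fun s => v (t + s) [-] T s (v t) [-] s [*] l).

Definition right_derivative {E : NormedModule R_AbsRing} (v : R -> E) (t : R) (l : E) : Prop :=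
  small_o (fun s => v (t + s) [-] v t [-] s [*] l).

Section MildDerivatives.
Context {E : NormedModule R_AbsRing} (T : R -> bounded_op E E).
Implicit Types u v : R -> E.

Lemma small_o_scal a (r : R -> E) : small_o r -> small_o (fun s => a [*] r s).
Proof.
apply (small_o_le (Rabs a) 1); [lra|]; intros s _; rewrite norm_scal_eq; lra.
Qed.

Lemma small_o_minus (q r : R -> E) :
  small_o q -> small_o r -> small_o (fun s => q s [-] r s).
Proof.
intros Hq Hr.
apply small_o_ext with (2 := small_o_plus _ _ Hq (small_o_scal (-1) _ Hr)).
intros s _; vec.
Qed.

Lemma mild_derivative_add u v t l m :
  mild_derivative T u t l -> mild_derivative T v t m ->
  mild_derivative T (fun s => u s [+] v s) t (l [+] m).
Proof.
intros Hu Hv; apply small_o_ext with (2 := small_o_plus _ _ Hu Hv).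
intros s _; bo_linear; vec.
Qed.

Lemma mild_derivative_scal a v t l :
  mild_derivative T v t l -> mild_derivative T (fun s => a [*] v s) t (a [*] l).
Proof.
intros Hv; apply small_o_ext with (2 := small_o_scal a _ Hv).
intros s _; bo_linear; vec.
Qed.

Lemma mild_derivative_sub u v t l m :
  mild_derivative T u t l -> mild_derivative T v t m ->
  mild_derivative T (fun s => u s [-] v s) t (l [-] m).
Proof.
intros Hu Hv; apply small_o_ext with (2 := small_o_minus _ _ Hu Hv).
intros s _; bo_linear; vec.
Qed.

End MildDerivatives.

Section RightDerivatives.
Context {E : NormedModule R_AbsRing}.
Implicit Types u v : R -> E.

Lemma right_derivative_add u v t l m :
  right_derivative u t l -> right_derivative v t m ->
  right_derivative (fun s => u s [+] v s) t (l [+] m).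
Proof.
intros Hu Hv; apply small_o_ext with (2 := small_o_plus _ _ Hu Hv); intros s _; vec.
Qed.

Lemma right_derivative_scal a v t l :
  right_derivative v t l -> right_derivative (fun s => a [*] v s) t (a [*] l).
Proof.
intros Hv; apply small_o_ext with (2 := small_o_scal a _ Hv); intros s _; vec.
Qed.

Lemma right_derivative_sub u v t l m :
  right_derivative u t l -> right_derivative v t m ->
  right_derivative (fun s => u s [-] v s) t (l [-] m).
Proof.
intros Hu Hv; apply small_o_ext with (2 := small_o_minus _ _ Hu Hv); intros s _; vec.
Qed.

End RightDerivatives.

(** * Continuity in terms of norms *)

Section Continuity.
Context {T : UniformSpace} {E : NormedModule R_AbsRing}.

Lemma continuous_norm_iff (f : T -> E) x :
  continuous f x <->
  (forall e, 0 < e -> locally x (fun y => norm (f y [-] f x) < e)).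
Proof.
eapply iff_trans.
  apply (filterlim_locally_ball_norm (K := R_AbsRing) (F := locally x) f (f x)).
split.
- intros H e He; exact (H (mkposreal e He)).
- intros H [e He]; exact (H e He).
Qed.

End Continuity.

Lemma continuous_R_iff {E : NormedModule R_AbsRing} (w : R -> E) t :
  continuous w t <->
  (forall e, 0 < e -> exists d, 0 < d /\
     forall s, Rabs (s - t) < d -> norm (w s [-] w t) < e).
Proof.
rewrite continuous_norm_iff; split; intros H e He.
- destruct (H e He) as [[d Hd] Hs]; exists d; split; auto.
- destruct (H e He) as [d [Hd Hs]]; exists (mkposreal d Hd); exact Hs.
Qed.

Lemma continuous_ball_iff {E F : NormedModule R_AbsRing} (f : E -> F) x :
  continuous f x <->
  (forall e, 0 < e -> exists d, 0 < d /\
     forall y, norm (y [-] x) < d -> norm (f y [-] f x) < e).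
Proof.
rewrite continuous_norm_iff; split; intros H e He.
- destruct (locally_norm_le_locally x _ (H e He)) as [[d Hd] Hs].
  exists d; split; auto.
- destruct (H e He) as [d [Hd Hs]]; apply locally_le_locally_norm.
  exists (mkposreal d Hd); exact Hs.
Qed.

Lemma lipschitz_continuous {E F : NormedModule R_AbsRing} (f : E -> F) k :
  (forall x y, norm (f x [-] f y) <= k * norm (x [-] y)) -> forall x, continuous f x.
Proof.
intros Hf x; apply continuous_ball_iff; intros e He.
pose proof (Rabs_pos k); pose proof (Rle_abs k).
exists (e / (Rabs k + 1)); split; [apply Rdiv_lt_0_compat; lra|]; intros y Hy.
apply Rle_lt_trans with (1 := Hf y x).
apply Rle_lt_trans with ((Rabs k + 1) * norm (y [-] x)).
  pose proof (norm_ge_0 (y [-] x)); nra.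
apply mul_div_lt; [lra|exact Hy].
Qed.

Lemma small_o_right_limit {E : NormedModule R_AbsRing} (q : R -> E) (y : E) :
  filterlim (fun t => (/ t) [*] q t) (at_right 0) (locally y) <->
  small_o (fun t => q t [-] t [*] y).
Proof.
eapply iff_trans; [apply (filterlim_locally_ball_norm (K := R_AbsRing)
  (F := at_right 0) (fun t => (/ t) [*] q t) y)|]; split.
- intros H e He; destruct (H (mkposreal e He)) as [[d Hd] Hs].
  exists d; split; auto; intros s [Hs0 Hsd].
  assert (Hb : norm ((/ s) [*] q s [-] y) < e).
    apply (Hs s); [|lra].
    change (Rabs (s - 0) < d); rewrite Rabs_pos_eq; lra.
  replace (q s [-] s [*] y)
    with (s [*] ((/ s) [*] q s [-] y))
    by (vec; field; lra).
  rewrite norm_scal_pos by lra; nra.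
- intros H [e He]; destruct (H (e / 2)) as [d [Hd Hs]]; [lra|].
  exists (mkposreal d Hd); intros s Hb Hs0.
  assert (Hsd : Rabs (s - 0) < d) by exact Hb; clear Hb.
  rewrite Rabs_pos_eq in Hsd by lra.
  change (norm ((/ s) [*] q s [-] y) < e).
  specialize (Hs s ltac:(lra)).
  replace ((/ s) [*] q s [-] y)
    with ((/ s) [*] (q s [-] s [*] y))
    by (vec; field; lra).
  pose proof (Rinv_0_lt_compat s Hs0).
  rewrite norm_scal_pos by lra.
  apply Rle_lt_trans with (/ s * (e / 2 * s)); [nra|].
  replace (/ s * (e / 2 * s)) with (e / 2) by (field; lra); lra.
Qed.

(** * Upper right Dini derivatives *)

(** The upper right Dini derivative of [phi] at [t] is at most [m]. An upper bound is
    all that a norm of a mild solution admits: it may fall faster than expected,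
    but it cannot rise faster. *)
Definition dini_le (phi : R -> R) (t m : R) : Prop :=
  forall e, 0 < e -> exists d, 0 < d /\
    forall s, 0 < s < d -> phi (t + s) <= phi t + s * (m + e).

Lemma continuous_R_R_iff (phi : R -> R) t :
  continuous phi t <->
  (forall e, 0 < e -> exists d, 0 < d /\
     forall s, Rabs (s - t) < d -> Rabs (phi s - phi t) < e).
Proof. exact (continuous_R_iff (E := R_NormedModule) phi t). Qed.

(** For every small [eta > 0] the function stays below the line [m + eta * t]: were
    there a last time up to which it does, the bound at that time would extend this
    a little further. The bound is only required where [phi t <= m + sigma], so that
    the lemma applies to estimates that hold below a threshold. *)
Lemma dini_nonincreasing (phi : R -> R) (b m sigma : R) :
  (forall t, continuous phi t) -> 0 < sigma -> phi 0 <= m ->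
  (forall t, 0 <= t < b -> phi t <= m + sigma -> dini_le phi t 0) ->
  forall t, 0 <= t <= b -> phi t <= m.
Proof.
intros Hc Hsig H0 Hd t Ht.
destruct (Rle_or_lt (phi t) m) as [|Hbad]; [auto|exfalso].
assert (Hb : 0 <= b) by lra.
(* The slope is so small that the line stays below [m + sigma] and below [phi t]. *)
set (eta := Rmin (sigma / (b + 1)) ((phi t - m) / (2 * (b + 1)))).
assert (Heta : 0 < eta).
  apply Rmin_glb_lt; apply Rdiv_lt_0_compat; lra.
assert (Hes : eta * b <= sigma).
  apply Rle_trans with (sigma / (b + 1) * (b + 1)); [|right; field; lra].
  assert (eta <= sigma / (b + 1)) by apply Rmin_l.
  assert (0 < sigma / (b + 1)) by (apply Rdiv_lt_0_compat; lra); nra.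
assert (Het : eta * b < phi t - m).
  apply Rlt_le_trans with ((phi t - m) / (2 * (b + 1)) * (2 * (b + 1)));
    [|right; field; lra].
  assert (eta <= (phi t - m) / (2 * (b + 1))) by apply Rmin_r.
  assert (0 < (phi t - m) / (2 * (b + 1))) by (apply Rdiv_lt_0_compat; lra); nra.
set (S := fun u => 0 <= u <= b /\ forall r, 0 <= r <= u -> phi r <= m + eta * r).
destruct (completeness S) as [c [Hub Hlub]].
  exists b; intros u [Hu _]; lra.
  exists 0; split; [lra|]; intros r Hr; replace r with 0 by lra; lra.
assert (Hc0 : 0 <= c).
  apply Hub; split; [lra|]; intros r Hr; replace r with 0 by lra; lra.
assert (Hcb : c <= b) by (apply Hlub; intros u [Hu _]; lra).
assert (Hlt : forall r, 0 <= r < c -> phi r <= m + eta * r).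
  intros r Hr; destruct (Rle_or_lt (phi r) (m + eta * r)) as [|Hn]; [auto|].
  assert (c <= r); [|lra]; apply Hlub; intros u [Hu HS].
  destruct (Rle_or_lt u r); [auto|]; specialize (HS r); lra.
assert (Hcc : phi c <= m + eta * c).
  destruct (Rle_or_lt (phi c) (m + eta * c)) as [|Hn]; [auto|exfalso].
  destruct (Req_dec c 0) as [->|Hc1]; [lra|].
  destruct (proj1 (continuous_R_R_iff phi c) (Hc c) (phi c - (m + eta * c)))
    as [d [Hd0 Hdc]]; [lra|].
  set (r := Rmax 0 (c - d / 2)).
  assert (Hr : 0 <= r < c /\ c - d / 2 <= r).
    unfold r; repeat split; [apply Rmax_l| |apply Rmax_r].
    apply Rmax_lub_lt; lra.
  specialize (Hdc r); specialize (Hlt r ltac:(lra)).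
  rewrite (Rabs_left (r - c)) in Hdc by lra.
  specialize (Hdc ltac:(lra)); apply Rabs_def2 in Hdc; nra.
destruct (Req_dec c b) as [->|Hne].
  assert (Htb : phi t <= m + eta * t).
    destruct (Req_dec t b) as [->|]; [auto|apply Hlt; lra].
  nra.
destruct (Hd c ltac:(lra) ltac:(nra) eta Heta) as [d [Hd0 Hdc]].
set (s := Rmin d (b - c) / 2).
assert (Hs : 0 < s /\ s < d /\ s < b - c).
  assert (0 < Rmin d (b - c)) by (apply Rmin_glb_lt; lra).
  pose proof (Rmin_l d (b - c)); pose proof (Rmin_r d (b - c)); unfold s; lra.
assert (c + s <= c); [|lra]; apply Hub; split; [lra|].
intros r Hr; destruct (Rlt_or_le r c); [apply Hlt; lra|].
destruct (Req_dec r c) as [->|]; [auto|].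
specialize (Hdc (r - c) ltac:(lra)); replace (c + (r - c)) with r in Hdc by ring.
lra.
Qed.

Lemma dini_mono phi t m m' : m <= m' -> dini_le phi t m -> dini_le phi t m'.
Proof.
intros Hm H e He; destruct (H e He) as [d [Hd Hs]]; exists d; split; auto.
intros s Hs'; specialize (Hs s Hs'); nra.
Qed.

Lemma dini_plus phi psi t m m' :
  dini_le phi t m -> dini_le psi t m' ->
  dini_le (fun u => phi u + psi u) t (m + m').
Proof.
intros H H' e He.
destruct (H (e / 2)) as [d [Hd Hs]]; [lra|].
destruct (H' (e / 2)) as [d' [Hd' Hs']]; [lra|].
exists (Rmin d d'); split; [now apply Rmin_glb_lt|]; intros s Hs0.
pose proof (Rmin_l d d'); pose proof (Rmin_r d d').
specialize (Hs s ltac:(lra)); specialize (Hs' s ltac:(lra)); lra.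
Qed.

Lemma dini_scale phi t m k :
  0 <= k -> dini_le phi t m -> dini_le (fun u => k * phi u) t (k * m).
Proof.
intros Hk H e He.
destruct (H (e / (k + 1))) as [d [Hd Hs]]; [apply Rdiv_lt_0_compat; lra|].
exists d; split; auto; intros s Hs0; specialize (Hs s Hs0).
assert (k * (e / (k + 1)) <= e).
  apply Rle_trans with ((k + 1) * (e / (k + 1))); [|right; field; lra].
  assert (0 < e / (k + 1)) by (apply Rdiv_lt_0_compat; lra); nra.
apply Rle_trans with (k * (phi t + s * (m + e / (k + 1)))); nra.
Qed.

Lemma derive_right_expansion (phi : R -> R) t l :
  is_derive phi t l ->
  forall e, 0 < e -> exists d, 0 < d /\
    forall s, 0 < s < d -> Rabs (phi (t + s) - phi t - s * l) <= e * s.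
Proof.
intros [_ H] e He.
destruct (H t (fun P HP => HP) (mkposreal e He)) as [[d Hd] Hs].
exists d; split; auto; intros s Hs0.
assert (Hb : ball t d (t + s)).
  change (Rabs (t + s - t) < d); replace (t + s - t) with s by ring.
  rewrite Rabs_pos_eq; lra.
specialize (Hs (t + s) Hb).
assert (Hs' : Rabs (phi (t + s) - phi t - (t + s - t) * l) <= e * Rabs (t + s - t))
  by exact Hs.
replace (t + s - t) with s in Hs' by ring.
now rewrite (Rabs_pos_eq s) in Hs' by lra.
Qed.

Lemma dini_of_derive phi t l : is_derive phi t l -> dini_le phi t l.
Proof.
intros H e He; destruct (derive_right_expansion phi t l H e He) as [d [Hd Hs]].
exists d; split; auto; intros s Hs0; specialize (Hs s Hs0).
apply Rabs_le_between in Hs; lra.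
Qed.

Lemma dini_exp phi t m w c :
  dini_le phi t m ->
  dini_le (fun u => exp (w * u) * (phi u - c)) t
    (exp (w * t) * (m + w * (phi t - c))).
Proof.
intros H e He.
set (E := exp (w * t)); assert (HE : 0 < E) by apply exp_pos.
set (e1 := e / (2 * E)).
assert (He1 : 0 < e1) by (apply Rdiv_lt_0_compat; lra).
destruct (H e1 He1) as [d [Hd Hs]].
assert (Hder : is_derive (fun u => exp (w * (u - t)) * (phi t - c + (u - t) * (m + e1)))
  t (m + e1 + w * (phi t - c))).
  auto_derive; [auto|].
  replace (w * (t + - t)) with 0 by ring; rewrite exp_0; ring.
destruct (derive_right_expansion _ _ _ Hder e1 He1) as [d' [Hd' Hs']].
exists (Rmin d d'); split; [now apply Rmin_glb_lt|]; intros s Hs0.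
pose proof (Rmin_l d d'); pose proof (Rmin_r d d').
specialize (Hs s ltac:(lra)); specialize (Hs' s ltac:(lra)).
replace (t - t) with 0 in Hs' by ring.
replace (t + s - t) with s in Hs' by ring.
rewrite Rmult_0_r, exp_0 in Hs'; apply Rabs_le_between in Hs'.
assert (Hw : exp (w * (t + s)) = E * exp (w * s)).
  unfold E; rewrite <- exp_plus; f_equal; ring.
rewrite Hw; pose proof (exp_pos (w * s)).
apply Rle_trans with (E * (exp (w * s) * (phi t - c + s * (m + e1)))).
  rewrite Rmult_assoc; apply Rmult_le_compat_l; [lra|].
  apply Rmult_le_compat_l; lra.
replace (E * (phi t - c) + s * (E * (m + w * (phi t - c)) + e))
  with (E * (phi t - c + s * (m + w * (phi t - c)) + 2 * e1 * s))
  by (unfold e1; field; lra).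
apply Rmult_le_compat_l; lra.
Qed.

Lemma continuous_exp_weight (phi : R -> R) w c t :
  continuous phi t -> continuous (fun u => exp (w * u) * (phi u - c)) t.
Proof.
intros H.
apply (continuous_mult (K := R_AbsRing) (fun u => exp (w * u)) (fun u => phi u - c)).
- apply (ex_derive_continuous (fun u => exp (w * u))); auto_derive; auto.
- apply (continuous_minus (V := R_NormedModule) phi (fun _ => c)); auto.
  apply continuous_const.
Qed.

(** A differential inequality that is only known below a threshold [R0] keeps
    the function below it: it can then be integrated for all times. *)
Lemma dini_decay (phi : R -> R) (w c R0 : R) :
  (forall t, continuous phi t) -> 0 <= w -> 0 <= c -> c < R0 -> phi 0 < R0 ->
  (forall t, 0 <= t -> phi t < R0 -> dini_le phi t (- w * (phi t - c))) ->
  forall t, 0 <= t -> phi t <= c + exp (- w * t) * Rmax 0 (phi 0 - c).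
Proof.
intros Hc Hw Hc0 HcR H0 Hd t Ht.
set (m := Rmax 0 (phi 0 - c)).
assert (Hm : 0 <= m) by apply Rmax_l.
assert (HmR : m < R0 - c) by (apply Rmax_lub_lt; lra).
assert (Hexp : exp (w * t) * (phi t - c) <= m).
  apply (dini_nonincreasing (fun u => exp (w * u) * (phi u - c)) t m ((R0 - c - m) / 2));
    [| lra | | | lra].
  - intros u; now apply continuous_exp_weight.
  - rewrite Rmult_0_r, exp_0; pose proof (Rmax_r 0 (phi 0 - c)); fold m in H; lra.
  - intros u Hu Hle.
    assert (He : 1 <= exp (w * u)).
      destruct (Req_dec (w * u) 0) as [->|]; [rewrite exp_0; lra|].
      apply Rlt_le; rewrite <- exp_0; apply exp_increasing; nra.
    assert (Hphi : phi u < R0).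
      destruct (Rle_or_lt (phi u) c) as [|Hn]; [lra|].
      assert (phi u - c <= exp (w * u) * (phi u - c)) by nra; lra.
    apply dini_mono with (exp (w * u) * (- w * (phi u - c) + w * (phi u - c))).
      right; ring.
    apply dini_exp, Hd; [lra|exact Hphi].
assert (Hinv := exp_opp_mult w t).
pose proof (exp_pos (- w * t)).
assert (exp (- w * t) * (exp (w * t) * (phi t - c)) <= exp (- w * t) * m)
  by (apply Rmult_le_compat_l; lra).
rewrite <- Rmult_assoc, Hinv in H1; lra.
Qed.

Lemma dini_decay_global (phi : R -> R) (w : R) :
  (forall t, continuous phi t) -> 0 <= w -> 0 <= phi 0 ->
  (forall t, 0 <= t -> dini_le phi t (- w * phi t)) ->
  forall t, 0 <= t -> phi t <= exp (- w * t) * phi 0.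
Proof.
intros Hc Hw H0 Hd t Ht.
pose proof (dini_decay phi w 0 (phi 0 + 1) Hc Hw) as H.
rewrite Rminus_0_r, Rmax_right in H by auto.
rewrite <- (Rplus_0_l (exp _ * _)); apply H; try lra.
intros s Hs _; rewrite Rminus_0_r; auto.
Qed.

(** A bound from above passes to the square because [phi] is nonnegative. *)
Lemma dini_square (phi : R -> R) t m :
  (forall u, 0 <= phi u) -> dini_le phi t m ->
  dini_le (fun u => phi u * phi u) t (2 * m * phi t).
Proof.
intros Hpos H e He.
assert (Hp := Hpos t); set (a := phi t) in *.
destruct (H (Rmin 1 (e / (4 * (a + 1))))) as [d [Hd Hs]].
  apply Rmin_glb_lt; [lra|apply Rdiv_lt_0_compat; lra].
set (m1 := Rmin 1 (e / (4 * (a + 1)))) in *.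
assert (Hm0 : 0 < m1) by (apply Rmin_glb_lt; [lra|apply Rdiv_lt_0_compat; lra]).
assert (Hm2 : 4 * (a + 1) * m1 <= e) by (apply mul_div_le; [lra|apply Rmin_r]).
set (b := (m + m1) * (m + m1) + 1); assert (Hb : 0 < b)
  by (pose proof (Rle_0_sqr (m + m1)); unfold Rsqr in *; unfold b; lra).
exists (Rmin d (e / (2 * b))); split; [apply Rmin_glb_lt; [lra|apply Rdiv_lt_0_compat; lra]|].
intros s Hs0; pose proof (Rmin_l d (e / (2 * b))); pose proof (Rmin_r d (e / (2 * b))).
specialize (Hs s ltac:(lra)); fold a in Hs; specialize (Hpos (t + s)).
assert (Hbs : 2 * b * s <= e) by (apply mul_div_le; lra).
apply Rle_trans with ((a + s * (m + m1)) * (a + s * (m + m1))).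
  apply Rmult_le_compat; lra.
assert (Hbs' : s * (s * ((m + m1) * (m + m1))) <= s * (e / 2)).
  apply Rmult_le_compat_l; [lra|]; unfold b in Hbs; nra.
assert (Ham : 2 * a * m1 <= e / 2) by nra.
assert (s * (2 * a * m1) <= s * (e / 2)) by (apply Rmult_le_compat_l; lra).
lra.
Qed.

Section VectorDini.
Context {E : NormedModule R_AbsRing}.

Lemma dini_norm (y : R -> E) t (l c : E) :
  right_derivative y t l -> dini_le (fun u => norm (y u [-] c)) t (norm l).
Proof.
intros H e He; destruct (H e He) as [d [Hd Hs]].
exists d; split; auto; intros s Hs0; specialize (Hs s Hs0).
pose proof (norm_le_plus (y (t + s) [-] c)
  ((y t [-] c) [+] s [*] l)
  (y (t + s) [-] y t [-] s [*] l) ltac:(vec)).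
pose proof (norm_add_le (y t [-] c) (s [*] l)).
rewrite norm_scal_pos in H1 by lra. lra.
Qed.

Lemma continuous_norm_minus (y : R -> E) (c : E) t :
  continuous y t -> continuous (fun u => norm (y u [-] c)) t.
Proof.
intros H; apply (continuous_comp (fun u => y u [-] c) norm).
- apply (continuous_minus y (fun _ => c)); auto; apply continuous_const.
- exact (filterlim_norm _).
Qed.

Lemma continuous_affine (l : E) a t :
  continuous (fun u : R => (u - a) [*] l) t.
Proof.
apply (continuous_scal_l (fun u : R => (u - a)%R : R_AbsRing) l).
apply (continuous_minus (V := R_NormedModule) (fun u => u) (fun _ => a)).
apply continuous_id. apply continuous_const.
Qed.

(** The mean value inequality, for curves that only have a right derivative. *)
Lemma right_derivative_mvi (y dy : R -> E) (l : E) (b K : R) :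
  0 <= b -> (forall t, continuous y t) ->
  (forall t, 0 <= t < b -> right_derivative y t (dy t)) ->
  (forall t, 0 <= t < b -> norm (dy t [-] l) <= K) ->
  norm (y b [-] y 0 [-] b [*] l) <= K * b.
Proof.
intros Hb Hc Hd HK.
set (q := fun u => y u [-] (u - 0) [*] l).
assert (Hq : norm (q b [-] q 0) + - K * b <= 0).
  apply (dini_nonincreasing (fun u => norm (q u [-] q 0) + - K * u) b 0 1);
    [| lra | | | lra].
  - intros t; apply (continuous_plus (V := R_NormedModule)
      (fun u => norm (q u [-] q 0)) (fun u => - K * u)).
    + apply continuous_norm_minus; unfold q.
      apply (continuous_minus y); auto; apply continuous_affine.
    + apply (ex_derive_continuous (fun u => - K * u)); auto_derive; auto.
  - replace (q 0 [-] q 0) with (vzero : E) by vec; rewrite norm_vzero; lra.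
  - intros t Ht _.
    apply dini_mono with (norm (dy t [-] l) + - K).
      specialize (HK t Ht); lra.
    apply (dini_plus (fun u => norm (q u [-] q 0)) (fun u => - K * u)).
    + apply dini_norm; apply small_o_ext with (2 := Hd t Ht); intros s _.
      unfold q; vec.
    + apply dini_of_derive; auto_derive; auto; ring.
replace (y b [-] y 0 [-] b [*] l) with (q b [-] q 0); [lra|].
unfold q; vec.
Qed.

End VectorDini.

(** * Completeness and uniform boundedness *)

Section Completeness.
Context {E : CompleteNormedModule R_AbsRing}.

Lemma cauchy_filter_limit {T : Type} (F : (T -> Prop) -> Prop) {FF : ProperFilter F}
  (f : T -> E) :
  (forall e, 0 < e -> exists P, F P /\
     forall u v, P u -> P v -> norm (f u [-] f v) < e) ->
  exists l : E, forall e, 0 < e -> F (fun u => norm (f u [-] l) < e).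
Proof.
intros H.
destruct (proj1 (filterlim_locally_cauchy (F := F) f)) as [l Hl].
- intros [e He]; destruct (H e He) as [P [HP Huv]]; exists P; split; auto.
  intros u v Hu Hv; apply (norm_compat1 (V := E)); exact (Huv v u Hv Hu).
- exists l; intros e He.
  exact (proj1 (filterlim_locally_ball_norm (K := R_AbsRing) (F := F) f l) Hl
    (mkposreal e He)).
Qed.

Lemma geometric_limit (u : nat -> E) (D q : R) :
  0 <= D -> 0 < q < 1 ->
  (forall n, norm (u (S n) [-] u n) <= D * q ^ n) ->
  exists l, forall n, norm (u n [-] l) <= D * q ^ n / (1 - q).
Proof.
intros HD Hq Hu.
assert (Hdiff : forall n k,
  norm (u (n + k)%nat [-] u n) <= D * q ^ n / (1 - q) - D * q ^ (n + k) / (1 - q)).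
  intros n k; induction k as [|k IH].
  - rewrite Nat.add_0_r; replace (u n [-] u n) with (vzero : E) by vec.
    rewrite norm_vzero; lra.
  - rewrite Nat.add_succ_r.
    pose proof (norm_le_plus (u (S (n + k)) [-] u n) (u (S (n + k)) [-] u (n + k)%nat)
      (u (n + k)%nat [-] u n) ltac:(vec)) as H.
    specialize (Hu (n + k)%nat).
    replace (D * q ^ S (n + k) / (1 - q))
      with (D * q ^ (n + k) / (1 - q) - D * q ^ (n + k)) by (simpl; field; lra).
    lra.
assert (Hpos : forall n, 0 <= D * q ^ n / (1 - q)).
  intros n; apply Rmult_le_pos; [|apply Rlt_le, Rinv_0_lt_compat; lra].
  apply Rmult_le_pos; [lra|apply pow_le; lra].
assert (Hsmall : forall e, 0 < e -> exists N, D * q ^ N / (1 - q) < e).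
  intros e He.
  destruct (pow_lt_1_zero q ltac:(rewrite Rabs_pos_eq; lra) (e * (1 - q) / (D + 1)))
    as [N HN]; [apply Rdiv_lt_0_compat; nra|].
  exists N; specialize (HN N (Nat.le_refl N)); rewrite Rabs_pos_eq in HN
    by (apply pow_le; lra).
  assert (HDq : D * q ^ N <= (D + 1) * q ^ N) by (pose proof (pow_lt q N); nra).
  apply Rmult_lt_reg_r with (1 - q); [lra|].
  replace (D * q ^ N / (1 - q) * (1 - q)) with (D * q ^ N) by (field; lra).
  apply Rle_lt_trans with (1 := HDq).
  apply Rlt_le_trans with ((D + 1) * (e * (1 - q) / (D + 1))).
    apply Rmult_lt_compat_l; lra.
  right; field; lra.
destruct (cauchy_filter_limit eventually u) as [l Hl].
  intros e He; destruct (Hsmall (e / 2)) as [N HN]; [lra|].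
  exists (fun n => (N <= n)%nat); split; [now exists N|].
  intros n m Hn Hm.
  replace n with (N + (n - N))%nat by lia; replace m with (N + (m - N))%nat by lia.
  pose proof (Hdiff N (n - N)%nat); pose proof (Hdiff N (m - N)%nat).
  pose proof (Hpos (N + (n - N))%nat); pose proof (Hpos (N + (m - N))%nat).
  pose proof (norm_le_plus (u (N + (n - N))%nat [-] u (N + (m - N))%nat)
    (u (N + (n - N))%nat [-] u N) (u N [-] u (N + (m - N))%nat) ltac:(vec)).
  rewrite (norm_minus_sym (u N)) in H3; lra.
exists l; intros n; apply Rnot_lt_le; intros Hn.
destruct (Hl (norm (u n [-] l) - D * q ^ n / (1 - q))) as [N HN]; [lra|].
specialize (HN (n + N)%nat ltac:(lia)).
pose proof (Hdiff n N); pose proof (Hpos (n + N)%nat).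
pose proof (norm_le_plus (u n [-] l) (u n [-] u (n + N)%nat) (u (n + N)%nat [-] l)
  ltac:(vec)).
rewrite (norm_minus_sym (u n) (u (n + N)%nat)) in H1; lra.
Qed.

End Completeness.

Section UniformBoundedness.
Context {E : CompleteNormedModule R_AbsRing} {F : NormedModule R_AbsRing}.

(** The operator is large at [v] in the unit ball; at one of the points
    [x + r v] and [x - r v] it is as large as at [r v], whatever [x] is. *)
Lemma op_norm_almost_attained (T : bounded_op E F) (x : E) (r : R) :
  0 < r -> exists x' : E, norm (x' [-] x) <= r /\ 2 / 3 * r * op_norm T <= norm (T x').
Proof.
intros Hr.
assert (Hv : exists v : E, norm v <= 1 /\ 2 / 3 * op_norm T <= norm (T v)).
  apply NNPP; intros Hn.
  assert (Hle : op_norm T <= 2 / 3 * op_norm T).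
    apply (proj2 (op_norm_lub T)); intros b [v [Hv ->]].
    apply Rnot_lt_le; intros Hlt; apply Hn; exists v; split; [exact Hv|lra].
  pose proof (op_norm_ge0 T); apply Hn; exists vzero.
  rewrite bo_0, !norm_vzero; lra.
destruct Hv as [v [Hv1 Hv2]].
assert (Hrv : norm (r [*] v) <= r) by (rewrite norm_scal_pos by lra; nra).
assert (Hsum : 2 * r * norm (T v) <= norm (T (x [+] r [*] v)) + norm (T (x [-] r [*] v))).
  replace (2 * r * norm (T v)) with (norm ((2 * r) [*] T v))
    by (apply norm_scal_pos; lra).
  replace ((2 * r) [*] T v) with (T (x [+] r [*] v) [-] T (x [-] r [*] v))
    by (bo_linear; vec).
  apply norm_minus_le.
destruct (Rle_or_lt (2 / 3 * r * op_norm T) (norm (T (x [+] r [*] v)))).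
- exists (x [+] r [*] v); split; [|auto].
  now replace (x [+] r [*] v [-] x) with (r [*] v) by vec.
- exists (x [-] r [*] v); split; [|nra].
  replace (x [-] r [*] v [-] x) with (vopp (r [*] v)) by vec.
  now rewrite norm_vopp.
Qed.

(** Uniform boundedness by a gliding hump: for the [n]-th operator the point is
    moved by [(1/3)^n] so as to make its value large, and the later moves,
    half as large in total, cannot undo this. *)
Lemma gliding_hump (T : nat -> bounded_op E F) :
  (forall n, 4 ^ n <= op_norm (T n)) ->
  exists x : E, forall n, (4 / 3) ^ n / 6 <= norm (T n x).
Proof.
intros HT.
assert (Hpos : forall n, 0 < (/ 3) ^ n) by (intros n; apply pow_lt; lra).
set (step n x := proj1_sig (constructive_indefinite_description _
  (op_norm_almost_attained (T n) x ((/ 3) ^ n) (Hpos n)))).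
set (u := fix u n : E := match n with O => vzero | S n => step n (u n) end).
assert (Hu : forall n, norm (u (S n) [-] u n) <= (/ 3) ^ n /\
  2 / 3 * (/ 3) ^ n * op_norm (T n) <= norm (T n (u (S n)))).
  intros n; change (u (S n)) with (step n (u n)); unfold step.
  apply proj2_sig.
destruct (geometric_limit u 1 (/ 3)) as [x Hx]; [lra|lra| |].
  intros n; rewrite Rmult_1_l; apply Hu.
exists x; intros n.
destruct (Hu n) as [_ Hn]; specialize (Hx (S n)); specialize (HT n).
pose proof (Hpos n) as Hn0.
simpl in Hx; replace (1 * (/ 3 * (/ 3) ^ n) / (1 - / 3)) with ((/ 3) ^ n / 2) in Hx
  by field.
pose proof (op_norm_bound (T n) (u (S n) [-] x)).
assert (op_norm (T n) * norm (u (S n) [-] x) <= op_norm (T n) * ((/ 3) ^ n / 2)).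
  apply Rmult_le_compat_l; [apply op_norm_ge0|exact Hx].
rewrite bo_sub in H.
pose proof (norm_le_plus (T n (u (S n))) (T n (u (S n)) [-] T n x) (T n x) ltac:(vec)).
assert (Hpow : (4 / 3) ^ n = 4 ^ n * (/ 3) ^ n) by (rewrite <- Rpow_mult_distr; f_equal).
rewrite Hpow; nra.
Qed.

End UniformBoundedness.

Lemma hump_unbounded (b : R) : exists n, b < (4 / 3) ^ n / 6.
Proof.
destruct (INR_unbounded (18 * Rabs b)) as [n Hn]; exists n.
pose proof (poly n (1 / 3) ltac:(lra)); pose proof (Rle_abs b).
replace (4 / 3) with (1 + 1 / 3) by lra; lra.
Qed.

(** * Integrals *)

Section Integrals.
Context {E F : NormedModule R_AbsRing}.

Lemma Riemann_sum_map_linear (S : bounded_op E F) (f : R -> E) ptd :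
  Riemann_sum (fun t => S (f t)) ptd = S (Riemann_sum f ptd).
Proof.
apply SF_cons_ind with (s := ptd); clear ptd; [intros x0|intros h s IH].
- symmetry; exact (bo_0 S).
- rewrite !Riemann_sum_cons, IH.
  change ((SF_h s - fst h) [*] S (f (snd h)) [+] S (Riemann_sum f s)
    = S ((SF_h s - fst h) [*] f (snd h) [+] Riemann_sum f s)).
  now rewrite bo_add, bo_scale.
Qed.

Lemma bo_continuous (S : bounded_op E F) x : continuous S x.
Proof. exact (linear_cont S x (bo_linear S)). Qed.

Lemma is_RInt_map (S : bounded_op E F) (f : R -> E) a b (l : E) :
  is_RInt f a b l -> is_RInt (fun t => S (f t)) a b (S l).
Proof.
intros H; unfold is_RInt.
apply filterlim_ext with
  (fun ptd => S (scal (sign (b - a) : R_AbsRing) (Riemann_sum f ptd))).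
- intros ptd; rewrite Riemann_sum_map_linear; apply (bo_scale S).
- exact (filterlim_comp _ _ _ _ S _ _ _ H (bo_continuous S l)).
Qed.

Lemma integral_bound (f : R -> E) a b (l : E) k :
  a <= b -> is_RInt f a b l -> (forall t, a <= t <= b -> norm (f t) <= k) ->
  norm l <= k * (b - a).
Proof.
intros Hab Hf Hk; rewrite Rmult_comm.
apply (norm_RInt_le f (fun _ => k) a b); auto.
exact (is_RInt_const a b k).
Qed.

Lemma integral_near_constant (f : R -> E) s (l y : E) e :
  0 <= s -> is_RInt f 0 s l -> (forall r, 0 <= r <= s -> norm (f r [-] y) <= e) ->
  norm (l [-] s [*] y) <= e * s.
Proof.
intros Hs Hf He.
replace (e * s) with (e * (s - 0)) by ring.
apply (integral_bound (fun r => f r [-] y)); auto.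
replace (s [*] y) with ((s - 0) [*] y) by vec.
exact (is_RInt_minus f (fun _ => y) 0 s l ((s - 0) [*] y) Hf (is_RInt_const 0 s y)).
Qed.

Lemma is_RInt_shift (f : R -> E) c a b (l : E) :
  is_RInt f (c + a) (c + b) l -> is_RInt (fun r => f (c + r)) a b l.
Proof.
intros H.
apply is_RInt_ext with (fun r => 1 [*] f (1 * r + c)).
- intros r _; replace (1 * r + c) with (c + r) by ring; vec.
- apply (is_RInt_comp_lin f 1 c a b).
  now replace (1 * a + c) with (c + a) by ring; replace (1 * b + c) with (c + b) by ring.
Qed.

End Integrals.

(** * Strongly continuous semigroups *)

Section SemigroupBasics.
Context {E : CompleteNormedModule R_AbsRing}.
Implicit Types T S : R -> bounded_op E E.

Lemma semigroup_right_limit T x : C0_semigroup T ->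
  forall e, 0 < e -> exists d, 0 < d /\ forall s, 0 <= s < d -> norm (T s x [-] x) < e.
Proof.
intros [H0 [_ Hlim]] e He.
destruct (proj1 (filterlim_locally_ball_norm (K := R_AbsRing) (F := at_right 0)
  (fun t => T t x) x) (Hlim x) (mkposreal e He)) as [[d Hd] Hs].
exists d; split; auto; intros s [Hs0 Hsd].
destruct (Req_dec s 0) as [->|Hn].
- rewrite H0; replace (x [-] x) with (vzero : E) by vec; now rewrite norm_vzero.
- apply (Hs s); [|lra]; change (Rabs (s - 0) < d); rewrite Rabs_pos_eq; lra.
Qed.

(** Otherwise the gliding hump provides a point whose orbit is unbounded near the time
    [0], although it converges there. *)
Lemma semigroup_bounded_near_0 T : C0_semigroup T ->
  exists d K, 0 < d /\ 1 <= K /\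
    forall t, 0 <= t <= d -> forall x, norm (T t x) <= K * norm x.
Proof.
intros HT; apply NNPP; intros Hn.
assert (Hbad : forall n : nat, exists t, 0 <= t <= / (INR n + 1) /\ 4 ^ n <= op_norm (T t)).
  intros n; apply NNPP; intros Hno; apply Hn.
  assert (0 < / (INR n + 1)) by (apply Rinv_0_lt_compat; pose proof (pos_INR n); lra).
  exists (/ (INR n + 1)), (4 ^ n); split; [auto|split].
    apply pow_R1_Rle; lra.
  intros t Ht x; apply Rle_trans with (1 := op_norm_bound (T t) x).
  apply Rmult_le_compat_r; [apply norm_ge_0|].
  apply Rnot_lt_le; intros Hlt; apply Hno; exists t; split; [auto|lra].
set (tn n := proj1_sig (constructive_indefinite_description _ (Hbad n))).
assert (Htn : forall n, 0 <= tn n <= / (INR n + 1) /\ 4 ^ n <= op_norm (T (tn n))).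
  intros n; unfold tn; apply proj2_sig.
destruct (gliding_hump (fun n => T (tn n))) as [x Hx]; [intros n; apply Htn|].
destruct (semigroup_right_limit T x HT 1 Rlt_0_1) as [d [Hd Hlim]].
destruct (hump_unbounded (norm x + 1)) as [n1 Hn1].
destruct (INR_unbounded (/ d)) as [n2 Hn2].
set (n := Nat.max n1 n2).
assert (H1 : (4 / 3) ^ n1 <= (4 / 3) ^ n) by (apply Rle_pow; [lra|apply Nat.le_max_l]).
assert (H2 : INR n2 <= INR n) by apply le_INR, Nat.le_max_r.
destruct (Htn n) as [Ht _]; specialize (Hx n).
assert (Hsmall : tn n < d).
  apply Rle_lt_trans with (/ (INR n + 1)); [lra|].
  rewrite <- (Rinv_inv d); apply Rinv_lt_contravar; [|lra].
  apply Rinv_0_lt_compat in Hd; apply Rmult_lt_0_compat; lra.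
specialize (Hlim (tn n) ltac:(lra)).
pose proof (norm_le_plus (T (tn n) x) (T (tn n) x [-] x) x ltac:(vec)); lra.
Qed.

Lemma semigroup_bounded T : C0_semigroup T ->
  forall a, exists K, 1 <= K /\
    forall t, 0 <= t <= a -> forall x, norm (T t x) <= K * norm x.
Proof.
intros HT a; destruct (semigroup_bounded_near_0 T HT) as [d [K [Hd [HK Hb]]]].
destruct HT as [H0 [Hadd _]].
assert (Hn : forall n t, 0 <= t <= INR n * d -> forall x, norm (T t x) <= K ^ n * norm x).
  induction n as [|n IH]; intros t Ht x.
  - simpl in Ht; replace t with 0 by lra; rewrite H0; simpl; lra.
  - rewrite S_INR in Ht; destruct (Rle_or_lt t d) as [Htd|Htd].
    + apply Rle_trans with (1 := Hb t ltac:(lra) x).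
      apply Rmult_le_compat_r; [apply norm_ge_0|].
      rewrite <- (Rmult_1_r K) at 1; apply Rmult_le_compat_l; [lra|].
      now apply pow_R1_Rle.
    + replace t with (d + (t - d)) by ring; rewrite Hadd by lra.
      apply Rle_trans with (1 := Hb d ltac:(lra) _); simpl.
      rewrite Rmult_assoc; apply Rmult_le_compat_l; [lra|].
      apply IH; lra.
destruct (INR_unbounded (a / d)) as [n Hna].
exists (K ^ n); split; [now apply pow_R1_Rle|].
intros t Ht; apply Hn; split; [lra|].
apply Rle_trans with (a / d * d); [|apply Rmult_le_compat_r; lra].
replace (a / d * d) with a by (field; lra); lra.
Qed.

Lemma Rmax0_lipschitz s t : Rabs (Rmax 0 s - Rmax 0 t) <= Rabs (s - t).
Proof.
unfold Rmax; destruct (Rle_dec 0 s), (Rle_dec 0 t); unfold Rabs;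
  repeat destruct Rcase_abs; lra.
Qed.

(** Orbits are extended by a constant to negative times so as to be continuous
    on the whole line. *)
Lemma semigroup_orbit_continuous T x : C0_semigroup T ->
  forall t, continuous (fun s => T (Rmax 0 s) x) t.
Proof.
intros HT t; apply continuous_R_iff; intros e He.
destruct (semigroup_bounded T HT (Rabs t + 1)) as [K [HK Hb]].
destruct (semigroup_right_limit T x HT (e / K)) as [d [Hd Hlim]].
  apply Rdiv_lt_0_compat; lra.
assert (Hle : forall a b, 0 <= a <= b -> b <= Rabs t + 1 -> b - a < d ->
  norm (T b x [-] T a x) < e).
  intros a b Hab Hbt Hd'; replace b with (a + (b - a)) by ring.
  rewrite (proj1 (proj2 HT)) by lra; rewrite <- bo_sub.
  apply Rle_lt_trans with (K * norm (T (b - a) x [-] x)); [apply Hb; lra|].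
  apply Rlt_le_trans with (K * (e / K)); [|right; field; lra].
  apply Rmult_lt_compat_l; [lra|]; apply Hlim; lra.
exists (Rmin d 1); split; [apply Rmin_glb_lt; lra|]; intros s Hs.
pose proof (Rmin_l d 1); pose proof (Rmin_r d 1).
pose proof (Rmax0_lipschitz s t) as Hl.
set (a := Rmax 0 t) in *; set (b := Rmax 0 s) in *.
assert (Ha : 0 <= a) by apply Rmax_l; assert (Hb0 : 0 <= b) by apply Rmax_l.
assert (Hat : a <= Rabs t).
  apply Rmax_lub; [apply Rabs_pos|apply Rle_abs].
assert (Hab : - Rmin d 1 < b - a < Rmin d 1) 
  by (apply Rabs_lt_between; lra).
destruct (Rle_or_lt a b); [apply Hle; lra|].
rewrite norm_minus_sym; apply Hle; lra.
Qed.

(** The local bound on the semigroup makes it jointly continuous in time and space. *)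
Lemma semigroup_convolution_continuous T (b : R -> E) (t s : R) :
  C0_semigroup T -> continuous b s ->
  continuous (fun r => T (Rmax 0 (t - r)) (b r)) s.
Proof.
intros HT Hb; apply continuous_R_iff; intros e He.
destruct (semigroup_bounded T HT (Rabs (t - s) + 1)) as [K [HK HTb]].
destruct (proj1 (continuous_R_iff _ _) Hb (e / 2 / K)) as [d1 [Hd1 H1]].
  apply Rdiv_lt_0_compat; lra.
destruct (proj1 (continuous_R_iff _ _)
  (semigroup_orbit_continuous T (b s) HT (t - s)) (e / 2)) as [d2 [Hd2 H2]]; [lra|].
exists (Rmin 1 (Rmin d1 d2)); split; [repeat apply Rmin_glb_lt; lra|]; intros r Hr.
pose proof (Rmin_l 1 (Rmin d1 d2)); pose proof (Rmin_r 1 (Rmin d1 d2)).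
pose proof (Rmin_l d1 d2); pose proof (Rmin_r d1 d2).
specialize (H1 r ltac:(lra)).
specialize (H2 (t - r)); replace (t - r - (t - s)) with (- (r - s)) in H2 by ring.
rewrite Rabs_Ropp in H2; specialize (H2 ltac:(lra)); cbv beta in H2.
assert (Hin : 0 <= Rmax 0 (t - r) <= Rabs (t - s) + 1).
  split; [apply Rmax_l|]; apply Rmax_lub; [pose proof (Rabs_pos (t - s)); lra|].
  replace (t - r) with ((t - s) + (s - r)) by ring.
  pose proof (Rle_abs (t - s)); pose proof (Rle_abs (s - r)) as Hsr.
  rewrite Rabs_minus_sym in Hsr; lra.
pose proof (norm_le_plus
  (T (Rmax 0 (t - r)) (b r) [-] T (Rmax 0 (t - s)) (b s))
  (T (Rmax 0 (t - r)) (b r [-] b s))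
  (T (Rmax 0 (t - r)) (b s) [-] T (Rmax 0 (t - s)) (b s)) ltac:(bo_linear; vec)).
pose proof (HTb _ Hin (b r [-] b s)).
assert (K * norm (b r [-] b s) < e / 2).
  apply mul_div_lt; lra.
lra.
Qed.

End SemigroupBasics.

Section Generators.
Context {E : CompleteNormedModule R_AbsRing}.
Context (A : unbounded_op E) (T : R -> bounded_op E E).
Hypothesis HT : C0_semigroup T.
Hypothesis HA : generates A T.

Lemma generates_iff x y :
  (uo_dom A x /\ A x = y) <-> small_o (fun t => T t x [-] x [-] t [*] y).
Proof.
eapply iff_trans; [exact (HA x y)|].
exact (small_o_right_limit (fun t => T t x [-] x) y).
Qed.

Lemma generator_expansion x :
  uo_dom A x -> small_o (fun t => T t x [-] x [-] t [*] A x).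
Proof. now intros H; apply generates_iff. Qed.

Lemma generator_scale a x : uo_dom A x ->
  uo_dom A (a [*] x) /\ A (a [*] x) = a [*] A x.
Proof.
intros H; apply generates_iff.
apply (small_o_le (Rabs a) 1 (fun t => T t x [-] x [-] t [*] A x)); [lra| |].
- intros s _; right; rewrite <- norm_scal_eq; f_equal; bo_linear; vec.
- now apply generator_expansion.
Qed.

Lemma semigroup_right_derivative x t :
  0 <= t -> uo_dom A x ->
  right_derivative (fun s => T s x) t (T t (A x)).
Proof.
intros Ht H.
apply small_o_ext with (2 := small_o_map (T t) _ (generator_expansion x H)).
intros s Hs; rewrite (proj1 (proj2 HT)) by lra; bo_linear; vec.
Qed.

Lemma generator_invariant x t :
  0 <= t -> uo_dom A x -> uo_dom A (T t x) /\ A (T t x) = T t (A x).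
Proof.
intros Ht H; apply generates_iff.
apply small_o_ext with (2 := semigroup_right_derivative x t Ht H).
intros s Hs; rewrite Rplus_comm, (proj1 (proj2 HT)) by lra; vec.
Qed.

Lemma RInt_orbit x a b :
  is_RInt (fun s => T (Rmax 0 s) x) a b (RInt (fun s => T (Rmax 0 s) x) a b).
Proof.
apply RInt_correct, ex_RInt_continuous; intros z _.
now apply semigroup_orbit_continuous.
Qed.

(** [T t] moves the average of an orbit over [[0, h]] by the difference of two
    averages over intervals of length [t], so that averages belong to the domain. *)
Lemma orbit_integral_in_domain x h : 0 < h ->
  uo_dom A (RInt (fun s => T (Rmax 0 s) x) 0 h).
Proof.
intros Hh; set (v := fun s => T (Rmax 0 s) x).
refine (proj1 (proj2 (generates_iff (RInt v 0 h) (v h [-] v 0)) _)).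
intros e He.
assert (Hv : forall r, continuous v r) by (intros r; now apply semigroup_orbit_continuous).
destruct (proj1 (continuous_R_iff v h) (Hv h) (e / 2)) as [d1 [Hd1 H1]]; [lra|].
destruct (proj1 (continuous_R_iff v 0) (Hv 0) (e / 2)) as [d2 [Hd2 H2]]; [lra|].
exists (Rmin d1 d2); split; [now apply Rmin_glb_lt|]; intros t Ht.
pose proof (Rmin_l d1 d2); pose proof (Rmin_r d1 d2).
assert (I1 : is_RInt (fun r => v (t + r)) 0 h (T t (RInt v 0 h))).
  apply is_RInt_ext with (fun r => T t (v r)).
  - intros r Hr; rewrite Rmin_left, Rmax_right in Hr by lra; unfold v.
    rewrite !Rmax_right by lra; symmetry; apply HT; lra.
  - apply is_RInt_map, RInt_orbit.
assert (I2 : is_RInt (fun r => v (t + r)) 0 h (RInt v t (t + h))).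
  apply is_RInt_shift; rewrite Rplus_0_r; apply RInt_orbit.
assert (Heq : T t (RInt v 0 h) [-] RInt v 0 h = RInt v h (h + t) [-] RInt v 0 t).
  rewrite <- (is_RInt_unique _ _ _ _ I1), (is_RInt_unique _ _ _ _ I2).
  assert (C : RInt v 0 t [+] RInt v t (t + h) = RInt v 0 h [+] RInt v h (h + t)).
    transitivity (RInt v 0 (t + h)); [|rewrite (Rplus_comm t h); symmetry];
      apply (RInt_Chasles (V := E) v); eexists; apply RInt_orbit.
  transitivity ((RInt v 0 t [+] RInt v t (t + h)) [-] RInt v 0 t [-] RInt v 0 h);
    [vec|rewrite C; vec].
rewrite Heq.
assert (B1 : norm (RInt v h (h + t) [-] t [*] v h) <= e / 2 * t).
  apply (integral_near_constant (fun r => v (h + r))); [lra| |].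
  - apply is_RInt_shift; rewrite Rplus_0_r; apply RInt_orbit.
  - intros r Hr; apply Rlt_le, H1.
    replace (h + r - h) with r by ring; rewrite Rabs_pos_eq; lra.
assert (B2 : norm (RInt v 0 t [-] t [*] v 0) <= e / 2 * t).
  apply (integral_near_constant v); [lra|apply RInt_orbit|].
  intros r Hr; apply Rlt_le, H2; rewrite Rabs_pos_eq; lra.
pose proof (norm_le_plus (RInt v h (h + t) [-] RInt v 0 t [-] t [*] (v h [-] v 0))
  (RInt v h (h + t) [-] t [*] v h) (vopp (RInt v 0 t [-] t [*] v 0)) ltac:(vec)).
rewrite norm_vopp in H3; lra.
Qed.

Lemma domain_dense x e : 0 < e -> exists x', uo_dom A x' /\ norm (x' [-] x) < e.
Proof.
intros He; set (v := fun s => T (Rmax 0 s) x).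
destruct (proj1 (continuous_R_iff v 0) (semigroup_orbit_continuous T x HT 0) (e / 2))
  as [d [Hd H]]; [lra|].
set (h := d / 2).
exists ((/ h) [*] RInt v 0 h); split.
  apply generator_scale, orbit_integral_in_domain; unfold h; lra.
assert (B : norm (RInt v 0 h [-] h [*] v 0) <= e / 2 * h).
  apply (integral_near_constant v); [unfold h; lra|apply RInt_orbit|].
  intros r Hr; apply Rlt_le, H; unfold h in Hr; rewrite Rabs_pos_eq; lra.
assert (Hv0 : v 0 = x) by (unfold v; rewrite Rmax_left by lra; apply HT).
rewrite Hv0 in B.
replace ((/ h) [*] RInt v 0 h [-] x) with ((/ h) [*] (RInt v 0 h [-] h [*] x))
  by (vec; field; unfold h; lra).
assert (Hh : 0 < / h) by (apply Rinv_0_lt_compat; unfold h; lra).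
rewrite norm_scal_pos by lra.
apply Rle_lt_trans with (/ h * (e / 2 * h)); [apply Rmult_le_compat_l; lra|].
replace (/ h * (e / 2 * h)) with (e / 2) by (field; unfold h; lra); lra.
Qed.

End Generators.

(** The curve [s |-> T (t - s) (S s x)] has zero derivative when [x] is in the
    domain; it joins [T t x] to [S t x]. *)
Lemma semigroup_unique {E : CompleteNormedModule R_AbsRing} (A : unbounded_op E)
  (T S : R -> bounded_op E E) :
  C0_semigroup T -> C0_semigroup S -> generates A T -> generates A S ->
  forall t x, 0 <= t -> T t x = S t x.
Proof.
intros HT HS HTA HSA t x Ht.
destruct (semigroup_bounded T HT t) as [K [HK HTb]].
destruct (semigroup_bounded S HS t) as [K' [HK' HSb]].
assert (Hdom : forall y, uo_dom A y -> T t y = S t y).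
  intros y Hy.
  set (v := fun s => T (Rmax 0 (t - s)) (S (Rmax 0 s) y)).
  assert (H : norm (v t [-] v 0 [-] t [*] vzero) <= 0 * t).
  { apply (right_derivative_mvi v (fun _ => vzero) vzero t 0); [lra| | |].
    - intros s; apply (semigroup_convolution_continuous T (fun r => S (Rmax 0 r) y));
        auto; now apply semigroup_orbit_continuous.
    - intros s Hs.
      set (z := S s y).
      assert (Hz : uo_dom A z) by (apply (generator_invariant A S HS HSA y s); [lra|auto]).
      apply (small_o_le K (t - s) (fun h => (S h z [-] z [-] h [*] A z)
        [-] (T h z [-] z [-] h [*] A z))); [lra| |].
      + intros h Hh; unfold v.
        replace (T (Rmax 0 (t - (s + h))) (S (Rmax 0 (s + h)) y) [-]
          T (Rmax 0 (t - s)) (S (Rmax 0 s) y) [-] h [*] vzero)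
          with (T (t - (s + h)) (S h z [-] T h z)).
        * eapply Rle_trans; [apply HTb; lra|]; right; do 2 f_equal; vec.
        * rewrite !Rmax_right by lra; rewrite (Rplus_comm s h).
          rewrite (proj1 (proj2 HS) h s) by lra.
          replace (t - s) with ((t - (h + s)) + h) by ring.
          rewrite (proj1 (proj2 HT) (t - (h + s)) h) by lra.
          fold z; bo_linear; vec.
      + apply small_o_minus; now apply generator_expansion.
    - intros s _; replace (vzero [-] vzero) with (vzero : E) by vec.
      rewrite norm_vzero; lra. }
  rewrite Rmult_0_l in H.
  replace (v t [-] v 0 [-] t [*] vzero) with (v t [-] v 0) in H by vec.
  apply norm_minus_lt0 in H; unfold v in H.
  rewrite !Rminus_0_r, (Rmax_right 0 t), Rmax_left, (Rmax_left 0 0) in H by lra.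
  rewrite (proj1 HT), (proj1 HS) in H; now symmetry.
apply eq_of_small_distance; intros e He.
destruct (domain_dense A T HT HTA x (e / (K + K'))) as [y [Hy Hyx]].
  apply Rdiv_lt_0_compat; lra.
pose proof (norm_le_plus (T t x [-] S t x) (S t (y [-] x)) (vopp (T t (y [-] x)))
  ltac:(bo_linear; rewrite (Hdom y Hy); vec)).
rewrite norm_vopp in H.
pose proof (HTb t ltac:(lra) (y [-] x)); pose proof (HSb t ltac:(lra) (y [-] x)).
assert ((K + K') * norm (y [-] x) <= e) by (apply mul_div_le; lra).
lra.
Qed.

(** * Mild solutions *)

Section Duhamel.
Context {E : CompleteNormedModule R_AbsRing} (T : R -> bounded_op E E).
Hypothesis HT : C0_semigroup T.

(** Variation of constants with forcing term [b] and initial value [w0]. *)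
Definition duhamel (b : R -> E) (w0 : E) (w : R -> E) : Prop :=
  forall t, 0 <= t -> is_RInt (fun s => T (t - s) (b s)) 0 t (w t [-] T t w0).

Lemma duhamel_initial b w0 w : duhamel b w0 w -> w 0 = w0.
Proof.
intros H; specialize (H 0 (Rle_refl 0)).
assert (Hz : w 0 [-] T 0 w0 = vzero).
  rewrite <- (is_RInt_unique _ _ _ _ H); exact (RInt_point 0 _).
rewrite (proj1 HT) in Hz; apply norm_minus_lt0; rewrite Hz, norm_vzero; lra.
Qed.

(** [T s] maps the formula at time [t] to the part of the formula at time [t + s] that
    concerns the forcing before [t]. *)
Lemma duhamel_shift b w0 w t s : duhamel b w0 w -> 0 <= t -> 0 <= s ->
  is_RInt (fun r => T (s - r) (b (t + r))) 0 s (w (t + s) [-] T s (w t)).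
Proof.
intros H Ht Hs.
assert (H1 : is_RInt (fun r => T (t + s - r) (b r)) 0 t (T s (w t [-] T t w0))).
  apply is_RInt_ext with (fun r => T s (T (t - r) (b r))).
  - intros r Hr; rewrite Rmin_left, Rmax_right in Hr by lra.
    replace (t + s - r) with (s + (t - r)) by ring.
    symmetry; apply HT; lra.
  - apply is_RInt_map, H, Ht.
assert (H2 : is_RInt (fun r => T (t + s - r) (b r)) t (t + s)
  (vopp (T s (w t [-] T t w0)) [+] (w (t + s) [-] T (t + s) w0))).
  apply (is_RInt_Chasles _ t 0 (t + s)).
  - apply (is_RInt_swap (V := E)), H1.
  - apply H; lra.
replace (w (t + s) [-] T s (w t))
  with (vopp (T s (w t [-] T t w0)) [+] (w (t + s) [-] T (t + s) w0)).
- apply is_RInt_ext with (fun r => T (t + s - (t + r)) (b (t + r))).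
  + intros r _; now replace (t + s - (t + r)) with (s - r) by ring.
  + apply (is_RInt_shift (fun r => T (t + s - r) (b r))).
    now rewrite Rplus_0_r.
- rewrite (Rplus_comm t s) at 2; rewrite (proj1 (proj2 HT) s t) by lra.
  bo_linear; vec.
Qed.

Lemma duhamel_step b w0 w t s y K a c :
  duhamel b w0 w -> 0 <= t -> 0 <= s -> 0 <= K ->
  (forall r, 0 <= r <= s -> forall x, norm (T r x) <= K * norm x) ->
  (forall r, 0 <= r <= s -> norm (b (t + r) [-] y) <= a) ->
  (forall r, 0 <= r <= s -> norm (T r y [-] y) <= c) ->
  norm (w (t + s) [-] T s (w t) [-] s [*] y) <= (K * a + c) * s.
Proof.
intros H Ht Hs HK HTb Hb Hy.
apply (integral_near_constant (fun r => T (s - r) (b (t + r)))); auto.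
- now apply (duhamel_shift b w0).
- intros r Hr.
  pose proof (norm_le_plus (T (s - r) (b (t + r)) [-] y)
    (T (s - r) (b (t + r) [-] y)) (T (s - r) y [-] y) ltac:(bo_linear; vec)).
  pose proof (HTb (s - r) ltac:(lra) (b (t + r) [-] y)).
  specialize (Hb r Hr); specialize (Hy (s - r) ltac:(lra)); nra.
Qed.

(** Over a short interval the forcing hardly leaves [b t], which the semigroup hardly
    moves. *)
Lemma duhamel_expansion b w0 w t :
  duhamel b w0 w -> 0 <= t -> continuous b t ->
  mild_derivative T w t (b t).
Proof.
intros H Ht Hb e He.
destruct (semigroup_bounded T HT 1) as [K [HK HTb]].
destruct (proj1 (continuous_R_iff (E := E) b t) Hb (e / 2 / K)) as [d1 [Hd1 H1]].
  apply Rdiv_lt_0_compat; lra.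
destruct (semigroup_right_limit T (b t) HT (e / 2)) as [d2 [Hd2 H2]]; [lra|].
exists (Rmin 1 (Rmin d1 d2)); split; [repeat apply Rmin_glb_lt; lra|]; intros s Hs.
pose proof (Rmin_l 1 (Rmin d1 d2)); pose proof (Rmin_r 1 (Rmin d1 d2)).
pose proof (Rmin_l d1 d2); pose proof (Rmin_r d1 d2).
replace e with (K * (e / 2 / K) + e / 2) at 1 by (field; lra).
apply (duhamel_step b w0); auto; try lra.
- intros r Hr; apply HTb; lra.
- intros r Hr; apply Rlt_le, H1; replace (t + r - t) with r by ring.
  rewrite Rabs_pos_eq; lra.
- intros r Hr; apply Rlt_le, H2; lra.
Qed.

(** Over each of the short intervals [[a, t]] and [[a, u]] the forcing only
    contributes to first order, so that continuity comes from that of the orbit of [w a]. *)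
Lemma duhamel_continuous b w0 w :
  (forall t, continuous b t) -> duhamel b w0 w ->
  forall t, continuous (fun s => w (Rmax 0 s)) t.
Proof.
intros Hb H t; apply (continuous_R_iff (E := E)); intros e He.
set (t' := Rmax 0 t); assert (Ht' : 0 <= t') by apply Rmax_l.
destruct (semigroup_bounded T HT 2) as [K [HK HTb]].
destruct (proj1 (continuous_R_iff (E := E) b t') (Hb t') 1 Rlt_0_1) as [d0 [Hd0 H0]].
set (B := norm (b t') + 1).
assert (HB : 1 <= B) by (pose proof (norm_ge_0 (b t')); unfold B; lra).
set (d := Rmin 1 (Rmin (d0 / 2) (e / 6 / (K * B)))).
assert (HKB : 1 <= K * B) by nra.
assert (Hd : 0 < d).
  repeat apply Rmin_glb_lt; [lra|lra|apply Rdiv_lt_0_compat; lra].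
assert (Hd1 : d <= 1) by apply Rmin_l.
assert (Hd2 : d <= d0 / 2).
  apply Rle_trans with (1 := Rmin_r _ _); apply Rmin_l.
assert (Hd3 : K * B * (2 * d) <= e / 3).
  apply Rle_trans with (K * B * (2 * (e / 6 / (K * B)))); [|right; field; lra].
  apply Rmult_le_compat_l; [lra|].
  assert (d <= e / 6 / (K * B)); [|lra].
  apply Rle_trans with (1 := Rmin_r _ _); apply Rmin_r.
set (a := Rmax 0 (t' - d)).
assert (Ha : 0 <= a) by apply Rmax_l.
assert (Hat : t' - d <= a <= t') by (split; [apply Rmax_r|apply Rmax_lub; lra]).
assert (Hdiff : forall u, a <= u <= t' + d ->
  norm (w u [-] T (u - a) (w a)) <= e / 3).
  intros u Hu.
  pose proof (duhamel_shift b w0 w a (u - a) H Ha ltac:(lra)) as Hint.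
  replace (a + (u - a)) with u in Hint by ring.
  apply Rle_trans with (K * B * (u - a - 0)).
  - apply integral_bound with (2 := Hint); [lra|]; intros r Hr.
    apply Rle_trans with (1 := HTb (u - a - r) ltac:(lra) _).
    apply Rmult_le_compat_l; [lra|].
    assert (Hr' : Rabs (a + r - t') < d0) by (apply Rabs_lt_between; lra).
    specialize (H0 _ Hr').
    pose proof (norm_le_plus (b (a + r)) (b (a + r) [-] b t') (b t') ltac:(vec)).
    unfold B; lra.
  - apply Rle_trans with (K * B * (2 * d)); [|lra].
    apply Rmult_le_compat_l; lra.
destruct (proj1 (continuous_R_iff (E := E) _ _)
  (semigroup_orbit_continuous T (w a) HT (t' - a)) (e / 3)) as [d1 [Hd1' H1]]; [lra|].
exists (Rmin d d1); split; [now apply Rmin_glb_lt|]; intros u Hu.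
pose proof (Rmin_l d d1); pose proof (Rmin_r d d1).
pose proof (Rmax0_lipschitz u t) as Hlip; fold t' in Hlip |- *.
set (u' := Rmax 0 u) in *; assert (Hu' : 0 <= u') by apply Rmax_l.
assert (Hut : - d < u' - t' < d) by (apply Rabs_lt_between; lra).
assert (Hau : a <= u') by (apply Rmax_lub; lra).
specialize (H1 (u' - a)); replace (u' - a - (t' - a)) with (u' - t') in H1 by ring.
specialize (H1 ltac:(lra)); cbv beta in H1; rewrite !Rmax_right in H1 by lra.
pose proof (Hdiff u' ltac:(lra)); pose proof (Hdiff t' ltac:(lra)).
pose proof (norm_le_plus (w u' [-] w t')
  ((w u' [-] T (u' - a) (w a)) [+] (T (u' - a) (w a) [-] T (t' - a) (w a)))
  (T (t' - a) (w a) [-] w t') ltac:(vec)) as Htri.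
pose proof (norm_add_le (w u' [-] T (u' - a) (w a))
  (T (u' - a) (w a) [-] T (t' - a) (w a))).
rewrite (norm_minus_sym (T (t' - a) (w a)) (w t')) in Htri; lra.
Qed.

(* The two truncations at [0] keep the semigroup away from negative times. *)
Definition duhamel_integral (b : R -> E) (w0 : E) (t : R) : E :=
  T (Rmax 0 t) w0 [+]
  RInt (fun r => T (Rmax 0 (Rmax 0 t - r)) (b r)) 0 (Rmax 0 t).

Lemma duhamel_integral_correct b w0 :
  (forall t, continuous b t) -> duhamel b w0 (duhamel_integral b w0).
Proof.
intros Hb t Ht; unfold duhamel_integral; rewrite (Rmax_right 0 t) by lra.
match goal with |- context [_ [+] ?I] =>
  replace (T t w0 [+] I [-] T t w0) with I by vec end.
apply is_RInt_ext with (fun r => T (Rmax 0 (t - r)) (b r)).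
- intros r Hr; rewrite Rmin_left, Rmax_right in Hr by lra.
  now rewrite Rmax_right by lra.
- apply RInt_correct, ex_RInt_continuous; intros z _.
  now apply semigroup_convolution_continuous.
Qed.

Lemma duhamel_integral_continuous b w0 :
  (forall t, continuous b t) -> forall t, continuous (duhamel_integral b w0) t.
Proof.
intros Hb t.
apply continuous_ext with (fun s => duhamel_integral b w0 (Rmax 0 s)).
- intros s; unfold duhamel_integral.
  now rewrite (Rmax_right 0 (Rmax 0 s)) by apply Rmax_l.
- apply (duhamel_continuous b w0); auto; now apply duhamel_integral_correct.
Qed.

Lemma is_RInt_exp_weight c lam t : lam <> 0 ->
  is_RInt (fun r => c * exp (lam * r)) 0 t (c / lam * (exp (lam * t) - 1)).
Proof.
intros Hl.
replace (c / lam * (exp (lam * t) - 1))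
  with (minus (c / lam * exp (lam * t)) (c / lam * exp (lam * 0)))
  by (rewrite Rmult_0_r, exp_0; unfold minus, plus, opp; simpl; ring).
apply (is_RInt_derive (fun r => c / lam * exp (lam * r))); intros r _.
- auto_derive; auto; field; auto.
- apply (ex_derive_continuous (fun r => c * exp (lam * r))); auto_derive; auto.
Qed.

Lemma duhamel_difference b1 b2 w0 w1 w2 K c lam :
  (forall r, 0 <= r -> forall x, norm (T r x) <= K * norm x) ->
  0 <= K -> 0 < lam -> 0 <= c -> duhamel b1 w0 w1 -> duhamel b2 w0 w2 ->
  (forall r, 0 <= r -> norm (b1 r [-] b2 r) <= c * exp (lam * r)) ->
  forall t, 0 <= t -> norm (w1 t [-] w2 t) <= K * c / lam * exp (lam * t).
Proof.
intros HTb HK Hlam Hc H1 H2 Hb t Ht.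
assert (Hint : is_RInt (fun r => T (t - r) (b1 r [-] b2 r)) 0 t (w1 t [-] w2 t)).
  replace (w1 t [-] w2 t) with ((w1 t [-] T t w0) [-] (w2 t [-] T t w0)) by vec.
  apply is_RInt_ext with (fun r => T (t - r) (b1 r) [-] T (t - r) (b2 r)).
  - intros r _; now rewrite bo_sub.
  - apply (is_RInt_minus (V := E)); [now apply H1|now apply H2].
apply Rle_trans with (K * c / lam * (exp (lam * t) - 1)).
- apply (norm_RInt_le (fun r => T (t - r) (b1 r [-] b2 r))
    (fun r => K * c * exp (lam * r)) 0 t); auto.
  + intros r Hr; apply Rle_trans with (1 := HTb (t - r) ltac:(lra) _).
    rewrite Rmult_assoc; apply Rmult_le_compat_l; auto; apply Hb; lra.
  + apply is_RInt_exp_weight; lra.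
- assert (0 <= K * c / lam).
    apply Rmult_le_pos; [nra|apply Rlt_le, Rinv_0_lt_compat; lra].
  nra.
Qed.

(** Picard iteration. With the weight [exp (lam t)], [lam] large, the iterates are
    contracted by the factor [1/2] on the whole half-line at once. *)
Lemma mild_existence (F : E -> E) (K k : R) (w0 : E) :
  (forall r, 0 <= r -> forall x, norm (T r x) <= K * norm x) -> 0 <= K -> 0 <= k ->
  (forall x y, norm (F x [-] F y) <= k * norm (x [-] y)) ->
  exists w, (forall t, continuous w t) /\ duhamel (fun s => F (w s)) w0 w.
Proof.
intros HTb HK Hk HF.
assert (HFc := lipschitz_continuous F k HF).
set (lam := 2 * (K * k) + 1).
assert (Hlam : 1 <= lam) by (assert (0 <= K * k) by nra; unfold lam; lra).
assert (Hhalf : K * k / lam <= / 2).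
  apply Rmult_le_reg_r with lam; [lra|].
  replace (K * k / lam * lam) with (K * k) by (field; lra); unfold lam; lra.
set (D := (K + 1) * norm w0 + K * norm (F w0)).
assert (HD : 0 <= D).
  pose proof (norm_ge_0 w0); pose proof (norm_ge_0 (F w0)); unfold D; nra.
set (Phi w := duhamel_integral (fun s => F (w s)) w0).
set (u := fix u n : R -> E := match n with O => fun _ => w0 | S n => Phi (u n) end).
assert (Hcomp : forall w : R -> E, (forall t, continuous w t) ->
  forall t, continuous (fun s => F (w s)) t).
  intros w Hw t; apply continuous_comp; auto.
assert (Huc : forall n t, continuous (u n) t).
  induction n as [|n IH]; intros t; [apply continuous_const|].
  apply duhamel_integral_continuous; intros s; now apply Hcomp.
assert (Hstep : forall n t, 0 <= t ->
  norm (u (S n) t [-] u n t) <= D * exp (lam * t) * (/ 2) ^ n).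
  induction n as [|n IH]; intros t Ht.
  - assert (Hd : duhamel (fun s => F (u 0%nat s)) w0 (u 1%nat)).
      apply duhamel_integral_correct; intros s; now apply Hcomp.
    assert (H1 : norm (u 1%nat t [-] T t w0) <= K * norm (F w0) * (t - 0)).
      apply integral_bound with (2 := Hd t Ht); [lra|]; intros r Hr.
      apply HTb; lra.
    pose proof (norm_le_plus (u 1%nat t [-] u 0%nat t) (u 1%nat t [-] T t w0)
      (T t w0 [-] w0) ltac:(simpl; vec)).
    pose proof (norm_minus_le (T t w0) w0); pose proof (HTb t Ht w0).
    assert (Hexp : 1 + lam * t <= exp (lam * t)).
      destruct (Req_dec t 0) as [->|]; [rewrite Rmult_0_r, exp_0; lra|].
      apply Rlt_le, exp_ineq1; nra.
    assert (1 <= exp (lam * t) /\ t <= exp (lam * t)) by nra.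
    pose proof (norm_ge_0 w0); pose proof (norm_ge_0 (F w0)).
    assert (K * norm (F w0) * (t - 0) <= K * norm (F w0) * exp (lam * t)).
      apply Rmult_le_compat_l; [nra|lra].
    assert ((K + 1) * norm w0 * 1 <= (K + 1) * norm w0 * exp (lam * t)).
      apply Rmult_le_compat_l; [nra|lra].
    unfold D; simpl pow; lra.
  - pose proof (pow_lt (/ 2) n ltac:(lra)) as Hp.
    apply Rle_trans with (K * (k * (D * (/ 2) ^ n)) / lam * exp (lam * t)).
    + apply (duhamel_difference (fun s => F (u (S n) s)) (fun s => F (u n s)) w0);
        auto; try lra.
      * apply Rmult_le_pos; [lra|apply Rmult_le_pos; lra].
      * apply duhamel_integral_correct; intros s; now apply Hcomp.
      * apply duhamel_integral_correct; intros s; now apply Hcomp.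
      * intros r Hr; apply Rle_trans with (1 := HF _ _).
        rewrite Rmult_assoc; apply Rmult_le_compat_l; auto.
        specialize (IH r Hr); lra.
    + replace (K * (k * (D * (/ 2) ^ n)) / lam * exp (lam * t))
        with (K * k / lam * (D * exp (lam * t) * (/ 2) ^ n)) by (field; lra).
      replace (D * exp (lam * t) * (/ 2) ^ S n)
        with (/ 2 * (D * exp (lam * t) * (/ 2) ^ n)) by (simpl; ring).
      apply Rmult_le_compat_r; auto.
      pose proof (exp_pos (lam * t)).
      apply Rmult_le_pos; [apply Rmult_le_pos|]; lra.
assert (Hneg : forall n t, u n t = u n (Rmax 0 t)).
  intros [|n] t; [reflexivity|]; simpl; unfold Phi, duhamel_integral.
  now rewrite (Rmax_right 0 (Rmax 0 t)) by apply Rmax_l.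
assert (Hlim : forall t, exists l, forall n,
  norm (u n t [-] l) <= 2 * (D * exp (lam * Rmax 0 t)) * (/ 2) ^ n).
  intros t; pose proof (exp_pos (lam * Rmax 0 t)).
  destruct (geometric_limit (fun n => u n t) (D * exp (lam * Rmax 0 t)) (/ 2))
    as [l Hl]; [nra|lra| |].
  - intros n; rewrite (Hneg (S n)), (Hneg n); apply Hstep, Rmax_l.
  - exists l; intros n; specialize (Hl n).
    replace (D * exp (lam * Rmax 0 t) * (/ 2) ^ n / (1 - / 2))
      with (2 * (D * exp (lam * Rmax 0 t)) * (/ 2) ^ n) in Hl by field.
    exact Hl.
set (w t := proj1_sig (constructive_indefinite_description _ (Hlim t))).
assert (Hw : forall t n,
  norm (u n t [-] w t) <= 2 * (D * exp (lam * Rmax 0 t)) * (/ 2) ^ n).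
  intros t; unfold w; apply proj2_sig.
assert (Hwc : forall t, continuous w t).
  intros t; apply (continuous_R_iff (E := E)); intros e He.
  set (m := exp (lam * (Rabs t + 1))); assert (Hm : 0 < m) by apply exp_pos.
  destruct (half_pow_small (2 * (D * m)) (e / 3)) as [n Hn]; [nra|lra|].
  assert (Hnear : forall s, s <= Rabs t + 1 -> norm (u n s [-] w s) < e / 3).
    intros s Hs; apply Rle_lt_trans with (1 := Hw s n).
    apply Rle_lt_trans with (2 := Hn).
    apply Rmult_le_compat_r; [apply pow_le; lra|].
    assert (exp (lam * Rmax 0 s) <= m); [|nra].
    assert (Rmax 0 s <= Rabs t + 1).
      apply Rmax_lub; [pose proof (Rabs_pos t)|]; lra.
    destruct (Req_dec (Rmax 0 s) (Rabs t + 1)) as [->|]; [unfold m; lra|].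
    apply Rlt_le, exp_increasing; nra.
  destruct (proj1 (continuous_R_iff (E := E) _ _) (Huc n t) (e / 3)) as [d [Hd H]]; [lra|].
  exists (Rmin d 1); split; [apply Rmin_glb_lt; lra|]; intros s Hs.
  pose proof (Rmin_l d 1); pose proof (Rmin_r d 1); pose proof (Rle_abs t).
  specialize (H s ltac:(lra)).
  pose proof (Hnear t ltac:(lra)).
  assert (Hst : s <= Rabs t + 1) by (pose proof (Rle_abs (s - t)); lra).
  pose proof (Hnear s Hst).
  pose proof (norm_le_plus (w s [-] w t) (vopp (u n s [-] w s))
    ((u n s [-] u n t) [+] (u n t [-] w t)) ltac:(vec)) as Htri.
  pose proof (norm_add_le (u n s [-] u n t) (u n t [-] w t)).
  rewrite norm_vopp in Htri; lra.
exists w; split; auto.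
assert (Hfix : forall t, 0 <= t -> Phi w t = w t).
  intros t Ht.
    apply eq_of_small_distance; intros e He.
    pose proof (exp_pos (lam * t)) as Hexp.
    set (c := 2 * (K * k / lam * (2 * D * exp (lam * t))) + 2 * (D * exp (lam * t))).
    assert (HKk : 0 <= K * k / lam).
      apply Rmult_le_pos; [nra|apply Rlt_le, Rinv_0_lt_compat; lra].
    assert (HDe : 0 <= D * exp (lam * t)) by nra.
    destruct (half_pow_small c e) as [n Hn]; [unfold c; nra|auto|].
    pose proof (pow_lt (/ 2) n ltac:(lra)) as Hp.
    assert (H1 : norm (u (S n) t [-] Phi w t)
      <= K * (k * (2 * D * (/ 2) ^ n)) / lam * exp (lam * t)).
      apply (duhamel_difference (fun s => F (u n s)) (fun s => F (w s)) w0);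
        auto; try lra.
      - apply Rmult_le_pos; [lra|apply Rmult_le_pos; lra].
      - apply duhamel_integral_correct; intros s; now apply Hcomp.
      - apply duhamel_integral_correct; intros s; now apply Hcomp.
      - intros r Hr; apply Rle_trans with (1 := HF _ _).
        rewrite Rmult_assoc; apply Rmult_le_compat_l; auto.
        specialize (Hw r n); rewrite Rmax_right in Hw by lra; lra.
    pose proof (Hw t (S n)) as H2; rewrite Rmax_right in H2 by lra.
    pose proof (norm_le_plus (Phi w t [-] w t) (vopp (u (S n) t [-] Phi w t))
      (u (S n) t [-] w t) ltac:(vec)) as Htri.
    rewrite norm_vopp in Htri.
    replace (K * (k * (2 * D * (/ 2) ^ n)) / lam * exp (lam * t))
      with (K * k / lam * (2 * D * exp (lam * t)) * (/ 2) ^ n) in H1 by (field; lra).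
    replace (2 * (D * exp (lam * t)) * (/ 2) ^ S n)
      with (D * exp (lam * t) * (/ 2) ^ n) in H2 by (simpl; field).
    assert (Hc' : K * k / lam * (2 * D * exp (lam * t)) + D * exp (lam * t) <= c).
      unfold c; assert (0 <= K * k / lam * (2 * D * exp (lam * t))); [|lra].
      apply Rmult_le_pos; lra.
    apply Rle_trans with (c * (/ 2) ^ n); [|lra].
    apply Rle_trans with ((K * k / lam * (2 * D * exp (lam * t)) + D * exp (lam * t))
      * (/ 2) ^ n); [lra|].
    apply Rmult_le_compat_r; lra.
intros t Ht; rewrite <- (Hfix t Ht).
apply (duhamel_integral_correct (fun s => F (w s)) w0); auto.
Qed.

(** For [t] large the forcing is nearly [y] on [[t, t + s]]; in the limit the formula over
    this interval gives [T s p = p - s * y + o(s)]. *)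
Lemma duhamel_limit (A : unbounded_op E) b w0 w (p y : E) :
  generates A T -> duhamel b w0 w ->
  (forall e, 0 < e -> exists N, forall t, N <= t -> norm (w t [-] p) < e) ->
  (forall e, 0 < e -> exists N, forall t, N <= t -> norm (b t [-] y) < e) ->
  uo_dom A p /\ A p = vopp y.
Proof.
intros HA H Hw Hb; apply (generates_iff A T HA); intros e He.
destruct (semigroup_bounded T HT 1) as [K [HK HTb]].
destruct (semigroup_right_limit T y HT (e / 4)) as [d [Hd Hy]]; [lra|].
exists (Rmin 1 d); split; [apply Rmin_glb_lt; lra|]; intros s Hs.
pose proof (Rmin_l 1 d); pose proof (Rmin_r 1 d).
destruct (Hb (e / 4 / K)) as [N1 HN1]; [apply Rdiv_lt_0_compat; lra|].
destruct (Hw (e * s / 4 / K)) as [N2 HN2]; [apply Rdiv_lt_0_compat; nra|].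
set (t := Rmax 0 (Rmax N1 N2)).
assert (Ht : 0 <= t) by apply Rmax_l.
assert (Ht1 : N1 <= t) by (eapply Rle_trans; [apply Rmax_l|apply Rmax_r]).
assert (Ht2 : N2 <= t) by (eapply Rle_trans; [apply Rmax_r|apply Rmax_r]).
assert (Hstep : norm (w (t + s) [-] T s (w t) [-] s [*] y)
  <= (K * (e / 4 / K) + e / 4) * s).
  apply (duhamel_step b w0); auto; try lra.
  - intros r Hr; apply HTb; lra.
  - intros r Hr; apply Rlt_le, HN1; lra.
  - intros r Hr; apply Rlt_le, Hy; lra.
replace (K * (e / 4 / K) + e / 4) with (e / 2) in Hstep by (field; lra).
pose proof (HN2 t Ht2) as A1; pose proof (HN2 (t + s) ltac:(lra)) as A2.
assert (A3 : K * (e * s / 4 / K) = e * s / 4) by (field; lra).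
assert (A4 : norm (T s (w t [-] p)) <= e * s / 4).
  apply Rle_trans with (1 := HTb s ltac:(lra) _); apply mul_div_le; lra.
assert (A5 : e * s / 4 / K <= e * s / 4).
  apply Rmult_le_reg_l with K; [lra|]; rewrite A3; assert (0 < e * s) by nra; nra.
pose proof (norm_le_plus (T s p [-] p [-] s [*] vopp y)
  (vopp (w (t + s) [-] T s (w t) [-] s [*] y))
  ((w (t + s) [-] p) [+] vopp (T s (w t [-] p))) ltac:(bo_linear; vec)).
pose proof (norm_add_le (w (t + s) [-] p) (vopp (T s (w t [-] p)))).
rewrite !norm_vopp in *; lra.
Qed.

End Duhamel.

(** Mild solutions come with a semigroup of their own, which uniqueness identifies
    with [T]; extending them by a constant to negative times makes them continuous
    on the line. *)
Lemma mild_solution_duhamel {E : CompleteNormedModule R_AbsRing} (A : unbounded_op E)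
  (T : R -> bounded_op E E) (F : E -> E) (w0 : E) (w : R -> E) :
  C0_semigroup T -> generates A T -> mild_solution A F w0 w ->
  let v := fun t => w (Rmax 0 t) in
  (forall t, continuous v t) /\ duhamel T (fun s => F (v s)) w0 v.
Proof.
intros HT HA [S [HS [HSA [Hc Hi]]]] v; split.
- intros t; apply (continuous_R_iff (E := E)); intros e He.
  set (t' := Rmax 0 t); assert (Ht' : 0 <= t') by apply Rmax_l.
  pose proof (proj1 (filterlim_locally_ball_norm (K := R_AbsRing)
    (F := within (fun s => 0 <= s) (locally t')) w (w t')) (Hc t' Ht')
    (mkposreal e He)) as [[d Hd] H].
  exists d; split; auto; intros s Hs.
  apply (H (Rmax 0 s)); [|apply Rmax_l].
  change (Rabs (Rmax 0 s - t') < d).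
  apply Rle_lt_trans with (2 := Hs); apply Rmax0_lipschitz.
- intros t Ht; unfold v; rewrite (Rmax_right 0 t) by lra.
  rewrite (semigroup_unique A T S HT HS HA HSA t w0 Ht).
  apply is_RInt_ext with (fun s => S (t - s) (F (w s))).
  + intros s Hs; rewrite Rmin_left, Rmax_right in Hs by lra.
    rewrite Rmax_right by lra; symmetry.
    apply (semigroup_unique A T S HT HS HA HSA); lra.
  + exact (Hi t Ht).
Qed.

(** * Positive bilinear forms *)

Section PositiveForms.
Context {E : NormedModule R_AbsRing} (Q : E -> E -> R).
Hypothesis Q_sym : forall x y, Q x y = Q y x.
Hypothesis Q_add : forall x y z, Q (x [+] y) z = Q x z + Q y z.
Hypothesis Q_scal : forall a x y, Q (a [*] x) y = a * Q x y.
Hypothesis Q_pos : forall x, 0 <= Q x x.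

Lemma form_add_r x y z : Q x (y [+] z) = Q x y + Q x z.
Proof. now rewrite Q_sym, Q_add, !(Q_sym x). Qed.

Lemma form_scal_r a x y : Q x (a [*] y) = a * Q x y.
Proof. now rewrite Q_sym, Q_scal, (Q_sym x). Qed.

Lemma form_square_add x y : Q (x [+] y) (x [+] y) = Q x x + 2 * Q x y + Q y y.
Proof. rewrite Q_add, !form_add_r, (Q_sym y x); ring. Qed.

Lemma form_cauchy_schwarz x y : Rabs (Q x y) <= sqrt (Q x x) * sqrt (Q y y).
Proof.
rewrite <- sqrt_mult by auto; rewrite <- sqrt_Rsqr_abs.
apply sqrt_le_1_alt; unfold Rsqr.
assert (Hexp : forall t, 0 <= Q x x + 2 * t * Q x y + t * t * Q y y).
  intros t; replace (_ + _) with (Q (x [+] t [*] y) (x [+] t [*] y)); [apply Q_pos|].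
  rewrite form_square_add, form_scal_r, Q_scal, form_scal_r; ring.
destruct (Req_dec (Q y y) 0) as [H0|H0].
- destruct (Req_dec (Q x y) 0) as [->|H1]; [rewrite H0; lra|].
  specialize (Hexp (- (Q x x + 1) / (2 * Q x y))); rewrite H0 in Hexp.
  replace (2 * (- (Q x x + 1) / (2 * Q x y)) * Q x y) with (- (Q x x + 1)) in Hexp
    by (field; auto).
  lra.
- assert (Hp : 0 < Q y y) by (pose proof (Q_pos y); lra).
  specialize (Hexp (- Q x y / Q y y)).
  apply Rmult_le_compat_r with (r := Q y y) in Hexp; [|lra].
  replace ((Q x x + 2 * (- Q x y / Q y y) * Q x y
    + - Q x y / Q y y * (- Q x y / Q y y) * Q y y) * Q y y)
    with (Q x x * Q y y - Q x y * Q x y) in Hexp by (field; auto).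
  lra.
Qed.

Lemma form_norm_triangle x y :
  sqrt (Q (x [+] y) (x [+] y)) <= sqrt (Q x x) + sqrt (Q y y).
Proof.
pose proof (sqrt_pos (Q x x)); pose proof (sqrt_pos (Q y y)).
rewrite <- (sqrt_Rsqr (sqrt (Q x x) + sqrt (Q y y))) by lra.
apply sqrt_le_1_alt; unfold Rsqr.
pose proof (form_cauchy_schwarz x y); pose proof (Rle_abs (Q x y)).
rewrite form_square_add.
pose proof (sqrt_sqrt _ (Q_pos x)); pose proof (sqrt_sqrt _ (Q_pos y)); nra.
Qed.

Lemma form_norm_scal a x :
  sqrt (Q (a [*] x) (a [*] x)) = Rabs a * sqrt (Q x x).
Proof.
rewrite Q_scal, form_scal_r, <- Rmult_assoc, sqrt_mult; auto; [|nra].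
f_equal; exact (sqrt_Rsqr_abs a).
Qed.

(** The product rule for a quadratic form. *)
Lemma dini_form (y : R -> E) t (l : E) C :
  (forall u v, Rabs (Q u v) <= C * norm u * norm v) ->
  right_derivative y t l -> dini_le (fun u => Q (y u) (y u)) t (2 * Q (y t) l).
Proof.
intros HC Ho e He.
assert (HC0 : 0 <= Rabs C) by apply Rabs_pos.
set (K := Rabs C + 1).
assert (HQ : forall u v, Q u v <= K * norm u * norm v).
  intros u v; pose proof (HC u v); pose proof (Rle_abs (Q u v)); pose proof (Rle_abs C).
  pose proof (norm_ge_0 u); pose proof (norm_ge_0 v).
  assert (0 <= norm u * norm v) by nra; unfold K; nra.
set (m := norm (y t)); set (n := norm l + 1).
assert (Hm : 0 <= m) by apply norm_ge_0.
assert (Hn : 1 <= n) by (pose proof (norm_ge_0 l); unfold n; lra).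
destruct (Ho (Rmin 1 (e / (4 * K * (m + 1))))) as [d [Hd H]].
  apply Rmin_glb_lt; [lra|]; apply Rdiv_lt_0_compat; unfold K; nra.
exists (Rmin d (e / (2 * K * n * n))).
assert (HK : 0 < K) by (unfold K; lra).
assert (HKn : 0 < 2 * K * n * n) by (repeat apply Rmult_lt_0_compat; lra).
split; [apply Rmin_glb_lt; [lra|now apply Rdiv_lt_0_compat]|]; intros s Hs.
pose proof (Rmin_l d (e / (2 * K * n * n))); pose proof (Rmin_r d (e / (2 * K * n * n))).
specialize (H s ltac:(lra)).
set (r := y (t + s) [-] y t [-] s [*] l) in *.
set (q := s [*] l [+] r).
pose proof (Rmin_l 1 (e / (4 * K * (m + 1)))) as M1.
pose proof (Rmin_r 1 (e / (4 * K * (m + 1)))) as M2.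
assert (Hr1 : norm r <= s) by nra.
assert (Hr2 : K * m * norm r <= e / 4 * s).
  apply Rle_trans with (K * (m + 1) * (e / (4 * K * (m + 1)) * s)).
  - pose proof (norm_ge_0 r).
    apply Rle_trans with (K * (m + 1) * norm r); [nra|].
    apply Rmult_le_compat_l; nra.
  - right; field; split; lra.
assert (Hq : norm q <= n * s).
  pose proof (norm_add_le (s [*] l) r); rewrite norm_scal_pos in H2 by lra.
  unfold q, n; lra.
replace (y (t + s)) with (y t [+] q) by (unfold q, r; vec).
rewrite form_square_add.
assert (E1 : Q (y t) q <= s * Q (y t) l + e / 4 * s).
  unfold q; rewrite form_add_r, form_scal_r.
  pose proof (HQ (y t) r); fold m in H2; lra.
assert (E2 : Q q q <= e / 2 * s).
  apply Rle_trans with (1 := HQ q q); pose proof (norm_ge_0 q).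
  apply Rle_trans with (K * (n * s) * (n * s)).
  - apply Rmult_le_compat; try lra; [nra|]; apply Rmult_le_compat_l; lra.
  - replace (e / 2 * s) with (K * n * n * s * (e / (2 * K * n * n))) by (field; lra).
    replace (K * (n * s) * (n * s)) with (K * n * n * s * s) by ring.
    apply Rmult_le_compat_l; [|lra]; repeat apply Rmult_le_pos; lra.
lra.
Qed.

End PositiveForms.

(** * Hilbert spaces and adjoints *)

Section HilbertSpaces.
Context {X : Hilbert}.
Implicit Types x y z : X.

Lemma inner_add_l x y z : inner (x [+] y) z = inner x z + inner y z.
Proof. apply inner_plus. Qed.

Lemma inner_scal_l a x y : inner (a [*] x) y = a * inner x y.
Proof. apply inner_scal. Qed.

Lemma inner_add_r x y z : inner x (y [+] z) = inner x y + inner x z.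
Proof. now rewrite inner_sym, inner_add_l, !(inner_sym X x). Qed.

Lemma inner_scal_r a x y : inner x (a [*] y) = a * inner x y.
Proof. now rewrite inner_sym, inner_scal_l, (inner_sym X x). Qed.

Lemma inner_sub_l x y z : inner (x [-] y) z = inner x z - inner y z.
Proof.
replace (x [-] y) with (x [+] (-1) [*] y) by vec.
rewrite inner_add_l, inner_scal_l; ring.
Qed.

Lemma inner_sub_r x y z : inner x (y [-] z) = inner x y - inner x z.
Proof. now rewrite inner_sym, inner_sub_l, !(inner_sym X x). Qed.

Lemma inner_self x : inner x x = norm x ^ 2.
Proof. apply inner_norm. Qed.

Lemma norm_sqrt_inner x : norm x = sqrt (inner x x).
Proof. rewrite inner_self, sqrt_pow2; auto; apply norm_ge_0. Qed.

Lemma cauchy_schwarz x y : Rabs (inner x y) <= norm x * norm y.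
Proof.
rewrite !norm_sqrt_inner; apply (form_cauchy_schwarz (E := X) inner).
- apply inner_sym.
- apply inner_add_l.
- apply inner_scal_l.
- intros z; rewrite inner_self; apply pow2_ge_0.
Qed.

Lemma inner_nondegenerate x y : (forall v, inner v x = inner v y) -> x = y.
Proof.
intros H; apply norm_minus_lt0.
assert (H0 : norm (x [-] y) ^ 2 = 0).
  rewrite <- inner_self, inner_sub_r, H; ring.
pose proof (norm_ge_0 (x [-] y)); nra.
Qed.

(** The minimising sequences of [norm v ^ 2 - 2 * l v] are Cauchy by the
    parallelogram identity, and the first variation at their limit vanishes. *)
Lemma riesz (l : bounded_op X R_NormedModule) :
  exists x, forall v, l v = inner v x.
Proof.
set (J := fun v : X => norm v ^ 2 - 2 * l v).
assert (l_add : forall u v, l (u [+] v) = l u + l v) by (intros; apply (bo_add l)).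
assert (l_scal : forall a v, l (a [*] v) = a * l v) by (intros; apply (bo_scale l)).
assert (J_add : forall u v, J (u [+] v) = J u + 2 * (inner u v - l v) + norm v ^ 2).
  intros u v; unfold J; rewrite l_add, <- !inner_self, inner_add_l, !inner_add_r,
    (inner_sym X v u); ring.
destruct (completeness (fun r => exists v, r = - J v)) as [m [Hub Hlub]].
  exists (op_norm l ^ 2); intros r [v ->].
  pose proof (op_norm_bound l v) as Hb.
  change (Rabs (l v) <= op_norm l * norm v) in Hb.
  pose proof (Rle_abs (l v)); pose proof (pow2_ge_0 (op_norm l - norm v)).
  unfold J; nra.
  now exists (- J vzero), vzero.
assert (Hmin : forall v, - m <= J v).
  intros v; assert (- J v <= m) by (apply Hub; now exists v); lra.
(* The precision [4 ^ - n] makes consecutive points [2 * 2 ^ - n] close. *)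
assert (Hnear : forall n : nat, exists v, J v <= - m + (/ 2) ^ n * (/ 2) ^ n).
  intros n; pose proof (pow_lt (/ 2) n ltac:(lra)) as Hp.
  apply NNPP; intros Hn.
  assert (m <= m - (/ 2) ^ n * (/ 2) ^ n); [|nra].
  apply Hlub; intros r [v ->]; apply Rnot_lt_le; intros Hlt; apply Hn.
  exists v; lra.
set (u n := proj1_sig (constructive_indefinite_description _ (Hnear n))).
assert (Hu : forall n, J (u n) <= - m + (/ 2) ^ n * (/ 2) ^ n).
  intros n; unfold u; apply proj2_sig.
destruct (geometric_limit u 2 (/ 2)) as [x Hx]; [lra|lra| |].
  intros n; pose proof (pow_lt (/ 2) n ltac:(lra)) as Hp.
  set (d := u (S n) [-] u n).
  pose proof (Hmin (u n [+] / 2 [*] d)) as H1.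
  pose proof (Hu n) as H2; pose proof (Hu (S n)) as H3.
  replace (u (S n)) with (u n [+] d) in H3 by (unfold d; vec).
  rewrite J_add in H1, H3.
  rewrite inner_scal_r, l_scal, norm_scal_pos in H1 by lra; simpl pow in H3.
  pose proof (norm_ge_0 d).
  assert (norm d * norm d <= 4 * ((/ 2) ^ n * (/ 2) ^ n)) by nra.
  nra.
exists x; intros v.
assert (Heq : forall n, Rabs (inner (u n) v - l v) <= (/ 2) ^ n * ((norm v ^ 2 + 1) / 2)).
  intros n; pose proof (pow_lt (/ 2) n ltac:(lra)) as Hp.
  pose proof (Hmin (u n [+] (/ 2) ^ n [*] v)) as H1.
  pose proof (Hmin (u n [+] (- (/ 2) ^ n) [*] v)) as H2.
  specialize (Hu n); rewrite J_add, inner_scal_r, l_scal, norm_scal_eq in H1, H2.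
  rewrite Rabs_Ropp in H2; rewrite Rabs_pos_eq in H1, H2 by lra.
  set (q := (/ 2) ^ n) in *; set (b := inner (u n) v - l v) in *.
  assert (Ha : 0 <= q * (2 * b + q * norm v ^ 2 + q)) by (unfold b; nra).
  assert (Hb : 0 <= q * (- 2 * b + q * norm v ^ 2 + q)) by (unfold b; nra).
  assert (Ha' : 0 <= 2 * b + q * norm v ^ 2 + q).
    apply Rmult_le_reg_l with q; lra.
  assert (Hb' : 0 <= - 2 * b + q * norm v ^ 2 + q).
    apply Rmult_le_reg_l with q; lra.
  apply Rabs_le; lra.
assert (Hfin : forall n, Rabs (l v - inner v x) <= (4 * norm v + (norm v ^ 2 + 1) / 2) * (/ 2) ^ n).
  intros n; specialize (Heq n); specialize (Hx n).
  replace (2 * (/ 2) ^ n / (1 - / 2)) with (4 * (/ 2) ^ n) in Hx by field.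
  pose proof (cauchy_schwarz (u n [-] x) v) as Hcs; rewrite inner_sub_l in Hcs.
  pose proof (norm_ge_0 v).
  replace (l v - inner v x) with (- (inner (u n) v - l v) + (inner (u n) v - inner x v))
    by (rewrite (inner_sym X v x); ring).
  eapply Rle_trans; [apply Rabs_triang|]; rewrite Rabs_Ropp; nra.
apply Rminus_diag_uniq, NNPP; intros Hne; apply Rabs_pos_lt in Hne.
destruct (half_pow_small (4 * norm v + (norm v ^ 2 + 1) / 2) _
  ltac:(pose proof (norm_ge_0 v); pose proof (pow2_ge_0 (norm v)); lra) Hne) as [n Hn].
specialize (Hfin n); lra.
Qed.

Lemma continuous_inner (u v : R -> X) t :
  continuous u t -> continuous v t -> continuous (fun s => inner (u s) (v s)) t.
Proof.
intros Hu Hv.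
assert (Hsq : forall z : R -> X, continuous z t ->
  continuous (fun s => norm (z s) * norm (z s)) t).
  intros z Hz; apply (continuous_mult (K := R_AbsRing));
    apply (continuous_comp z norm); auto; exact (filterlim_norm _).
apply continuous_ext with (fun s => minus
  (scal (/ 4) (norm (u s [+] v s) * norm (u s [+] v s)))
  (scal (/ 4) (norm (u s [-] v s) * norm (u s [-] v s)))).
- intros s; change (/ 4 * (norm (u s [+] v s) * norm (u s [+] v s))
    - / 4 * (norm (u s [-] v s) * norm (u s [-] v s)) = inner (u s) (v s)).
  replace (norm (u s [+] v s) * norm (u s [+] v s)) with (norm (u s [+] v s) ^ 2) by ring.
  replace (norm (u s [-] v s) * norm (u s [-] v s)) with (norm (u s [-] v s) ^ 2) by ring.
  rewrite <- !inner_self, inner_add_l, !inner_add_r, inner_sub_l, !inner_sub_r.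
  rewrite (inner_sym X (v s) (u s)); field.
- apply (continuous_minus (V := R_NormedModule)).
  + apply (continuous_scal_r (V := R_NormedModule)), Hsq, (continuous_plus u v); auto.
  + apply (continuous_scal_r (V := R_NormedModule)), Hsq, (continuous_minus u v); auto.
Qed.

End HilbertSpaces.

Section Adjoints.
Context {E F : Hilbert}.
Implicit Types S T : bounded_op E F.

Lemma inner_right_is_linear (y : F) :
  is_linear (fun z : F => inner z y : R_NormedModule).
Proof.
split.
- intros a b; apply inner_plus.
- intros a b; apply inner_scal.
- exists (norm y + 1); pose proof (norm_ge_0 y); split; [lra|]; intros z.
  change (Rabs (inner z y) <= (norm y + 1) * norm z).
  pose proof (cauchy_schwarz z y); pose proof (norm_ge_0 z); nra.
Qed.

Lemma adjoint_spec S y v : inner (S v) y = inner v (adjoint S y).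
Proof.
revert v; unfold adjoint.
apply (iota_correct (fun x : E => forall v, inner (S v) y = inner v x)).
destruct (riesz (mk_bounded_op _
  (is_linear_comp S _ (bo_linear S) (inner_right_is_linear y)))) as [x Hx].
exists x; split; [exact Hx|]; intros x' Hx'.
apply inner_nondegenerate; intros v; rewrite <- Hx'; symmetry; apply Hx.
Qed.

Lemma adjoint_unique S y x : (forall v, inner (S v) y = inner v x) -> adjoint S y = x.
Proof.
intros H; apply inner_nondegenerate; intros v; now rewrite <- adjoint_spec.
Qed.

Lemma adjoint_sub S y y' : adjoint S (y [-] y') = adjoint S y [-] adjoint S y'.
Proof.
apply adjoint_unique; intros v; now rewrite !inner_sub_r, !adjoint_spec.
Qed.

Lemma adjoint_scal S a y : adjoint S (a [*] y) = a [*] adjoint S y.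
Proof.
apply adjoint_unique; intros v; now rewrite !inner_scal_r, adjoint_spec.
Qed.

Lemma adjoint_op_sub S T y : adjoint (S [-] T) y = adjoint S y [-] adjoint T y.
Proof.
apply adjoint_unique; intros v.
change (inner (S v [-] T v) y = inner v (adjoint S y [-] adjoint T y)).
now rewrite inner_sub_l, inner_sub_r, !adjoint_spec.
Qed.

Lemma adjoint_bound S y : norm (adjoint S y) <= op_norm S * norm y.
Proof.
set (x := adjoint S y).
assert (H : norm x ^ 2 <= op_norm S * norm x * norm y).
  rewrite <- inner_self; unfold x at 2; rewrite <- adjoint_spec.
  pose proof (cauchy_schwarz (S x) y); pose proof (Rle_abs (inner (S x) y)).
  pose proof (op_norm_bound S x); pose proof (norm_ge_0 y).
  apply Rle_trans with (norm (S x) * norm y); [lra|apply Rmult_le_compat_r; lra].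
pose proof (norm_ge_0 x); pose proof (op_norm_ge0 S); pose proof (norm_ge_0 y).
destruct (Req_dec (norm x) 0) as [->|]; [nra|].
apply Rmult_le_reg_l with (norm x); [lra|]; simpl in H; lra.
Qed.

(** If the adjoint is not bounded below, there are vectors [y n] as large as one
    likes with [adjoint S (y n)] in the unit ball. The functionals
    [fun u => inner u (y n)] are then bounded at every point [S v], that is at every
    point, against uniform boundedness. *)
Lemma surjective_adjoint_coercive S :
  (forall y : F, exists x : E, S x = y) ->
  exists c, 0 < c /\ forall y, c * norm y <= norm (adjoint S y).
Proof.
intros Hsurj; apply NNPP; intros Hn.
assert (Hbad : forall n : nat, exists y : F, 4 ^ n <= norm y /\ norm (adjoint S y) <= 1).
  intros n; apply NNPP; intros Hno; apply Hn; exists (/ 4 ^ n).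
  assert (H4 : 0 < 4 ^ n) by (apply pow_lt; lra).
  split; [now apply Rinv_0_lt_compat|]; intros y; apply Rnot_lt_le; intros Hlt.
  assert (Hy : 0 < norm y).
    pose proof (norm_ge_0 y); destruct (Req_dec (norm y) 0) as [H0|]; [|lra].
    pose proof (norm_ge_0 (adjoint S y)); rewrite H0 in Hlt; lra.
  apply Hno; exists ((4 ^ n / norm y) [*] y); split.
  - rewrite norm_scal_pos by (apply Rlt_le, Rdiv_lt_0_compat; lra).
    right; field; lra.
  - rewrite adjoint_scal, norm_scal_pos by (apply Rlt_le, Rdiv_lt_0_compat; lra).
    apply Rle_trans with (4 ^ n / norm y * (/ 4 ^ n * norm y)); [|right; field; lra].
    apply Rmult_le_compat_l; [apply Rlt_le, Rdiv_lt_0_compat|]; lra.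
set (y n := proj1_sig (constructive_indefinite_description _ (Hbad n))).
assert (Hy : forall n, 4 ^ n <= norm (y n) /\ norm (adjoint S (y n)) <= 1).
  intros n; unfold y; apply proj2_sig.
destruct (gliding_hump (fun n => mk_bounded_op _ (inner_right_is_linear (y n))))
  as [z Hz].
- intros n; destruct (Hy n) as [H1 _].
  pose proof (op_norm_bound (mk_bounded_op _ (inner_right_is_linear (y n))) (y n)) as H.
  simpl in H; set (o := op_norm _) in *.
  change (Rabs (inner (y n) (y n)) <= o * norm (y n)) in H.
  rewrite inner_self, Rabs_pos_eq in H by apply pow2_ge_0.
  assert (0 < 4 ^ n) by (apply pow_lt; lra).
  apply Rle_trans with (1 := H1); apply Rmult_le_reg_r with (norm (y n)); [lra|].
  simpl in H; lra.
- destruct (Hsurj z) as [v Hv]; destruct (hump_unbounded (norm v)) as [n Hn'].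
  specialize (Hz n); simpl in Hz.
  change ((4 / 3) ^ n / 6 <= Rabs (inner z (y n))) in Hz.
  rewrite <- Hv, adjoint_spec in Hz.
  pose proof (cauchy_schwarz v (adjoint S (y n))); destruct (Hy n) as [_ H1].
  pose proof (norm_ge_0 v); nra.
Qed.

End Adjoints.

(** * The norm of a Lyapunov operator *)

(** A norm equivalent to the given one, for which the semigroup contracts at once, with no
    constant in front of the exponential: such estimates can be iterated over
    infinitesimal times, hence perturbed. *)
Record contracting_norm {E : NormedModule R_AbsRing} (T : R -> bounded_op E E)
  (p : E -> R) (c1 c2 w : R) : Prop := {
  cn_c1 : 0 < c1;
  cn_c2 : 0 < c2;
  cn_w : 0 < w;
  cn_lower : forall x, c1 * norm x <= p x;
  cn_upper : forall x, p x <= c2 * norm x;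
  cn_triangle : forall x y, p (x [+] y) <= p x + p y;
  cn_scal : forall a x, p (a [*] x) = Rabs a * p x;
  cn_decay : forall t x, 0 <= t -> p (T t x) <= exp (- w * t) * p x
}.

Arguments cn_c1 {E T p c1 c2 w}.
Arguments cn_c2 {E T p c1 c2 w}.
Arguments cn_w {E T p c1 c2 w}.
Arguments cn_lower {E T p c1 c2 w}.
Arguments cn_upper {E T p c1 c2 w}.
Arguments cn_triangle {E T p c1 c2 w}.
Arguments cn_scal {E T p c1 c2 w}.
Arguments cn_decay {E T p c1 c2 w}.

(** On the domain [<P x, x>] decays along orbits by the Lyapunov inequality; the estimate
    extends by density. *)
Lemma lyapunov_contracting_norm {X : Hilbert} (A : unbounded_op X)
  (T : R -> bounded_op X X) :
  C0_semigroup T -> generates A T -> Lyap A ->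
  exists p c1 c2 w, contracting_norm T p c1 c2 w.
Proof.
intros HT HA [P [c [mu [Hc [Hmu [Psym [Pcoer PA]]]]]]].
set (Q := fun x y : X => inner (P x) y).
assert (Qsym : forall x y, Q x y = Q y x).
  intros x y; unfold Q; rewrite Psym; apply inner_sym.
assert (Qadd : forall x y z, Q (x [+] y) z = Q x z + Q y z).
  intros x y z; unfold Q; now rewrite bo_add, inner_add_l.
assert (Qscal : forall a x y, Q (a [*] x) y = a * Q x y).
  intros a x y; unfold Q; now rewrite bo_scale, inner_scal_l.
assert (Qpos : forall x, 0 <= Q x x).
  intros x; apply Rle_trans with (2 := Pcoer x).
  apply Rmult_le_pos; [lra|apply pow2_ge_0].
set (b := op_norm P + 1).
assert (Hb : 1 <= b) by (pose proof (op_norm_ge0 P); unfold b; lra).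
assert (Qbound : forall x y, Rabs (Q x y) <= b * norm x * norm y).
  intros x y; apply Rle_trans with (1 := cauchy_schwarz (P x) y).
  apply Rmult_le_compat_r; [apply norm_ge_0|].
  pose proof (op_norm_bound P x); pose proof (norm_ge_0 x); unfold b; nra.
set (w := mu / b); assert (Hw : 0 < w) by (apply Rdiv_lt_0_compat; lra).
set (p := fun x => sqrt (Q x x)).
assert (plow : forall x, sqrt c * norm x <= p x).
  intros x; unfold p; rewrite <- (sqrt_pow2 (norm x)) by apply norm_ge_0.
  rewrite <- sqrt_mult by (try lra; apply pow2_ge_0).
  apply sqrt_le_1_alt, Pcoer.
assert (pupp : forall x, p x <= sqrt b * norm x).
  intros x; unfold p; rewrite <- (sqrt_pow2 (norm x)) by apply norm_ge_0.
  rewrite <- sqrt_mult by (try lra; apply pow2_ge_0).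
  apply sqrt_le_1_alt; pose proof (Rle_abs (Q x x)); specialize (Qbound x x); lra.
assert (ptri : forall x y, p (x [+] y) <= p x + p y).
  intros x y; now apply form_norm_triangle.
assert (pscal : forall a x, p (a [*] x) = Rabs a * p x).
  intros a x; now apply form_norm_scal.
assert (Hdom : forall x t, 0 <= t -> uo_dom A x -> p (T t x) <= exp (- w * t) * p x).
  intros x t Ht Hx.
  set (y := fun s => T (Rmax 0 s) x).
  assert (Hy : forall s, continuous y s) by (intros s; now apply semigroup_orbit_continuous).
  assert (Hdec : Q (y t) (y t) <= exp (- (2 * w) * t) * Q (y 0) (y 0)).
  { apply (dini_decay_global (fun s => Q (y s) (y s)) (2 * w)); auto; try lra.
    - intros s; apply continuous_inner; auto.
      apply (continuous_comp y P); auto; exact (bo_continuous P (y s)).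
    - intros s Hs.
      destruct (generator_invariant A T HT HA x s Hs Hx) as [Hd HA'].
      apply dini_mono with (2 * Q (y s) (A (T s x))).
      + unfold y, Q; rewrite Rmax_right by lra.
        pose proof (PA _ Hd) as H1; rewrite inner_sym in H1.
        pose proof (Qbound (T s x) (T s x)) as H2; unfold Q in H2.
        pose proof (Rle_abs (inner (P (T s x)) (T s x))) as H3.
        assert (w * inner (P (T s x)) (T s x) <= mu * norm (T s x) ^ 2); [|lra].
        apply Rle_trans with (w * (b * norm (T s x) * norm (T s x))).
          apply Rmult_le_compat_l; lra.
        right; unfold w; field; lra.
      + apply (dini_form Q Qsym Qadd Qscal y s (A (T s x)) b Qbound).
        rewrite HA'.
        apply small_o_ext with (2 := semigroup_right_derivative A T HT HA x s Hs Hx).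
        intros r Hr; unfold y; now rewrite !Rmax_right by lra. }
  unfold y in Hdec; rewrite (Rmax_right 0 t), (Rmax_left 0 0), (proj1 HT) in Hdec by lra.
  unfold p.
  replace (exp (- w * t)) with (sqrt (exp (- (2 * w) * t))).
  - rewrite <- sqrt_mult by (auto; apply Rlt_le, exp_pos).
    now apply sqrt_le_1_alt.
  - rewrite <- (sqrt_Rsqr (exp (- w * t))) by apply Rlt_le, exp_pos.
    f_equal; unfold Rsqr; rewrite <- exp_plus; f_equal; ring.
exists p, (sqrt c), (sqrt b), w; split; auto; try (apply sqrt_lt_R0; lra).
intros t x Ht; apply Rnot_lt_le; intros Hlt.
destruct (semigroup_bounded T HT t) as [K [HK HTb]].
assert (Hsb : 1 <= sqrt b) by (rewrite <- sqrt_1; apply sqrt_le_1_alt; lra).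
set (e := p (T t x) - exp (- w * t) * p x) in *.
destruct (domain_dense A T HT HA x (e / (sqrt b * (K + 1)))) as [x' [Hx' Hxx]].
  apply Rdiv_lt_0_compat; [unfold e; lra|nra].
assert (He1 := exp_decay_le_1 w t (Rlt_le _ _ Hw) Ht).
pose proof (Hdom x' t Ht Hx') as H1.
pose proof (ptri (T t x') (T t (x [-] x'))) as H2.
replace (T t x' [+] T t (x [-] x')) with (T t x) in H2 by (bo_linear; vec).
pose proof (ptri x (x' [-] x)) as H3.
replace (x [+] (x' [-] x)) with x' in H3 by vec.
pose proof (pupp (x' [-] x)) as H4; pose proof (pupp (T t (x [-] x'))) as H5.
pose proof (HTb t ltac:(lra) (x [-] x')) as H6.
rewrite (norm_minus_sym x) in H6; pose proof (exp_pos (- w * t)).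
pose proof (norm_ge_0 (x' [-] x)).
assert (H7 : sqrt b * norm (T t (x [-] x')) <= sqrt b * (K * norm (x' [-] x)))
  by (apply Rmult_le_compat_l; lra).
assert (H8 : exp (- w * t) * p x' <= exp (- w * t) * p x + sqrt b * norm (x' [-] x)).
  assert (0 <= sqrt b * norm (x' [-] x)) by nra; nra.
assert (H9 : sqrt b * (K + 1) * norm (x' [-] x) < e).
  apply Rlt_le_trans with (sqrt b * (K + 1) * (e / (sqrt b * (K + 1)))).
    apply Rmult_lt_compat_l; nra.
  right; field; split; lra.
unfold e in H9; lra.
Qed.

(** * Differential calculus *)

Section Calculus.
Context {E F : NormedModule R_AbsRing}.
Variables (f : E -> F) (df : E -> bounded_op E F).
Hypothesis f_diff : has_differential f df.

Lemma differential_at x e : 0 < e -> exists d, 0 < d /\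
  forall y, norm (y [-] x) < d ->
    norm (f y [-] f x [-] df x (y [-] x)) <= e * norm (y [-] x).
Proof.
intros He; destruct (f_diff x) as [_ H].
specialize (H x (fun P HP => HP) (mkposreal e He)).
destruct (locally_norm_le_locally x _ H) as [[d Hd] Hs].
exists d; split; [exact Hd|exact Hs].
Qed.

Lemma differential_along_curve x (z : R -> E) l :
  small_o (fun s => z s [-] x [-] s [*] l) ->
  small_o (fun s => f (z s) [-] f x [-] s [*] df x l).
Proof.
intros Hz e He.
set (n := norm l + 1); assert (Hn : 1 <= n) by (pose proof (norm_ge_0 l); unfold n; lra).
set (o := op_norm (df x) + 1).
assert (Ho : 1 <= o) by (pose proof (op_norm_ge0 (df x)); unfold o; lra).
destruct (differential_at x (e / 2 / n)) as [d1 [Hd1 H1]].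
  apply Rdiv_lt_0_compat; lra.
destruct (Hz (Rmin 1 (e / 2 / o))) as [d2 [Hd2 H2]].
  apply Rmin_glb_lt; [lra|apply Rdiv_lt_0_compat; lra].
exists (Rmin d2 (d1 / n)); split.
  apply Rmin_glb_lt; [lra|apply Rdiv_lt_0_compat; lra].
intros s Hs.
pose proof (Rmin_l d2 (d1 / n)); pose proof (Rmin_r d2 (d1 / n)).
pose proof (Rmin_l 1 (e / 2 / o)); pose proof (Rmin_r 1 (e / 2 / o)).
specialize (H2 s ltac:(lra)).
set (r := z s [-] x [-] s [*] l) in *.
assert (Hzx : norm (z s [-] x) <= n * s).
  pose proof (norm_le_plus (z s [-] x) (s [*] l) r ltac:(unfold r; vec)) as H5.
  rewrite norm_scal_pos in H5 by lra; unfold n; nra.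
assert (Hns : n * s < d1).
  apply mul_div_lt; lra.
specialize (H1 (z s) ltac:(lra)).
pose proof (norm_le_plus (f (z s) [-] f x [-] s [*] df x l)
  (f (z s) [-] f x [-] df x (z s [-] x)) (df x r)
  ltac:(unfold r; bo_linear; vec)) as H5.
pose proof (op_norm_bound (df x) r) as H6; pose proof (norm_ge_0 r) as Hr0.
assert (H7 : op_norm (df x) * norm r <= e / 2 * s).
  apply Rle_trans with (o * (e / 2 / o * s)).
  - apply Rmult_le_compat; [apply op_norm_ge0|auto|unfold o; lra|nra].
  - right; field; lra.
assert (H8 : e / 2 / n * norm (z s [-] x) <= e / 2 * s).
  apply Rle_trans with (e / 2 / n * (n * s)).
  - apply Rmult_le_compat_l; [apply Rlt_le, Rdiv_lt_0_compat; lra|lra].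
  - right; field; lra.
lra.
Qed.

Lemma differentiable_continuous x : continuous f x.
Proof.
apply continuous_ball_iff; intros e He.
destruct (differential_at x 1 Rlt_0_1) as [d [Hd H]].
set (o := op_norm (df x) + 2).
assert (Ho : 2 <= o) by (pose proof (op_norm_ge0 (df x)); unfold o; lra).
exists (Rmin d (e / o)); split; [apply Rmin_glb_lt; [lra|apply Rdiv_lt_0_compat; lra]|].
intros y Hy; pose proof (Rmin_l d (e / o)); pose proof (Rmin_r d (e / o)).
specialize (H y ltac:(lra)).
pose proof (norm_le_plus (f y [-] f x) (f y [-] f x [-] df x (y [-] x))
  (df x (y [-] x)) ltac:(vec)).
pose proof (op_norm_bound (df x) (y [-] x)).
apply Rle_lt_trans with (o * norm (y [-] x)).
  pose proof (norm_ge_0 (y [-] x)); unfold o; nra.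
apply mul_div_lt; lra.
Qed.

(** The mean value inequality around a reference increment [l]: with [l = 0] it gives Lipschitz
    bounds, with [l = df b v] Taylor bounds. *)
Lemma segment_mvi b v l K :
  (forall t, 0 <= t <= 1 -> norm (df (b [+] t [*] v) v [-] l) <= K) ->
  norm (f (b [+] v) [-] f b [-] l) <= K.
Proof.
intros HK.
assert (H : norm (f (b [+] 1 [*] v) [-] f (b [+] 0 [*] v) [-] 1 [*] l) <= K * 1).
  apply (right_derivative_mvi (fun t => f (b [+] t [*] v))
    (fun t => df (b [+] t [*] v) v)); [lra| | |].
  - intros t; apply (continuous_comp (fun t => b [+] t [*] v) f);
      [|apply differentiable_continuous].
    apply (continuous_plus (fun _ => b) (fun t : R => t [*] v)).
      apply continuous_const.
    apply (continuous_scal_l (fun t : R => t : R_AbsRing) v), continuous_id.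
  - intros t _; apply differential_along_curve.
    apply small_o_ext with (2 := small_o_zero); intros s _; vec.
  - intros t Ht; apply HK; lra.
replace (b [+] 1 [*] v) with (b [+] v) in H by vec.
replace (b [+] 0 [*] v) with b in H by vec.
replace (1 [*] l) with l in H by vec; lra.
Qed.

Lemma norm_segment_le (a b : E) t rho :
  0 <= t <= 1 -> norm a <= rho -> norm b <= rho ->
  norm (b [+] t [*] (a [-] b)) <= rho.
Proof.
intros Ht Ha Hb.
pose proof (norm_le_plus (b [+] t [*] (a [-] b)) ((1 - t) [*] b) (t [*] a)
  ltac:(vec)) as H.
rewrite !norm_scal_pos in H by lra; nra.
Qed.

Lemma lipschitz_in_ball rho k :
  (forall y, norm y <= rho -> op_norm (df y) <= k) ->
  forall a b, norm a <= rho -> norm b <= rho ->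
    norm (f a [-] f b) <= k * norm (a [-] b).
Proof.
intros Hk a b Ha Hb.
replace (f a [-] f b) with (f (b [+] (a [-] b)) [-] f b [-] vzero)
  by (replace (b [+] (a [-] b)) with a by vec; vec).
apply segment_mvi; intros t Ht.
replace (df (b [+] t [*] (a [-] b)) (a [-] b) [-] vzero)
  with (df (b [+] t [*] (a [-] b)) (a [-] b)) by vec.
eapply Rle_trans; [apply op_norm_bound|].
apply Rmult_le_compat_r; [apply norm_ge_0|].
now apply Hk, norm_segment_le.
Qed.

Lemma taylor_in_ball rho k :
  0 <= k ->
  (forall a b, norm a <= rho -> norm b <= rho ->
    op_norm (df a [-] df b) <= k * norm (a [-] b)) ->
  forall a b, norm a <= rho -> norm b <= rho ->
    norm (f a [-] f b [-] df b (a [-] b)) <= k * norm (a [-] b) ^ 2.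
Proof.
intros Hk0 Hk a b Ha Hb.
replace (f a) with (f (b [+] (a [-] b))) by (f_equal; vec).
apply segment_mvi; intros t Ht.
set (x := b [+] t [*] (a [-] b)).
assert (Hx : norm x <= rho) by now apply norm_segment_le.
pose proof (op_norm_bound (df x [-] df b) (a [-] b)) as H.
change (norm (df x (a [-] b) [-] df b (a [-] b))
  <= op_norm (df x [-] df b) * norm (a [-] b)) in H.
pose proof (Hk x b Hx Hb) as H1.
replace (x [-] b) with (t [*] (a [-] b)) in H1 by (unfold x; vec).
rewrite norm_scal_pos in H1 by lra; pose proof (norm_ge_0 (a [-] b)).
assert (t * norm (a [-] b) <= norm (a [-] b)) by nra.
assert (op_norm (df x [-] df b) <= k * norm (a [-] b)) by nra.
simpl; nra.
Qed.

Lemma second_difference_in_ball rho k :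
  0 <= k ->
  (forall a b, norm a <= rho -> norm b <= rho ->
    op_norm (df a [-] df b) <= k * norm (a [-] b)) ->
  forall a b c, norm a <= rho -> norm b <= rho -> norm c <= rho ->
    norm (f a [-] 2 [*] f b [+] f c) <= op_norm (df b) * norm (a [-] 2 [*] b [+] c)
      + k * (norm (a [-] b) ^ 2 + norm (c [-] b) ^ 2).
Proof.
intros Hk0 Hk a b c Ha Hb Hc.
pose proof (taylor_in_ball rho k Hk0 Hk a b Ha Hb) as H1.
pose proof (taylor_in_ball rho k Hk0 Hk c b Hc Hb) as H2.
pose proof (op_norm_bound (df b) (a [-] 2 [*] b [+] c)) as H3.
pose proof (norm_le_plus (f a [-] 2 [*] f b [+] f c)
  (df b (a [-] 2 [*] b [+] c))
  ((f a [-] f b [-] df b (a [-] b)) [+] (f c [-] f b [-] df b (c [-] b)))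
  ltac:(bo_linear; vec)) as H4.
pose proof (norm_add_le (f a [-] f b [-] df b (a [-] b)) (f c [-] f b [-] df b (c [-] b))).
lra.
Qed.

Lemma strict_differential x e : continuous df x -> 0 < e -> exists d, 0 < d /\
  forall a b, norm (a [-] x) < d -> norm (b [-] x) < d ->
    norm (f a [-] f b [-] df x (a [-] b)) <= e * norm (a [-] b).
Proof.
intros Hc He.
destruct (proj1 (continuous_ball_iff (F := bo_NormedModule E F) df x) Hc e He)
  as [d [Hd H]].
exists d; split; auto; intros a b Ha Hb.
replace (f a) with (f (b [+] (a [-] b))) by (f_equal; vec).
apply segment_mvi; intros t Ht.
set (y := b [+] t [*] (a [-] b)).
assert (Hy : norm (y [-] x) < d).
  pose proof (norm_le_plus (y [-] x) ((1 - t) [*] (b [-] x)) (t [*] (a [-] x))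
    ltac:(unfold y; vec)) as H1.
  rewrite !norm_scal_pos in H1 by lra.
  pose proof (norm_ge_0 (b [-] x)); pose proof (norm_ge_0 (a [-] x)).
  set (m := Rmax (norm (b [-] x)) (norm (a [-] x))).
  pose proof (Rmax_l (norm (b [-] x)) (norm (a [-] x))).
  pose proof (Rmax_r (norm (b [-] x)) (norm (a [-] x))).
  assert (m < d) by now apply Rmax_lub_lt.
  fold m in H3, H4; assert (norm (y [-] x) <= m); [|lra].
  assert ((1 - t) * norm (b [-] x) <= (1 - t) * m) by (apply Rmult_le_compat_l; lra).
  assert (t * norm (a [-] x) <= t * m) by (apply Rmult_le_compat_l; lra).
  lra.
specialize (H y Hy).
pose proof (op_norm_bound (df y [-] df x) (a [-] b)) as H1.
change (op_norm (df y [-] df x) < e) in H.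
change (norm (df y (a [-] b) [-] df x (a [-] b))
  <= op_norm (df y [-] df x) * norm (a [-] b)) in H1.
pose proof (norm_ge_0 (a [-] b)); nra.
Qed.

(** Halving the increment repeatedly reduces the Taylor remainder to its own
    [o(v)], at a total cost bounded by a geometric sum of second differences. *)
Lemma taylor_of_second_difference rho K :
  0 <= K ->
  (forall x v, norm x + norm v <= rho ->
    norm (f (x [+] v) [-] 2 [*] f x [+] f (x [-] v)) <= K * norm v ^ 2) ->
  forall x v, norm x + norm v <= rho ->
    norm (f (x [+] v) [-] f x [-] df x v) <= K * norm v ^ 2.
Proof.
intros HK H x v Hv.
set (phi := fun u => f (x [+] u) [-] f x [-] df x u).
assert (Hhalf : forall u, norm x + norm u <= rho ->
  norm (phi u) <= 2 * norm (phi (/ 2 [*] u)) + K * norm u ^ 2 / 4).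
  intros u Hu.
  pose proof (norm_add_le x (/ 2 [*] u)) as H1.
  assert (Hnu : norm (/ 2 [*] u) = norm u / 2) by (rewrite norm_scal_pos; lra).
  specialize (H (x [+] / 2 [*] u) (/ 2 [*] u) ltac:(lra)).
  replace (x [+] / 2 [*] u [+] / 2 [*] u) with (x [+] u) in H by (vec; field).
  replace (x [+] / 2 [*] u [-] / 2 [*] u) with x in H by vec.
  pose proof (norm_le_plus (phi u) (2 [*] phi (/ 2 [*] u))
    (f (x [+] u) [-] 2 [*] f (x [+] / 2 [*] u) [+] f x)
    ltac:(unfold phi; bo_linear; vec; field)) as H2.
  rewrite norm_scal_pos in H2 by lra; rewrite Hnu in H; simpl in *; lra.
assert (Hn : forall n u, norm x + norm u <= rho ->
  norm (phi u) <= 2 ^ n * norm (phi ((/ 2) ^ n [*] u))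
    + K * norm u ^ 2 / 2 * (1 - (/ 2) ^ n)).
  induction n as [|n IH]; intros u Hu.
  - simpl; replace (1 [*] u) with u by vec; lra.
  - assert (Hnu : norm (/ 2 [*] u) = norm u / 2) by (rewrite norm_scal_pos; lra).
    pose proof (norm_ge_0 u); specialize (IH (/ 2 [*] u) ltac:(lra)).
    replace ((/ 2) ^ n [*] (/ 2 [*] u)) with ((/ 2) ^ S n [*] u) in IH
      by (vec; simpl; ring).
    specialize (Hhalf u Hu); rewrite Hnu in IH.
    assert (E1 : 2 ^ S n = 2 * 2 ^ n) by reflexivity.
    assert (E2 : (/ 2) ^ S n = / 2 * (/ 2) ^ n) by reflexivity.
    rewrite E1, E2 at 1; rewrite E2 in IH |- *.
    replace (K * norm u ^ 2 / 2 * (1 - / 2 * (/ 2) ^ n))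
      with (2 * (K * (norm u / 2) ^ 2 / 2 * (1 - (/ 2) ^ n)) + K * norm u ^ 2 / 4)
      by (simpl; field).
    lra.
assert (Hle : norm (phi v) <= K * norm v ^ 2 / 2).
  apply Rnot_lt_le; intros Hlt.
  pose proof (norm_ge_0 v) as Hv0; pose proof (pow2_ge_0 (norm v)).
  set (e := (norm (phi v) - K * norm v ^ 2 / 2) / (norm v + 1)).
  assert (He : 0 < e) by (apply Rdiv_lt_0_compat; lra).
  destruct (differential_at x e He) as [d [Hd Hx]].
  destruct (half_pow_small (norm v) d Hv0 Hd) as [n HN].
  pose proof (pow_lt (/ 2) n ltac:(lra)) as Hp.
  specialize (Hn n v Hv).
  assert (Hsm : norm ((/ 2) ^ n [*] v) < d) by (rewrite norm_scal_pos; lra).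
  specialize (Hx (x [+] (/ 2) ^ n [*] v)).
  replace (x [+] (/ 2) ^ n [*] v [-] x) with ((/ 2) ^ n [*] v) in Hx by vec.
  specialize (Hx Hsm).
  change (norm (phi ((/ 2) ^ n [*] v)) <= e * norm ((/ 2) ^ n [*] v)) in Hx.
  rewrite norm_scal_pos in Hx by lra.
  assert (Hpp : 2 ^ n * (/ 2) ^ n = 1).
    rewrite <- Rpow_mult_distr, Rinv_r by lra; apply pow1.
  assert (2 ^ n * norm (phi ((/ 2) ^ n [*] v)) <= e * norm v).
    apply Rle_trans with (2 ^ n * (e * ((/ 2) ^ n * norm v))).
      apply Rmult_le_compat_l; [apply pow_le; lra|auto].
    right; replace (2 ^ n * (e * ((/ 2) ^ n * norm v)))
      with (e * norm v * (2 ^ n * (/ 2) ^ n)) by ring; rewrite Hpp; ring.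
  assert (K * norm v ^ 2 / 2 * (1 - (/ 2) ^ n) <= K * norm v ^ 2 / 2).
    assert (0 <= K * norm v ^ 2 / 2) by nra; nra.
  assert (e * (norm v + 1) = norm (phi v) - K * norm v ^ 2 / 2)
    by (unfold e; field; lra).
  lra.
change (norm (phi v) <= K * norm v ^ 2).
pose proof (pow2_ge_0 (norm v)); nra.
Qed.

(** Three Taylor expansions, between the vertices of a triangle whose sides are
    comparable with [y - x], compare the differentials at [x] and [y]. *)
Lemma differential_lipschitz_of_second_difference rho K :
  0 <= K ->
  (forall x v, norm x + norm v <= rho ->
    norm (f (x [+] v) [-] 2 [*] f x [+] f (x [-] v)) <= K * norm v ^ 2) ->
  forall x y, norm x <= rho / 8 -> norm y <= rho / 8 ->
    op_norm (df y [-] df x) <= 6 * K * norm (y [-] x).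
Proof.
intros HK H x y Hx Hy.
pose proof (taylor_of_second_difference rho K HK H) as HT.
set (w := y [-] x); assert (Hw0 := norm_ge_0 w).
assert (Hw : norm w <= rho / 4) by (pose proof (norm_minus_le y x); unfold w; lra).
assert (Hxw : y = x [+] w) by (unfold w; vec).
apply op_norm_le; [nra|]; intros v.
change (norm (df y v [-] df x v) <= 6 * K * norm w * norm v).
destruct (Req_dec (norm w) 0) as [H0|H0].
  rewrite (norm_eq_zero w H0 : w = vzero) in Hxw.
  replace y with x by (rewrite Hxw; vec).
  replace (df x v [-] df x v) with (vzero : F) by vec.
  rewrite H0, norm_vzero; lra.
destruct (Req_dec (norm v) 0) as [Hv0|Hv0].
  rewrite (norm_eq_zero v Hv0 : v = vzero), !bo_0.
  replace (vzero [-] vzero) with (vzero : F) by vec.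
  rewrite !norm_vzero; lra.
assert (Hvp := norm_ge_0 v).
set (c := norm w / norm v); assert (Hc : 0 < c) by (apply Rdiv_lt_0_compat; lra).
set (u := c [*] v).
assert (Hu : norm u = norm w).
  unfold u; rewrite norm_scal_pos by lra; unfold c; field; lra.
pose proof (norm_add_le w u) as Hwu.
pose proof (HT x (w [+] u) ltac:(lra)) as T1.
pose proof (HT x w ltac:(lra)) as T2.
pose proof (HT y u ltac:(lra)) as T3.
assert (Hmain : norm (df y u [-] df x u) <= 6 * K * norm w * norm w).
  pose proof (norm_le_plus (df y u [-] df x u)
    (f (x [+] (w [+] u)) [-] f x [-] df x (w [+] u))
    (vopp ((f (x [+] w) [-] f x [-] df x w) [+] (f (y [+] u) [-] f y [-] df y u)))
    ltac:(rewrite Hxw; replace (x [+] (w [+] u)) with (x [+] w [+] u) by vec;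
      bo_linear; vec)) as H1.
  rewrite norm_vopp in H1.
  pose proof (norm_add_le (f (x [+] w) [-] f x [-] df x w)
    (f (y [+] u) [-] f y [-] df y u)).
  assert (K * norm (w [+] u) ^ 2 <= K * (4 * norm w ^ 2)).
    apply Rmult_le_compat_l; [auto|]; pose proof (norm_ge_0 (w [+] u)); nra.
  rewrite Hu in T3; simpl in *; lra.
replace (df y u [-] df x u) with (c [*] (df y v [-] df x v)) in Hmain
  by (unfold u; bo_linear; vec).
rewrite norm_scal_pos in Hmain by lra.
apply Rmult_le_reg_l with c; auto.
replace (c * (6 * K * norm w * norm v)) with (6 * K * norm w * norm w)
  by (unfold c; field; lra).
auto.
Qed.

End Calculus.

(** * Differentiation along the semigroup *)

Section AlongSemigroup.
Context {E : CompleteNormedModule R_AbsRing} {F : NormedModule R_AbsRing}.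
Context (A : unbounded_op E) (T : R -> bounded_op E E).
Hypotheses (HT : C0_semigroup T) (HA : generates A T).
Context (N : E -> F) (dN : E -> bounded_op E F) (r : E -> F).
Hypotheses (HN : C1_with N dN) (Hr : forall x, continuous r x).
Hypothesis HNr : forall x, uo_dom A x -> dN x (A x) = r x.

(** On the domain this is the chain rule. The mean value inequality makes it
    uniform near [x], so that it passes to the limit: the derivative exists even where
    [A x] does not. *)
Lemma derivative_along_semigroup x :
  small_o (fun s => N (T s x) [-] N x [-] s [*] r x).
Proof.
intros e He.
destruct (proj1 (continuous_ball_iff (E := E) (F := F) r x) (Hr x) e He)
  as [d1 [Hd1 Hr1]].
destruct (semigroup_bounded T HT 1) as [K [HK HTb]].
destruct (semigroup_right_limit T x HT (d1 / 2)) as [d2 [Hd2 H2]]; [lra|].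
exists (Rmin 1 d2); split; [apply Rmin_glb_lt; lra|]; intros s Hs.
pose proof (Rmin_l 1 d2); pose proof (Rmin_r 1 d2).
apply Rnot_lt_le; intros Hlt.
set (g := norm (N (T s x) [-] N x [-] s [*] r x) - e * s) in *.
assert (Hg : 0 < g) by (unfold g; lra).
pose proof (differentiable_continuous N dN (proj1 HN)) as HNc.
destruct (proj1 (continuous_ball_iff N (T s x)) (HNc _) (g / 3)) as [d3 [Hd3 H3]]; [lra|].
destruct (proj1 (continuous_ball_iff (E := E) N x) (HNc _) (g / 3)) as [d4 [Hd4 H4]]; [lra|].
destruct (domain_dense A T HT HA x (Rmin (d1 / 2 / K) (Rmin (d3 / K) d4)))
  as [x' [Hx' Hxx]].
  repeat apply Rmin_glb_lt; try lra; apply Rdiv_lt_0_compat; lra.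
pose proof (Rmin_l (d1 / 2 / K) (Rmin (d3 / K) d4)) as M1.
pose proof (Rmin_r (d1 / 2 / K) (Rmin (d3 / K) d4)) as M2.
pose proof (Rmin_l (d3 / K) d4) as M3; pose proof (Rmin_r (d3 / K) d4) as M4.
assert (B1 : K * norm (x' [-] x) < d1 / 2).
  apply mul_div_lt; lra.
assert (B2 : K * norm (x' [-] x) < d3).
  apply mul_div_lt; lra.
set (y := fun t => N (T (Rmax 0 t) x')).
assert (Hmv : norm (y s [-] y 0 [-] s [*] r x) <= e * s).
{ apply (right_derivative_mvi y (fun t => r (T t x'))); [lra| | |].
  - intros t; apply (continuous_comp (fun t => T (Rmax 0 t) x') N).
      now apply semigroup_orbit_continuous.
    apply HNc.
  - intros t Ht.
    destruct (generator_invariant A T HT HA x' t ltac:(lra) Hx') as [Hd HAt].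
    rewrite <- (HNr _ Hd), HAt.
    apply small_o_ext with (fun u => N (T (t + u) x') [-] N (T t x')
      [-] u [*] dN (T t x') (T t (A x'))).
      intros u Hu; unfold y; now rewrite !Rmax_right by lra.
    apply (differential_along_curve N dN (proj1 HN) (T t x') (fun u => T (t + u) x')).
    apply semigroup_right_derivative with (A := A); auto; lra.
  - intros t Ht; apply Rlt_le, Hr1.
    pose proof (norm_le_plus (T t x' [-] x) (T t (x' [-] x)) (T t x [-] x)
      ltac:(bo_linear; vec)).
    pose proof (HTb t ltac:(lra) (x' [-] x)); specialize (H2 t ltac:(lra)); lra. }
unfold y in Hmv; rewrite (Rmax_right 0 s), (Rmax_left 0 0), (proj1 HT) in Hmv by lra.
specialize (H4 x' ltac:(lra)).
specialize (H3 (T s x')); rewrite <- bo_sub in H3.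
pose proof (HTb s ltac:(lra) (x' [-] x)); specialize (H3 ltac:(lra)).
pose proof (norm_le_plus (N (T s x) [-] N x [-] s [*] r x)
  (N (T s x') [-] N x' [-] s [*] r x)
  ((N x' [-] N x) [-] (N (T s x') [-] N (T s x))) ltac:(vec)).
pose proof (norm_minus_le (N x' [-] N x) (N (T s x') [-] N (T s x))).
unfold g in *; lra.
Qed.

(** A first-order perturbation of the orbit of [x] adds the derivative of [N] in the direction [b];
    this is where the strict differentiability of a C1 map is used, the base point [T s x]
    being variable. *)
Lemma derivative_along_perturbed_semigroup x b (z : R -> E) :
  small_o (fun s => z s [-] T s x [-] s [*] b) ->
  small_o (fun s => N (z s) [-] N x [-] s [*] (r x [+] dN x b)).
Proof.
intros Hz.
apply small_o_ext with (fun s => (N (T s x) [-] N x [-] s [*] r x)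
  [+] ((N (z s) [-] N (T s x) [-] dN x (z s [-] T s x))
  [+] dN x (z s [-] T s x [-] s [*] b))).
  intros s _; bo_linear; vec.
apply small_o_plus; [apply derivative_along_semigroup|].
apply small_o_plus; [|now apply small_o_map].
intros e He.
set (n := norm b + 1); assert (Hn : 1 <= n) by (pose proof (norm_ge_0 b); unfold n; lra).
destruct (strict_differential N dN (proj1 HN) x (e / n) (proj2 HN x)) as [d [Hd H]].
  apply Rdiv_lt_0_compat; lra.
destruct (Hz 1 Rlt_0_1) as [d1 [Hd1 H1]].
destruct (semigroup_right_limit T x HT (d / 2)) as [d2 [Hd2 H2]]; [lra|].
exists (Rmin (d / 2 / n) (Rmin d1 d2)).
split; [repeat apply Rmin_glb_lt; try lra; apply Rdiv_lt_0_compat; lra|].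
intros s Hs.
pose proof (Rmin_l (d / 2 / n) (Rmin d1 d2)) as M1.
pose proof (Rmin_r (d / 2 / n) (Rmin d1 d2)) as M2.
pose proof (Rmin_l d1 d2) as M3; pose proof (Rmin_r d1 d2) as M4.
specialize (H1 s ltac:(lra)); specialize (H2 s ltac:(lra)).
pose proof (norm_le_plus (z s [-] T s x) (s [*] b) (z s [-] T s x [-] s [*] b)
  ltac:(vec)) as H3.
rewrite norm_scal_pos in H3 by lra.
assert (Hns : norm (z s [-] T s x) <= n * s) by (unfold n; lra).
assert (Hnd : n * s < d / 2).
  apply mul_div_lt; lra.
pose proof (norm_le_plus (z s [-] x) (z s [-] T s x) (T s x [-] x) ltac:(vec)).
specialize (H (z s) (T s x) ltac:(lra) ltac:(lra)).
apply Rle_trans with (1 := H).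
apply Rle_trans with (e / n * (n * s)); [|right; field; lra].
apply Rmult_le_compat_l; [apply Rlt_le, Rdiv_lt_0_compat|]; lra.
Qed.

End AlongSemigroup.

(** * Regularity of solutions of the first-order equation near the origin *)

Section ContractingNorms.
Context {E : CompleteNormedModule R_AbsRing} {T : R -> bounded_op E E}.
Context {p : E -> R} {c1 c2 w : R}.
Hypothesis Hp : contracting_norm T p c1 c2 w.

Lemma cn_zero : p vzero = 0.
Proof.
replace (vzero : E) with (0 [*] (vzero : E)) by vec.
rewrite (cn_scal Hp), Rabs_R0; ring.
Qed.

Lemma cn_opp x : p (vopp x) = p x.
Proof.
replace (vopp x) with ((-1) [*] x) by vec.
rewrite (cn_scal Hp), Rabs_left by lra; ring.
Qed.

Lemma cn_nonneg x : 0 <= p x.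
Proof.
pose proof (cn_lower Hp x); pose proof (norm_ge_0 x).
pose proof (cn_c1 Hp); nra.
Qed.

Lemma cn_norm_le x : norm x <= p x / c1.
Proof.
pose proof (cn_lower Hp x); pose proof (cn_c1 Hp).
apply Rmult_le_reg_r with c1; [auto|].
replace (p x / c1 * c1) with (p x) by (field; lra); lra.
Qed.

Lemma cn_sub_lipschitz x y : Rabs (p x - p y) <= c2 * norm (x [-] y).
Proof.
pose proof (cn_triangle Hp (x [-] y) y) as H1.
pose proof (cn_triangle Hp (vopp (x [-] y)) x) as H2.
replace (x [-] y [+] y) with x in H1 by vec.
replace (vopp (x [-] y) [+] x) with y in H2 by vec.
rewrite cn_opp in H2; pose proof (cn_upper Hp (x [-] y)).
apply Rabs_le; lra.
Qed.

Lemma cn_continuous (z : R -> E) t : continuous z t -> continuous (fun u => p (z u)) t.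
Proof.
intros Hz; apply continuous_R_R_iff; intros e He.
pose proof (cn_c2 Hp).
destruct (proj1 (continuous_R_iff (E := E) z t) Hz (e / c2)) as [d [Hd H1]].
  now apply Rdiv_lt_0_compat.
exists d; split; auto; intros s Hs; specialize (H1 s Hs).
apply Rle_lt_trans with (1 := cn_sub_lipschitz (z s) (z t)).
apply mul_div_lt; lra.
Qed.

Lemma cn_semigroup_bound t x : 0 <= t -> norm (T t x) <= c2 / c1 * norm x.
Proof.
intros Ht; pose proof (cn_c1 Hp); pose proof (cn_w Hp).
apply Rle_trans with (1 := cn_norm_le _).
assert (He := exp_decay_le_1 w t (Rlt_le _ _ H0) Ht).
pose proof (cn_decay Hp t x Ht); pose proof (cn_upper Hp x).
pose proof (cn_nonneg x).
replace (c2 / c1 * norm x) with (c2 * norm x / c1) by (field; lra).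
apply Rmult_le_compat_r; [apply Rlt_le, Rinv_0_lt_compat; lra|nra].
Qed.

(** In [p (T s (z t) + s * l + o(s))] the first term has decreased by the factor [exp (- w s)]. *)
Lemma dini_contracting (z : R -> E) t l :
  mild_derivative T z t l -> dini_le (fun u => p (z u)) t (- w * p (z t) + p l).
Proof.
intros Hz e He.
pose proof (cn_c2 Hp) as Hc2.
destruct (Hz (e / 2 / c2)) as [d1 [Hd1 H1]]; [apply Rdiv_lt_0_compat; lra|].
set (a := p (z t)); assert (Ha : 0 <= a) by apply cn_nonneg.
assert (Hder : is_derive (fun s => exp (- w * s) * a) 0 (- w * a)).
  auto_derive; [auto|]; rewrite Rmult_0_r, exp_0; ring.
destruct (derive_right_expansion _ _ _ Hder (e / 2)) as [d2 [Hd2 H2]]; [lra|].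
exists (Rmin d1 d2); split; [now apply Rmin_glb_lt|]; intros s Hs.
pose proof (Rmin_l d1 d2); pose proof (Rmin_r d1 d2).
specialize (H1 s ltac:(lra)); specialize (H2 s ltac:(lra)).
rewrite Rplus_0_l, Rmult_0_r, exp_0 in H2; apply Rabs_le_between in H2.
set (q := z (t + s) [-] T s (z t) [-] s [*] l) in *.
pose proof (cn_triangle Hp (T s (z t)) (s [*] l [+] q)) as H3.
replace (T s (z t) [+] (s [*] l [+] q)) with (z (t + s)) in H3 by (unfold q; vec).
pose proof (cn_triangle Hp (s [*] l) q) as H4.
rewrite (cn_scal Hp), Rabs_pos_eq in H4 by lra.
pose proof (cn_upper Hp q).
assert (c2 * norm q <= e / 2 * s).
  apply mul_div_le; lra.
pose proof (cn_decay Hp s (z t) ltac:(lra)) as H7; fold a in H7.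
lra.
Qed.

End ContractingNorms.

(** The radial retraction turns a map that is Lipschitz in a ball into a globally
    Lipschitz one. *)
Section Retraction.
Context {E : NormedModule R_AbsRing}.
Implicit Types x y : E.

Definition retract (rho : R) (x : E) : E :=
  if Rle_dec (norm x) rho then x else (rho / norm x) [*] x.

Lemma retract_inside rho x : norm x <= rho -> retract rho x = x.
Proof. intros H; unfold retract; now destruct (Rle_dec (norm x) rho). Qed.

Lemma retract_norm rho x : 0 <= rho -> norm (retract rho x) <= rho.
Proof.
intros H; unfold retract; destruct (Rle_dec (norm x) rho) as [|Hn]; [auto|].
rewrite norm_scal_pos by (apply Rdiv_le_0_compat; lra).
right; field; lra.
Qed.

Lemma norm_sub_abs x y : Rabs (norm x - norm y) <= norm (x [-] y).
Proof.
pose proof (norm_le_plus x (x [-] y) y ltac:(vec)).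
pose proof (norm_le_plus y (y [-] x) x ltac:(vec)).
rewrite (norm_minus_sym y x) in H0; apply Rabs_le; lra.
Qed.

Lemma retract_lipschitz rho x y :
  0 <= rho -> norm (retract rho x [-] retract rho y) <= 2 * norm (x [-] y).
Proof.
intros Hrho.
assert (Hone : forall a b : E, norm a <= rho -> rho < norm b ->
  norm (a [-] (rho / norm b) [*] b) <= 2 * norm (a [-] b)).
  intros a b Ha Hb.
  pose proof (norm_sub_abs a b) as Hab; apply Rabs_le_between in Hab.
  pose proof (norm_le_plus (a [-] (rho / norm b) [*] b) (a [-] b)
    ((1 - rho / norm b) [*] b) ltac:(vec)) as H.
  assert (rho / norm b <= 1).
    apply Rmult_le_reg_r with (norm b); [lra|].
    replace (rho / norm b * norm b) with rho by (field; lra); lra.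
  rewrite norm_scal_pos in H by lra.
  replace ((1 - rho / norm b) * norm b) with (norm b - rho) in H by (field; lra).
  lra.
unfold retract; destruct (Rle_dec (norm x) rho) as [Hx|Hx],
  (Rle_dec (norm y) rho) as [Hy|Hy].
- pose proof (norm_ge_0 (x [-] y)); lra.
- apply Hone; lra.
- rewrite norm_minus_sym, (norm_minus_sym x); apply Hone; lra.
- pose proof (norm_sub_abs x y) as Hab.
  pose proof (norm_le_plus ((rho / norm x) [*] x [-] (rho / norm y) [*] y)
    ((rho / norm x) [*] (x [-] y)) ((rho / norm x - rho / norm y) [*] y)
    ltac:(vec)) as H.
  assert (Hq : 0 <= rho / norm x <= 1).
    split; [apply Rdiv_le_0_compat; lra|].
    apply Rmult_le_reg_r with (norm x); [lra|].
    replace (rho / norm x * norm x) with rho by (field; lra); lra.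
  rewrite norm_scal_pos, norm_scal_eq in H by lra.
  assert (Heq : Rabs (rho / norm x - rho / norm y) * norm y
    = rho / norm x * Rabs (norm x - norm y)).
    rewrite <- (Rabs_pos_eq (norm y)) at 2 by lra; rewrite <- Rabs_mult.
    replace ((rho / norm x - rho / norm y) * norm y)
      with (rho / norm x * (norm y - norm x)) by (field; lra).
    rewrite Rabs_mult, (Rabs_pos_eq (rho / norm x)), Rabs_minus_sym by lra.
    reflexivity.
  rewrite Heq in H; pose proof (norm_ge_0 (x [-] y)).
  pose proof (Rabs_pos (norm x - norm y)); nra.
Qed.

End Retraction.

Lemma continuous_operator_apply {E F G : NormedModule R_AbsRing}
  (S : E -> bounded_op F G) (f : E -> F) x :
  continuous S x -> continuous f x -> continuous (fun y => S y (f y)) x.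
Proof.
intros HS Hf; apply continuous_ball_iff; intros e He.
set (m := norm (f x) + 1); assert (Hm : 1 <= m)
  by (pose proof (norm_ge_0 (f x)); unfold m; lra).
set (o := op_norm (S x) + 1); assert (Ho : 1 <= o)
  by (pose proof (op_norm_ge0 (S x)); unfold o; lra).
destruct (proj1 (continuous_ball_iff (F := bo_NormedModule F G) S x) HS (e / 2 / m))
  as [d1 [Hd1 H1]]; [apply Rdiv_lt_0_compat; lra|].
destruct (proj1 (continuous_ball_iff f x) Hf (Rmin 1 (e / 2 / o))) as [d2 [Hd2 H2]].
  apply Rmin_glb_lt; [lra|apply Rdiv_lt_0_compat; lra].
exists (Rmin d1 d2); split; [now apply Rmin_glb_lt|]; intros y Hy.
pose proof (Rmin_l d1 d2); pose proof (Rmin_r d1 d2).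
specialize (H1 y ltac:(lra)); specialize (H2 y ltac:(lra)).
change (op_norm (S y [-] S x) < e / 2 / m) in H1.
pose proof (Rmin_l 1 (e / 2 / o)); pose proof (Rmin_r 1 (e / 2 / o)).
pose proof (op_norm_bound (S y [-] S x) (f y)) as H5.
change (norm (S y (f y) [-] S x (f y)) <= op_norm (S y [-] S x) * norm (f y)) in H5.
pose proof (op_norm_bound (S x) (f y [-] f x)) as H6.
pose proof (norm_le_plus (S y (f y) [-] S x (f x)) (S y (f y) [-] S x (f y))
  (S x (f y [-] f x)) ltac:(bo_linear; vec)) as H7.
pose proof (norm_le_plus (f y) (f y [-] f x) (f x) ltac:(vec)) as H8.
assert (op_norm (S y [-] S x) * norm (f y) <= e / 2).
  apply Rle_trans with (e / 2 / m * m); [|right; field; lra].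
  apply Rmult_le_compat; [apply op_norm_ge0|apply norm_ge_0|lra|unfold m; lra].
assert (op_norm (S x) * norm (f y [-] f x) < e / 2).
  apply Rle_lt_trans with ((o - 1) * (e / 2 / o)).
    apply Rmult_le_compat; [apply op_norm_ge0|apply norm_ge_0|unfold o; lra|lra].
  apply Rlt_le_trans with (o * (e / 2 / o)); [|right; field; lra].
  apply Rmult_lt_compat_r; [apply Rdiv_lt_0_compat; lra|lra].
lra.
Qed.

Section SecondDifferences.
Context {E : CompleteNormedModule R_AbsRing} {F : NormedModule R_AbsRing}.
Context (A : unbounded_op E) (T : R -> bounded_op E E).
Hypotheses (HT : C0_semigroup T) (HA : generates A T).
Context (p : E -> R) (c1 c2 w : R).
Hypothesis Hp : contracting_norm T p c1 c2 w.
Context (f : E -> E) (eps k rho : R).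
Hypothesis f_zero : f vzero = vzero.
Hypotheses (rho_pos : 0 < rho) (eps_pos : 0 <= eps) (k_pos : 0 <= k).
Hypothesis eps_small : 2 * c2 * eps <= w / 2 * c1.
Hypothesis f_cont : forall x, continuous f x.
Hypothesis f_lip : forall a b, norm a <= rho -> norm b <= rho ->
  norm (f a [-] f b) <= eps * norm (a [-] b).
Hypothesis f_second : forall a b c, norm a <= rho -> norm b <= rho -> norm c <= rho ->
  norm (f a [-] 2 [*] f b [+] f c) <= eps * norm (a [-] 2 [*] b [+] c)
    + k * (norm (a [-] b) ^ 2 + norm (c [-] b) ^ 2).

Definition truncated_field (x : E) : E := f (retract rho x).

Lemma truncated_field_lipschitz x y :
  norm (truncated_field x [-] truncated_field y) <= 2 * eps * norm (x [-] y).
Proof.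
apply Rle_trans with (eps * norm (retract rho x [-] retract rho y)).
  apply f_lip; apply retract_norm; lra.
pose proof (retract_lipschitz rho x y ltac:(lra)); nra.
Qed.

Lemma truncated_field_contraction x y :
  p (truncated_field x [-] truncated_field y) <= w / 2 * p (x [-] y).
Proof.
pose proof (cn_c2 Hp); pose proof (cn_w Hp).
apply Rle_trans with (1 := cn_upper Hp _).
pose proof (truncated_field_lipschitz x y).
pose proof (cn_lower Hp (x [-] y)); pose proof (norm_ge_0 (x [-] y)).
apply Rle_trans with (c2 * (2 * eps * norm (x [-] y))); [apply Rmult_le_compat_l; lra|].
apply Rle_trans with (w / 2 * (c1 * norm (x [-] y))); [nra|].
apply Rmult_le_compat_l; lra.
Qed.

Definition truncated_solution (v : R -> E) : Prop :=
  (forall t, continuous v t) /\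
  forall t, 0 <= t -> mild_derivative T v t (truncated_field (v t)).

Lemma truncated_solution_exists x : exists v, truncated_solution v /\ v 0 = x.
Proof.
pose proof (cn_c1 Hp); pose proof (cn_c2 Hp).
destruct (mild_existence T HT truncated_field (c2 / c1) (2 * eps) x) as [v [Hc Hv]].
- intros r Hr y; now apply (cn_semigroup_bound Hp).
- apply Rlt_le, Rdiv_lt_0_compat; lra.
- lra.
- apply truncated_field_lipschitz.
- exists v; split; [split; [auto|]|exact (duhamel_initial T HT _ _ _ Hv)].
  intros t Ht; apply (duhamel_expansion T HT _ x v t Hv Ht).
  apply (continuous_comp v truncated_field); auto.
  exact (lipschitz_continuous (E := E) (F := E) _ _ truncated_field_lipschitz _).
Qed.

Lemma zero_truncated_solution : truncated_solution (fun _ => vzero).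
Proof.
split; [intros t; apply continuous_const|]; intros t _.
apply small_o_ext with (2 := small_o_zero); intros s _.
unfold truncated_field; rewrite retract_inside by (rewrite norm_vzero; lra).
rewrite f_zero, bo_0; vec.
Qed.

Lemma truncated_solution_gap (v1 v2 : R -> E) t :
  truncated_solution v1 -> truncated_solution v2 -> 0 <= t ->
  dini_le (fun u => p (v1 u [-] v2 u)) t (- (w / 2) * p (v1 t [-] v2 t)).
Proof.
intros [_ H1] [_ H2] Ht.
apply dini_mono with
  (- w * p (v1 t [-] v2 t) + p (truncated_field (v1 t) [-] truncated_field (v2 t))).
  pose proof (truncated_field_contraction (v1 t) (v2 t)); lra.
apply (dini_contracting Hp (fun u => v1 u [-] v2 u)).
now apply mild_derivative_sub; [apply H1|apply H2].
Qed.

Lemma truncated_solution_decay (v : R -> E) t :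
  truncated_solution v -> 0 <= t -> p (v t) <= exp (- (w / 2) * t) * p (v 0).
Proof.
intros Hv Ht; pose proof (cn_w Hp).
replace (v t) with (v t [-] vzero) by vec; replace (v 0) with (v 0 [-] vzero) by vec.
apply (dini_decay_global (fun u => p (v u [-] vzero))); [|lra|apply (cn_nonneg Hp)| |auto].
- intros s; apply (cn_continuous Hp (fun u => v u [-] vzero)).
  apply (continuous_minus v (fun _ => vzero)); [apply Hv|apply continuous_const].
- intros s Hs; apply (truncated_solution_gap v (fun _ => vzero)); auto.
  apply zero_truncated_solution.
Qed.

Lemma truncated_solution_inside (v : R -> E) t :
  truncated_solution v -> norm (v 0) <= rho * c1 / c2 -> 0 <= t ->
  norm (v t) <= rho /\ truncated_field (v t) = f (v t).
Proof.
intros Hv H0 Ht; pose proof (cn_c1 Hp); pose proof (cn_c2 Hp); pose proof (cn_w Hp).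
assert (Hin : norm (v t) <= rho); [|now split; [|unfold truncated_field; rewrite retract_inside]].
pose proof (truncated_solution_decay v t Hv Ht).
pose proof (exp_decay_le_1 (w / 2) t ltac:(lra) Ht); pose proof (cn_nonneg Hp (v 0)).
pose proof (cn_upper Hp (v 0)); pose proof (cn_lower Hp (v t)).
pose proof (mul_div_le c2 _ _ ltac:(lra) H0).
apply Rmult_le_reg_l with c1; nra.
Qed.

Context (N : E -> F) (dN : E -> bounded_op E F) (q : E -> F) (kq : R).
Hypotheses (HN : C1_with N dN) (N_zero : N vzero = vzero).
Hypothesis HNq : forall x, uo_dom A x -> dN x (A x [+] f x) = q x.
Hypothesis q_cont : forall x, continuous q x.
Hypothesis kq_pos : 0 <= kq.
Hypothesis q_second : forall a b c, norm a <= rho -> norm b <= rho -> norm c <= rho ->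
  norm (q a [-] 2 [*] q b [+] q c) <= kq * norm (a [-] 2 [*] b [+] c)
    + kq * (norm (a [-] b) ^ 2 + norm (c [-] b) ^ 2).

Lemma derivative_along_solution (v : R -> E) t :
  truncated_solution v -> norm (v 0) <= rho * c1 / c2 -> 0 <= t ->
  right_derivative (fun s => N (v s)) t (q (v t)).
Proof.
intros Hv H0 Ht; assert (Hd := proj2 Hv t Ht).
rewrite (proj2 (truncated_solution_inside v t Hv H0 Ht)) in Hd.
replace (q (v t)) with ((q (v t) [-] dN (v t) (f (v t))) [+] dN (v t) (f (v t))) by vec.
apply (derivative_along_perturbed_semigroup A T HT HA N dN
  (fun y => q y [-] dN y (f y)) HN); auto.
- intros y; apply (continuous_minus q (fun y => dN y (f y))); auto.
  apply (continuous_operator_apply dN f); auto; apply (proj2 HN).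
- intros y Hy; rewrite <- (HNq y Hy), bo_add; vec.
Qed.

Lemma vanishing_along_solution (v : R -> E) e :
  truncated_solution v -> norm (v 0) <= rho * c1 / c2 -> 0 < e ->
  exists t0, 0 <= t0 /\ forall t, t0 <= t -> norm (N (v t)) < e.
Proof.
intros Hv H0 He.
pose proof (cn_c1 Hp) as Hc1; pose proof (cn_w Hp).
destruct (proj1 (continuous_ball_iff (E := E) N vzero)
  (differentiable_continuous N dN (proj1 HN) vzero) e He) as [d [Hd HNd]].
destruct (exp_decay_small (p (v 0)) (w / 2) (c1 * d)) as [t0 [Ht0 Hs]];
  [apply (cn_nonneg Hp)|lra|nra|].
exists t0; split; auto; intros t Ht.
replace (N (v t)) with (N (v t) [-] N vzero) by (rewrite N_zero; vec).
apply HNd; replace (v t [-] vzero) with (v t) by vec.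
apply Rmult_lt_reg_l with c1; auto; apply Rle_lt_trans with (1 := cn_lower Hp (v t)).
apply Rle_lt_trans with (2 := Hs).
apply Rle_trans with (1 := truncated_solution_decay v t Hv ltac:(lra)).
apply Rmult_le_compat_r; [apply (cn_nonneg Hp)|].
destruct (Req_dec t t0) as [->|]; [lra|apply Rlt_le, exp_increasing; nra].
Qed.

(** Along the flow of [A + f] the derivative of [N] is [q]. Let [D] be the second
    difference of the solutions started at [x + v], [x] and [x - v], and [S] the sum of
    the squares of the distances, for [p], from the outer two to the middle one. Both
    [p D] and [S] decay exponentially, up to a source of order [S] for [p D]. Their
    combination [al * p D + be * S] therefore pays for the growth of the second
    difference of [N] along the solutions, which tends to zero: initially it is at most
    [be * S], of order [norm v ^ 2]. *)
Lemma second_difference_bound : exists K, 0 <= K /\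
  forall x v, norm x + norm v <= rho * c1 / c2 ->
    norm (N (x [+] v) [-] 2 [*] N x [+] N (x [-] v)) <= K * norm v ^ 2.
Proof.
pose proof (cn_c1 Hp) as Hc1; pose proof (cn_c2 Hp) as Hc2; pose proof (cn_w Hp) as Hw.
set (al := 2 * kq / (c1 * w)).
set (be := (kq + al * c2 * k) / (c1 ^ 2 * w)).
assert (Hal : 0 <= al) by (apply Rdiv_le_0_compat; nra).
assert (Hbe : 0 <= be).
  assert (0 <= al * c2 * k) by (apply Rmult_le_pos; [apply Rmult_le_pos|]; lra).
  apply Rdiv_le_0_compat; [lra|apply Rmult_lt_0_compat; [apply pow_lt|]; auto].
exists (2 * be * c2 ^ 2); split; [pose proof (pow2_ge_0 c2); nra|].
intros x v Hxv.
destruct (truncated_solution_exists (x [+] v)) as [va [Sa Ia]].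
destruct (truncated_solution_exists x) as [vb [Sb Ib]].
destruct (truncated_solution_exists (x [-] v)) as [vc [Sc Ic]].
assert (Na : norm (va 0) <= rho * c1 / c2).
  rewrite Ia; pose proof (norm_add_le x v); lra.
assert (Nb : norm (vb 0) <= rho * c1 / c2) by (rewrite Ib; pose proof (norm_ge_0 v); lra).
assert (Nc : norm (vc 0) <= rho * c1 / c2).
  rewrite Ic; pose proof (norm_minus_le x v); lra.
set (D := fun t => va t [-] 2 [*] vb t [+] vc t).
set (a := fun t => p (va t [-] vb t)); set (c := fun t => p (vc t [-] vb t)).
set (S := fun t => a t * a t + c t * c t).
set (n := fun t => N (va t) [-] 2 [*] N (vb t) [+] N (vc t)).
assert (Ha : forall t, 0 <= a t) by (intros t; apply (cn_nonneg Hp)).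
assert (Hc : forall t, 0 <= c t) by (intros t; apply (cn_nonneg Hp)).
assert (Hdist : forall t, norm (va t [-] vb t) ^ 2 + norm (vc t [-] vb t) ^ 2 <= S t / c1 ^ 2).
  intros t; apply le_div; [apply pow_lt; auto|].
  pose proof (cn_lower Hp (va t [-] vb t)) as H1.
  pose proof (cn_lower Hp (vc t [-] vb t)) as H2.
  fold (a t) in H1; fold (c t) in H2.
  pose proof (norm_ge_0 (va t [-] vb t)); pose proof (norm_ge_0 (vc t [-] vb t)).
  rewrite Rmult_plus_distr_l, <- !Rpow_mult_distr; unfold S.
  replace (a t * a t) with (a t ^ 2) by ring; replace (c t * c t) with (c t ^ 2) by ring.
  apply Rplus_le_compat; apply pow_incr; nra.
assert (Ca := proj1 Sa); assert (Cb := proj1 Sb); assert (Cc := proj1 Sc).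
assert (HNc := differentiable_continuous N dN (proj1 HN)).
set (Phi := fun t => norm (n t [-] n 0) + (al * p (D t) + be * S t)).
assert (HPhi : forall t, 0 <= t -> Phi t <= 2 * be * (p v * p v)).
{ intros t Ht; apply (dini_nonincreasing Phi t _ 1); [|lra| | |lra].
  - intros s.
    assert (Hsq : forall z : R -> E, continuous z s -> continuous (fun u => p (z u) * p (z u)) s).
      intros z Hz; apply (continuous_mult (K := R_AbsRing) (fun u => p (z u)));
        now apply (cn_continuous Hp).
    apply (continuous_plus (V := R_NormedModule) (fun t => norm (n t [-] n 0))).
      apply continuous_norm_minus.
      apply (continuous_plus (fun t => N (va t) [-] 2 [*] N (vb t)) (fun t => N (vc t)));
        [|now apply continuous_comp].
      apply (continuous_minus (fun t => N (va t)) (fun t => 2 [*] N (vb t)));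
        [now apply continuous_comp|].
      now apply (continuous_scal_r (2 : R_AbsRing) (fun t => N (vb t))), continuous_comp.
    apply (continuous_plus (V := R_NormedModule) (fun t => al * p (D t)) (fun t => be * S t)).
      apply (continuous_scal_r (V := R_NormedModule) al), (cn_continuous Hp).
      apply (continuous_plus (fun t => va t [-] 2 [*] vb t) vc); auto.
      apply (continuous_minus va (fun t => 2 [*] vb t)); auto.
      now apply (continuous_scal_r (2 : R_AbsRing) vb).
    apply (continuous_scal_r (V := R_NormedModule) be).
    apply (continuous_plus (V := R_NormedModule) (fun t => a t * a t) (fun t => c t * c t)).
      now apply Hsq, (continuous_minus va vb).
    now apply Hsq, (continuous_minus vc vb).
  - unfold Phi, S, a, c, D; rewrite Ia, Ib, Ic.
    replace (n 0 [-] n 0) with (vzero : F) by vec.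
    replace (x [+] v [-] 2 [*] x [+] (x [-] v)) with (vzero : E) by vec.
    replace (x [+] v [-] x) with v by vec; replace (x [-] v [-] x) with (vopp v) by vec.
    rewrite (cn_opp Hp), (cn_zero Hp), norm_vzero; lra.
  - intros s [Hs _] _.
    destruct (truncated_solution_inside va s Sa Na Hs) as [Ra Fa].
    destruct (truncated_solution_inside vb s Sb Nb Hs) as [Rb Fb].
    destruct (truncated_solution_inside vc s Sc Nc Hs) as [Rc Fc].
    set (l := f (va s) [-] 2 [*] f (vb s) [+] f (vc s)).
    set (Q := q (va s) [-] 2 [*] q (vb s) [+] q (vc s)).
    pose proof (f_second (va s) (vb s) (vc s) Ra Rb Rc) as H1.
    pose proof (q_second (va s) (vb s) (vc s) Ra Rb Rc) as H2.
    fold l (D s) in H1; fold Q (D s) in H2.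
    specialize (Hdist s).
    set (sq := norm (va s [-] vb s) ^ 2 + norm (vc s [-] vb s) ^ 2) in *.
    set (S1 := S s / c1 ^ 2) in *.
    assert (HS1 : S s = c1 ^ 2 * S1) by (unfold S1; field; lra).
    pose proof (cn_lower Hp (D s)) as H3; pose proof (norm_ge_0 (D s)) as H4.
    assert (B1 : k * sq <= k * S1) by (apply Rmult_le_compat_l; lra).
    assert (B2 : kq * sq <= kq * S1) by (apply Rmult_le_compat_l; lra).
    assert (Hl : p l <= w / 2 * p (D s) + c2 * k * S1).
      apply Rle_trans with (1 := cn_upper Hp l).
      apply Rle_trans with (c2 * eps * norm (D s) + c2 * k * S1).
        apply Rle_trans with (c2 * (eps * norm (D s) + k * S1)); [|lra].
        apply Rmult_le_compat_l; lra.
      assert (c2 * eps <= w / 2 * c1) by (assert (0 <= c2 * eps) by nra; lra).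
      assert (c2 * eps * norm (D s) <= w / 2 * c1 * norm (D s))
        by (apply Rmult_le_compat_r; lra).
      assert (w / 2 * (c1 * norm (D s)) <= w / 2 * p (D s))
        by (apply Rmult_le_compat_l; lra).
      lra.
    apply dini_mono with (norm Q + (al * (- w * p (D s) + p l)
      + be * (2 * (- (w / 2) * a s) * a s + 2 * (- (w / 2) * c s) * c s))).
    + assert (Hal' : al * (w / 2) * p (D s) = kq * (p (D s) / c1))
        by (unfold al; field; lra).
      assert (Hbe' : be * w * S s = (kq + al * c2 * k) * S1)
        by (rewrite HS1; unfold be; field; lra).
      assert (norm (D s) <= p (D s) / c1) by (apply le_div; lra).
      assert (kq * norm (D s) <= kq * (p (D s) / c1)) by (apply Rmult_le_compat_l; lra).
      assert (al * p l <= al * (w / 2 * p (D s) + c2 * k * S1))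
        by (apply Rmult_le_compat_l; lra).
      replace (be * (2 * (- (w / 2) * a s) * a s + 2 * (- (w / 2) * c s) * c s))
        with (- (be * w * S s)) by (unfold S; field).
      lra.
    + apply dini_plus; [|apply dini_plus].
      * apply dini_norm, right_derivative_add; [apply right_derivative_sub|];
          [|apply right_derivative_scal|]; now apply derivative_along_solution.
      * apply dini_scale; auto; apply (dini_contracting Hp).
        unfold l; rewrite <- Fa, <- Fb, <- Fc.
        apply mild_derivative_add; [apply mild_derivative_sub|];
          [|apply mild_derivative_scal|]; [now apply Sa|now apply Sb|now apply Sc].
      * apply dini_scale; auto; apply dini_plus; apply dini_square; auto;
          now apply truncated_solution_gap. }
assert (Hfinal : norm (n 0) <= 2 * be * (p v * p v)).
{ apply Rnot_lt_le; intros Hlt; set (g := norm (n 0) - 2 * be * (p v * p v)).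
  assert (Hg : 0 < g / 5) by (unfold g; lra).
  destruct (vanishing_along_solution va _ Sa Na Hg) as [ta [Ta Va]].
  destruct (vanishing_along_solution vb _ Sb Nb Hg) as [tb [Tb Vb]].
  destruct (vanishing_along_solution vc _ Sc Nc Hg) as [tc [Tc Vc]].
  set (t := ta + tb + tc).
  specialize (Va t ltac:(unfold t; lra)); specialize (Vb t ltac:(unfold t; lra)).
  specialize (Vc t ltac:(unfold t; lra)); specialize (HPhi t ltac:(unfold t; lra)).
  assert (0 <= al * p (D t)) by (apply Rmult_le_pos, (cn_nonneg Hp); auto).
  assert (0 <= be * S t) by (apply Rmult_le_pos; auto; specialize (Ha t); specialize (Hc t);
    unfold S; nra).
  pose proof (norm_minus_le (n t) (n t [-] n 0)) as H2.
  replace (n t [-] (n t [-] n 0)) with (n 0) in H2 by vec.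
  pose proof (norm_add_le (N (va t) [-] 2 [*] N (vb t)) (N (vc t))) as H3.
  pose proof (norm_minus_le (N (va t)) (2 [*] N (vb t))) as H4.
  rewrite norm_scal_pos in H4 by lra; fold (n t) in H3.
  unfold Phi in HPhi; unfold g in *; lra. }
unfold n in Hfinal; rewrite Ia, Ib, Ic in Hfinal.
apply Rle_trans with (1 := Hfinal).
replace (2 * be * c2 ^ 2 * norm v ^ 2) with (2 * be * ((c2 * norm v) * (c2 * norm v))) by ring.
apply Rmult_le_compat_l; [lra|].
pose proof (cn_upper Hp v); pose proof (cn_nonneg Hp v); apply Rmult_le_compat; auto.
Qed.

End SecondDifferences.

(** * Products of complete spaces *)

Section Products.
Context {X Y : CompleteNormedModule R_AbsRing}.

(** Integrals of functions with values in [X * Y] need a limit operator there, taken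
    here componentwise. *)
Definition prod_lim (F : (X * Y -> Prop) -> Prop) : X * Y :=
  (lim (fun P => F (fun v => P (fst v))), lim (fun P => F (fun v => P (snd v)))).

Lemma prod_lim_cauchy (F : (X * Y -> Prop) -> Prop) :
  ProperFilter F -> cauchy (T := prod_UniformSpace X Y) F ->
  forall e : posreal, F (ball (M := prod_UniformSpace X Y) (prod_lim F) e).
Proof.
intros HF Hc e.
assert (HF1 : ProperFilter (fun P : X -> Prop => F (fun v => P (fst v))))
  by exact (filtermap_proper_filter _ _ fst F HF).
assert (HF2 : ProperFilter (fun P : Y -> Prop => F (fun v => P (snd v))))
  by exact (filtermap_proper_filter _ _ snd F HF).
apply filter_and.
- apply (complete_cauchy _ HF1); intros d; destruct (Hc d) as [v Hv].
  exists (fst v); apply filter_imp with (2 := Hv); now intros u [H _].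
- apply (complete_cauchy _ HF2); intros d; destruct (Hc d) as [v Hv].
  exists (snd v); apply filter_imp with (2 := Hv); now intros u [_ H].
Qed.

Lemma prod_lim_close (F1 F2 : (X * Y -> Prop) -> Prop) :
  filter_le F1 F2 -> filter_le F2 F1 ->
  close (M := prod_UniformSpace X Y) (prod_lim F1) (prod_lim F2).
Proof.
intros H12 H21 e; split.
- apply (close_lim (T := CompleteNormedModule.CompleteSpace _ X));
    intros P HP; [now apply H12|now apply H21].
- apply (close_lim (T := CompleteNormedModule.CompleteSpace _ Y));
    intros P HP; [now apply H12|now apply H21].
Qed.

Definition prod_complete : CompleteNormedModule R_AbsRing :=
  CompleteNormedModule.Pack R_AbsRing (X * Y)
    (CompleteNormedModule.Class R_AbsRing (X * Y)
      (NormedModule.class R_AbsRing (prod_NormedModule R_AbsRing X Y))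
      (CompleteSpace.Mixin (prod_UniformSpace X Y) prod_lim prod_lim_cauchy prod_lim_close))
    (X * Y).

End Products.
Arguments prod_complete : clear implicits.

Section PairNorms.
Context {X Y : NormedModule R_AbsRing}.

Lemma norm_fst_le (v : X * Y) : norm (fst v) <= norm v.
Proof.
change (norm v) with (sqrt (norm (fst v) ^ 2 + norm (snd v) ^ 2)).
rewrite <- (sqrt_pow2 (norm (fst v))) at 1 by apply norm_ge_0.
apply sqrt_le_1_alt; pose proof (pow2_ge_0 (norm (snd v))); lra.
Qed.

Lemma norm_snd_le (v : X * Y) : norm (snd v) <= norm v.
Proof.
change (norm v) with (sqrt (norm (fst v) ^ 2 + norm (snd v) ^ 2)).
rewrite <- (sqrt_pow2 (norm (snd v))) at 1 by apply norm_ge_0.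
apply sqrt_le_1_alt; pose proof (pow2_ge_0 (norm (fst v))); lra.
Qed.

Lemma norm_pair_le (v : X * Y) : norm v <= norm (fst v) + norm (snd v).
Proof.
change (norm v) with (sqrt (norm (fst v) ^ 2 + norm (snd v) ^ 2)).
pose proof (norm_ge_0 (fst v)); pose proof (norm_ge_0 (snd v)).
rewrite <- (sqrt_pow2 (norm (fst v) + norm (snd v))) by lra.
apply sqrt_le_1_alt; nra.
Qed.

Lemma small_o_fst (r : R -> X * Y) : small_o r -> small_o (fun s => fst (r s)).
Proof.
apply (small_o_le 1 1); [lra|]; intros s _; pose proof (norm_fst_le (r s)); lra.
Qed.

Lemma small_o_snd (r : R -> X * Y) : small_o r -> small_o (fun s => snd (r s)).
Proof.
apply (small_o_le 1 1); [lra|]; intros s _; pose proof (norm_snd_le (r s)); lra.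
Qed.

Lemma small_o_pair (r : R -> X * Y) :
  small_o (fun s => fst (r s)) -> small_o (fun s => snd (r s)) -> small_o r.
Proof.
intros H1 H2 e He.
destruct (H1 (e / 2)) as [d1 [Hd1 B1]]; [lra|].
destruct (H2 (e / 2)) as [d2 [Hd2 B2]]; [lra|].
exists (Rmin d1 d2); split; [now apply Rmin_glb_lt|]; intros s Hs.
pose proof (Rmin_l d1 d2); pose proof (Rmin_r d1 d2).
specialize (B1 s ltac:(lra)); specialize (B2 s ltac:(lra)).
pose proof (norm_pair_le (r s)); lra.
Qed.

End PairNorms.

Lemma small_o_scal_eq_zero {E : NormedModule R_AbsRing} (v : E) :
  small_o (fun s => s [*] v) -> v = vzero.
Proof.
intros H; apply eq_of_small_distance; intros e He.
destruct (H e He) as [d [Hd B]]; specialize (B (d / 2) ltac:(lra)).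
replace (v [-] vzero) with v by vec; rewrite norm_scal_pos in B by lra; nra.
Qed.

Lemma continuous_time_shift {E : NormedModule R_AbsRing} (v : R -> E) h t :
  (forall s, continuous v s) -> continuous (fun s => v (s + h)) t.
Proof.
intros Hv; apply (continuous_comp (fun s => s + h) v); auto.
apply (continuous_plus (V := R_NormedModule) (fun s => s) (fun _ => h)).
  apply continuous_id.
apply continuous_const.
Qed.

Lemma mild_derivative_time_shift {E : NormedModule R_AbsRing} (T : R -> bounded_op E E)
  (v : R -> E) h t l :
  mild_derivative T v (t + h) l -> mild_derivative T (fun s => v (s + h)) t l.
Proof.
intros Hv; apply small_o_ext with (2 := Hv); intros s _.
now replace (t + s + h) with (t + h + s) by ring.
Qed.

Lemma right_derivative_time_shift {E : NormedModule R_AbsRing} (v : R -> E) h t l :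
  right_derivative v (t + h) l -> right_derivative (fun s => v (s + h)) t l.
Proof.
intros Hv; apply small_o_ext with (2 := Hv); intros s _.
now replace (t + s + h) with (t + h + s) by ring.
Qed.

(** * Exponential stability makes the generator bijective *)

Lemma exponential_cauchy {E : CompleteNormedModule R_AbsRing} (v : R -> E) (C w : R) :
  0 < w -> 0 <= C ->
  (forall t h, 0 <= t -> 0 <= h -> norm (v (t + h) [-] v t) <= C * exp (- w * t)) ->
  exists l, forall e, 0 < e -> exists N, forall t, N <= t -> norm (v t [-] l) < e.
Proof.
intros Hw HC H.
assert (Hlim : exists l, forall e, 0 < e ->
  Rbar_locally p_infty (fun t => norm (v t [-] l) < e)).
  apply (cauchy_filter_limit (Rbar_locally p_infty) v).
  intros e He; destruct (exp_decay_small C w (e / 2)) as [N [HN0 HN]]; [auto|auto|lra|].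
  exists (fun t => N < t); split; [now exists N|].
  intros s t Hs Ht.
  pose proof (H N (s - N) HN0 ltac:(lra)) as H1.
  pose proof (H N (t - N) HN0 ltac:(lra)) as H2.
  replace (N + (s - N)) with s in H1 by ring; replace (N + (t - N)) with t in H2 by ring.
  pose proof (norm_le_plus (v s [-] v t) (v s [-] v N) (vopp (v t [-] v N)) ltac:(vec)) as H3.
  rewrite norm_vopp in H3; lra.
destruct Hlim as [l Hl]; exists l; intros e He; destruct (Hl e He) as [N HN].
exists (N + 1); intros t Ht; apply HN; lra.
Qed.

Section GeneratorBijective.
Context {X : Hilbert} (A : unbounded_op X) (T : R -> bounded_op X X).
Hypotheses (HT : C0_semigroup T) (HA : generates A T).
Context (p : X -> R) (c1 c2 w : R).
Hypothesis Hp : contracting_norm T p c1 c2 w.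

(** [A x = y] is solved by the limit of the mild solution of [x' = A x - y]. *)
Lemma generator_surjective y : exists x, uo_dom A x /\ A x = y.
Proof.
pose proof (cn_c1 Hp) as Hc1; pose proof (cn_c2 Hp) as Hc2.
pose proof (cn_w Hp) as Hw.
destruct (mild_existence T HT (fun _ => vopp y) (c2 / c1) 0 vzero) as [v [Hc Hv]].
- intros r Hr x; now apply (cn_semigroup_bound Hp).
- apply Rlt_le, Rdiv_lt_0_compat; lra.
- lra.
- intros a b; replace (vopp y [-] vopp y) with (vzero : X) by vec.
  rewrite norm_vzero; lra.
- assert (Hexp : forall t, 0 <= t -> mild_derivative T v t (vopp y)).
    intros t Ht; apply (duhamel_expansion T HT (fun _ => vopp y) vzero v t Hv Ht).
    apply continuous_const.
  assert (Hv0 : v 0 = vzero) by exact (duhamel_initial T HT _ _ _ Hv).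
  set (b := p y / w).
  assert (Hb : 0 <= b) by (apply Rdiv_le_0_compat; [apply (cn_nonneg Hp)|lra]).
  assert (Hbound : forall t, 0 <= t -> p (v t) <= b).
  { intros t Ht.
    pose proof (dini_decay (fun t => p (v t)) w b (b + 1)) as Hd.
    cbv beta in Hd; rewrite Hv0, (cn_zero Hp), Rmax_left in Hd by lra.
    rewrite <- (Rplus_0_r b), <- (Rmult_0_r (exp (- w * t))).
    apply Hd; try lra; clear Hd.
    - intros s; now apply (cn_continuous Hp).
    - intros s Hs _.
      apply dini_mono with (2 := dini_contracting Hp v s (vopp y) (Hexp s Hs)).
      rewrite (cn_opp Hp); unfold b; right; field; lra. }
  destruct (exponential_cauchy v (b / c1) w Hw) as [x Hx].
  + now apply Rdiv_le_0_compat.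
  + intros t h Ht Hh.
    apply Rle_trans with (1 := cn_norm_le Hp _).
    replace (b / c1 * exp (- w * t)) with (exp (- w * t) * b / c1) by (field; lra).
    apply Rmult_le_compat_r; [apply Rlt_le, Rinv_0_lt_compat; auto|].
    apply Rle_trans with (exp (- w * t) * p (v (0 + h) [-] v 0)).
    * apply (dini_decay_global (fun t => p (v (t + h) [-] v t))); auto;
        [|lra|apply (cn_nonneg Hp)|].
      -- intros s; apply (cn_continuous Hp (fun t => v (t + h) [-] v t)).
         apply (continuous_minus (fun t => v (t + h)) v); auto.
         now apply (continuous_time_shift (E := X)).
      -- intros s Hs.
         apply dini_mono with (- w * p (v (s + h) [-] v s) + p (vopp y [-] vopp y)).
           replace (vopp y [-] vopp y) with (vzero : X) by vec; rewrite (cn_zero Hp); lra.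
         apply (dini_contracting Hp (fun t => v (t + h) [-] v t)), mild_derivative_sub; auto.
         apply (mild_derivative_time_shift T v h), Hexp; lra.
    * apply Rmult_le_compat_l; [apply Rlt_le, exp_pos|].
      rewrite Hv0; replace (v (0 + h) [-] vzero) with (v (0 + h)) by vec.
      apply Hbound; lra.
  + destruct (duhamel_limit T HT A (fun _ => vopp y) vzero v x (vopp y) HA Hv Hx)
      as [Hd HAx].
      intros e He; exists 0; intros t _.
      replace (vopp y [-] vopp y) with (vzero : X) by vec; now rewrite norm_vzero.
    exists x; split; auto; rewrite HAx; vec.
Qed.

Lemma generator_injective x x' :
  Lyap A -> uo_dom A x -> uo_dom A x' -> A x = A x' -> x = x'.
Proof.
intros [P [c [mu [Hc [Hmu [_ [_ HP]]]]]]] Hx Hx' Heq.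
assert (Hd : uo_dom A (x [-] x') /\ A (x [-] x') = vzero).
  apply (generates_iff A T HA).
  apply small_o_ext with (2 := small_o_minus _ _
    (generator_expansion A T HA x Hx) (generator_expansion A T HA x' Hx')).
  intros s _; rewrite Heq; bo_linear; vec.
destruct Hd as [Hd H0]; specialize (HP _ Hd); rewrite H0 in HP.
replace (vzero : X) with (0 [*] (vzero : X)) in HP by vec.
rewrite inner_scal_l in HP; pose proof (norm_ge_0 (x [-] x')).
assert (norm (x [-] x') ^ 2 <= 0) by (apply Rmult_le_reg_l with mu; lra).
apply norm_minus_lt0; nra.
Qed.

Lemma uo_inv_spec y : Lyap A -> uo_dom A (uo_inv A y) /\ A (uo_inv A y) = y.
Proof.
intros Hl; unfold uo_inv.
apply (iota_correct (fun x => uo_dom A x /\ A x = y)).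
destruct (generator_surjective y) as [x [Hx HAx]].
exists x; split; [auto|]; intros x' [Hx' HAx'].
apply generator_injective; auto; congruence.
Qed.

End GeneratorBijective.

(** * The semigroup of a cascade *)

Definition bo_comp {E F G : NormedModule R_AbsRing} (S : bounded_op F G)
  (T : bounded_op E F) : bounded_op E G :=
  mk_bounded_op _ (is_linear_comp T S (bo_linear T) (bo_linear S)).

Section Cascade.
Context {X Y : Hilbert} (A : unbounded_op X) (C : X -> Y).
Context (T : R -> bounded_op X X) (L : bounded_op X Y).
Hypotheses (HT : C0_semigroup T) (HA : generates A T).
Hypothesis HL : forall x, uo_dom A x -> L (A x) = C x.

(** As [C x = L (A x)], the integral of [C] along an orbit is the increment of [L]. *)
Lemma cascade_is_linear t :
  is_linear (fun v : prod_NormedModule R_AbsRing X Y =>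
    (T t (fst v), snd v [+] L (T t (fst v) [-] fst v))
    : prod_NormedModule R_AbsRing X Y).
Proof.
split.
- intros [x z] [x' z']; simpl.
  change ((T t (x [+] x'), z [+] z' [+] L (T t (x [+] x') [-] (x [+] x')))
    = (T t x [+] T t x', (z [+] L (T t x [-] x)) [+] (z' [+] L (T t x' [-] x')))).
  f_equal; bo_linear; vec.
- intros a [x z]; simpl.
  change ((T t ((a : R) [*] x), (a : R) [*] z [+] L (T t ((a : R) [*] x) [-] (a : R) [*] x))
    = ((a : R) [*] T t x, (a : R) [*] (z [+] L (T t x [-] x)))).
  f_equal; bo_linear; vec.
- exists (op_norm (T t) + 1 + op_norm L * (op_norm (T t) + 1) + 1).
  pose proof (op_norm_ge0 (T t)); pose proof (op_norm_ge0 L).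
  split; [nra|]; intros v.
  eapply Rle_trans; [apply norm_pair_le|].
  match goal with |- _ <= ?b =>
    change (norm (T t (fst v)) + norm (snd v [+] L (T t (fst v) [-] fst v)) <= b) end.
  pose proof (norm_fst_le v) as Hf; pose proof (norm_snd_le v).
  pose proof (op_norm_bound (T t) (fst v)).
  pose proof (norm_minus_le (T t (fst v)) (fst v)).
  pose proof (op_norm_bound L (T t (fst v) [-] fst v)).
  pose proof (norm_add_le (snd v) (L (T t (fst v) [-] fst v))).
  assert (op_norm (T t) * norm (fst v) <= op_norm (T t) * norm v)
    by (apply Rmult_le_compat_l; lra).
  assert (op_norm L * norm (T t (fst v) [-] fst v) <= op_norm L * ((op_norm (T t) + 1) * norm v))
    by (apply Rmult_le_compat_l; lra).
  pose proof (norm_ge_0 v); lra.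
Qed.

Definition cascade_semigroup (t : R) :
  bounded_op (prod_NormedModule R_AbsRing X Y) (prod_NormedModule R_AbsRing X Y) :=
  mk_bounded_op _ (cascade_is_linear t).

Lemma cascade_semigroup_bound K :
  (forall t x, 0 <= t -> norm (T t x) <= K * norm x) -> 0 <= K ->
  exists K', 0 <= K' /\ forall t, 0 <= t -> forall v, norm (cascade_semigroup t v) <= K' * norm v.
Proof.
intros HK HK0; exists (K + 1 + op_norm L * (K + 1)).
pose proof (op_norm_ge0 L); split; [nra|]; intros t Ht v.
eapply Rle_trans; [apply norm_pair_le|].
  match goal with |- _ <= ?b =>
    change (norm (T t (fst v)) + norm (snd v [+] L (T t (fst v) [-] fst v)) <= b) end.
pose proof (norm_fst_le v) as Hf; pose proof (norm_snd_le v).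
pose proof (HK t (fst v) Ht).
pose proof (norm_minus_le (T t (fst v)) (fst v)).
pose proof (op_norm_bound L (T t (fst v) [-] fst v)).
pose proof (norm_add_le (snd v) (L (T t (fst v) [-] fst v))).
assert (K * norm (fst v) <= K * norm v) by (apply Rmult_le_compat_l; lra).
assert (op_norm L * norm (T t (fst v) [-] fst v) <= op_norm L * ((K + 1) * norm v))
  by (apply Rmult_le_compat_l; lra).
lra.
Qed.

Lemma cascade_semigroup_C0 : C0_semigroup cascade_semigroup.
Proof.
destruct HT as [H0 [Hadd _]]; split; [|split].
- intros [x z]; simpl; rewrite H0; f_equal.
  replace (x [-] x) with (vzero : X) by vec; bo_linear; vec.
- intros s t Hs Ht [x z]; simpl; rewrite Hadd by auto.
  f_equal; bo_linear; vec.
- intros v.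
  apply (proj2 (filterlim_locally_ball_norm (K := R_AbsRing) (F := at_right 0)
    (U := prod_NormedModule R_AbsRing X Y) (fun t => cascade_semigroup t v) v)).
  intros [e He].
  pose proof (op_norm_ge0 L) as HL0.
  destruct (semigroup_right_limit T (fst v) HT (e / (op_norm L + 1)))
    as [d [Hd H]]; [apply Rdiv_lt_0_compat; lra|].
  exists (mkposreal d Hd); intros t Ht Ht0.
  change (Rabs (t - 0) < d) in Ht; rewrite Rminus_0_r, Rabs_pos_eq in Ht by lra.
  specialize (H t ltac:(lra)).
  change (norm (cascade_semigroup t v [-] v) < e).
  apply Rle_lt_trans with (1 := norm_pair_le _).
  change (norm (T t (fst v) [-] fst v)
    + norm ((snd v [+] L (T t (fst v) [-] fst v)) [-] snd v) < e).
  replace ((snd v [+] L (T t (fst v) [-] fst v)) [-] snd v)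
    with (L (T t (fst v) [-] fst v)) by vec.
  pose proof (op_norm_bound L (T t (fst v) [-] fst v)).
  apply Rle_lt_trans with ((op_norm L + 1) * norm (T t (fst v) [-] fst v)); [lra|].
  apply mul_div_lt; lra.
Qed.

Lemma cascade_generates : generates (cascade_op A C) cascade_semigroup.
Proof.
intros [x z] [y y'].
eapply iff_trans; [|symmetry; exact (small_o_right_limit
  (E := prod_NormedModule R_AbsRing X Y)
  (fun t => cascade_semigroup t (x, z) [-] (x, z)) (y, y'))].
split.
- intros [Hd Heq]; simpl in Hd, Heq; injection Heq as H1 H2.
  assert (Ho := generator_expansion A T HA x Hd).
  apply small_o_pair.
  + apply small_o_ext with (2 := Ho); intros s _; now rewrite H1.
  + apply small_o_ext with (2 := small_o_map L _ Ho); intros s _.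
    change (L (T s x [-] x [-] s [*] A x)
      = (z [+] L (T s x [-] x)) [-] z [-] s [*] y').
    rewrite <- H2, <- HL by auto; bo_linear; vec.
- intros Ho; assert (H1 := small_o_fst _ Ho); assert (H2 := small_o_snd _ Ho).
  change (small_o (fun s => T s x [-] x [-] s [*] y)) in H1.
  change (small_o (fun s => (z [+] L (T s x [-] x)) [-] z [-] s [*] y')) in H2.
  apply (generates_iff A T HA) in H1; destruct H1 as [Hd Hy].
  split; [exact Hd|]; simpl; f_equal; auto.
  assert (Hz : C x [-] y' = vzero).
    apply small_o_scal_eq_zero.
    apply small_o_ext with (2 := small_o_minus _ _ H2
      (small_o_map L _ (generator_expansion A T HA x Hd))).
    intros s _; rewrite <- HL by auto; bo_linear; vec.
  apply norm_minus_lt0; rewrite Hz, norm_vzero; lra.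
Qed.

End Cascade.

(** * The first-order equation near the origin *)

Lemma C1_minus_linear {E F : NormedModule R_AbsRing} (M : E -> F)
  (dM : E -> bounded_op E F) (L : bounded_op E F) :
  C1_with M dM -> C1_with (fun x => M x [-] L x) (fun x => dM x [-] L).
Proof.
intros HM; split.
- intros x; apply (filterdiff_minus_fct M L); [apply (proj1 HM)|].
  apply filterdiff_linear, (bo_linear L).
- intros x; apply (continuous_minus (V := bo_NormedModule E F) dM (fun _ => L)).
    apply (proj2 HM).
  apply continuous_const.
Qed.

Section FirstOrderEquation.
Context {X Y : Hilbert} (A : unbounded_op X) (T : R -> bounded_op X X).
Hypotheses (HT : C0_semigroup T) (HA : generates A T).
Context (f : X -> X) (h : X -> Y) (C : X -> Y) (M : X -> Y) (dM : X -> bounded_op X Y).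
Context (df : X -> bounded_op X X) (dh : X -> bounded_op X Y).
Hypotheses (f_diff : has_differential f df) (df_lip : locally_lipschitz df).
Hypotheses (df_zero : df zero = zero) (f_zero : f zero = zero).
Hypotheses (h_diff : has_differential h dh) (dh_lip : locally_lipschitz dh).
Hypotheses (dh_zero : dh zero = zero) (h_zero : h zero = zero).
Hypothesis C_scal : forall (a : R) x, uo_dom A x -> C (scal a x) = scal a (C x).
Hypotheses (M_C1 : C1_with M dM) (M_zero : M zero = zero).
Hypothesis M_eq : forall x, uo_dom A x -> dM x (plus (A x) (f x)) = plus (C x) (h x).

Lemma vanishing_differential_small_o {F : NormedModule R_AbsRing} (q : X -> F)
  (dq : X -> bounded_op X F) x :
  has_differential q dq -> dq zero = zero -> q zero = zero ->
  small_o (fun s => q (s [*] x)).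
Proof.
intros Hq Hdq Hq0.
apply small_o_ext with (fun s => q (s [*] x) [-] q vzero [-] s [*] dq vzero x).
- intros s _; change (dq vzero) with (dq zero); rewrite Hdq.
  change (q vzero) with (q zero); rewrite Hq0.
  change (q (s [*] x) [-] vzero [-] s [*] vzero = q (s [*] x)); vec.
- apply (differential_along_curve q dq Hq).
  apply small_o_ext with (2 := small_o_zero); intros s _; vec.
Qed.

(** The equation at [s x], divided by [s], as [s] tends to [0]. *)
Lemma differential_at_origin x : uo_dom A x -> dM vzero (A x) = C x.
Proof.
intros Hx.
assert (Hf := vanishing_differential_small_o f df x f_diff df_zero f_zero).
assert (Hh := vanishing_differential_small_o h dh x h_diff dh_zero h_zero).
destruct (proj1 (continuous_ball_iff (E := X) (F := bo_NormedModule X Y) dM vzero)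
  (proj2 M_C1 vzero) 1 Rlt_0_1) as [d [Hd Hb]].
assert (Hn := norm_ge_0 x).
assert (Hnear : forall e, 0 < e -> exists d', 0 < d' /\
  forall s, 0 < s < d' -> op_norm (dM (s [*] x) [-] dM vzero) < e).
  intros e He.
  destruct (proj1 (continuous_ball_iff (E := X) (F := bo_NormedModule X Y) dM vzero)
    (proj2 M_C1 vzero) e He) as [d' [Hd' Hb']].
  exists (d' / (norm x + 1)); split; [apply Rdiv_lt_0_compat; lra|]; intros s Hs.
  apply Hb'; replace (s [*] x [-] vzero) with (s [*] x) by vec.
  rewrite norm_scal_pos by lra.
  apply Rle_lt_trans with (s * (norm x + 1)); [nra|].
  apply Rlt_le_trans with (d' / (norm x + 1) * (norm x + 1)); [|right; field; lra].
  apply Rmult_lt_compat_r; lra.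
assert (Hdiff : small_o (fun s => s [*] (dM (s [*] x) (A x) [-] dM vzero (A x)))).
  apply small_o_vanishing; intros e He.
  assert (HnA := norm_ge_0 (A x)).
  destruct (Hnear (e / (norm (A x) + 1))) as [d' [Hd' H]].
    apply Rdiv_lt_0_compat; lra.
  exists d'; split; auto; intros s Hs; specialize (H s Hs).
  pose proof (op_norm_bound (dM (s [*] x) [-] dM vzero) (A x)) as H1.
  change (norm (dM (s [*] x) (A x) [-] dM vzero (A x))
    <= op_norm (dM (s [*] x) [-] dM vzero) * norm (A x)) in H1.
  apply Rle_trans with (1 := H1).
  apply Rle_trans with (e / (norm (A x) + 1) * (norm (A x) + 1)); [|right; field; lra].
  apply Rmult_le_compat; try lra; apply op_norm_ge0.
assert (HdMf : small_o (fun s => dM (s [*] x) (f (s [*] x)))).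
  destruct (Hnear 1 Rlt_0_1) as [d' [Hd' H]].
  apply (small_o_le (op_norm (dM vzero) + 1) d' (fun s => f (s [*] x))); auto.
  intros s Hs; specialize (H s Hs).
  apply Rle_trans with (1 := op_norm_bound _ _).
  apply Rmult_le_compat_r; [apply norm_ge_0|].
  pose proof (norm_le_plus (E := bo_NormedModule X Y) (dM (s [*] x))
    (dM (s [*] x) [-] dM vzero) (dM vzero) ltac:(vec)) as H1.
  change (op_norm (dM (s [*] x)) <= op_norm (dM (s [*] x) [-] dM vzero) + op_norm (dM vzero))
    in H1.
  lra.
assert (Hz : dM vzero (A x) [-] C x = vzero).
  apply small_o_scal_eq_zero.
  apply small_o_ext with (2 := small_o_minus _ _ (small_o_minus _ _ Hh HdMf) Hdiff).
  intros s Hs.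
  destruct (generator_scale A T HA s x Hx) as [Hsx HAs].
  pose proof (M_eq (s [*] x) Hsx) as E1; rewrite HAs in E1.
  change (dM (s [*] x) (s [*] A x [+] f (s [*] x)) 
    = C (scal (s : R_AbsRing) x) [+] h (s [*] x)) in E1.
  rewrite C_scal in E1 by auto; change (scal (s : R_AbsRing) (C x)) with (s [*] C x) in E1.
  rewrite bo_add, bo_scale in E1.
  transitivity ((s [*] C x [+] h (s [*] x)) [-] s [*] C x [-] dM (s [*] x) (f (s [*] x))
    [-] s [*] (dM (s [*] x) (A x) [-] dM vzero (A x))); [vec|].
  rewrite <- E1; vec.
apply norm_minus_lt0; rewrite Hz, norm_vzero; lra.
Qed.

Lemma lipschitz_on_unit_ball {F : NormedModule R_AbsRing} (q : X -> F) :
  locally_lipschitz q -> exists k, 0 <= k /\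
  forall x y, norm x <= 1 -> norm y <= 1 -> norm (q x [-] q y) <= k * norm (x [-] y).
Proof.
intros Hq; destruct (Hq (fun x => norm x <= 1)) as [k Hk]; [now exists 1|].
exists (Rabs k); split; [apply Rabs_pos|]; intros x y Hx Hy.
apply Rle_trans with (1 := Hk x y Hx Hy).
apply Rmult_le_compat_r; [apply norm_ge_0|apply Rle_abs].
Qed.

Context (p : X -> R) (c1 c2 w : R).
Hypothesis Hp : contracting_norm T p c1 c2 w.

(** In a small ball [f] has so small a Lipschitz constant that the flow of [A + f] contracts
    like that of [A]. The map [M x - dM 0 x] solves the equation with [C] removed and
    the smooth right-hand side [h x - dM 0 (f x)], and its second differences are
    bounded along this flow. *)
Lemma differential_lipschitz_near_origin : exists rho K, 0 < rho /\ 0 <= K /\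
  forall x y, norm x <= rho -> norm y <= rho ->
    op_norm (dM x [-] dM y) <= K * norm (x [-] y).
Proof.
pose proof (cn_c1 Hp) as Hc1; pose proof (cn_c2 Hp) as Hc2.
pose proof (cn_w Hp) as Hw.
destruct (lipschitz_on_unit_ball df df_lip) as [kf [Hkf Lf]].
destruct (lipschitz_on_unit_ball dh dh_lip) as [kh [Hkh Lh]].
assert (n0 : norm (vzero : X) <= 1) by (rewrite norm_vzero; lra).
assert (Sf : forall x, norm x <= 1 -> op_norm (df x) <= kf * norm x).
  intros x Hx; pose proof (Lf x vzero Hx n0) as H.
  rewrite (df_zero : df vzero = vzero) in H.
  replace (x [-] vzero) with x in H by vec.
  replace (df x [-] vzero) with (df x) in H by vec; exact H.
assert (Sh : forall x, norm x <= 1 -> op_norm (dh x) <= kh * norm x).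
  intros x Hx; pose proof (Lh x vzero Hx n0) as H.
  rewrite (dh_zero : dh vzero = vzero) in H.
  replace (x [-] vzero) with x in H by vec.
  replace (dh x [-] vzero) with (dh x) in H by vec; exact H.
set (rho := Rmin 1 (w * c1 / (4 * c2 * (kf + 1)))).
assert (Hrho : 0 < rho).
  apply Rmin_glb_lt; [lra|]; apply Rdiv_lt_0_compat; nra.
assert (Hrho1 : rho <= 1) by apply Rmin_l.
assert (Heps : 2 * c2 * (kf * rho) <= w / 2 * c1).
  assert (H : rho <= w * c1 / (4 * c2 * (kf + 1))) by apply Rmin_r.
  apply Rle_trans with (2 * c2 * ((kf + 1) * (w * c1 / (4 * c2 * (kf + 1))))).
    apply Rmult_le_compat_l; [lra|]; apply Rmult_le_compat; lra.
  right; field; lra.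
set (L := dM vzero).
set (N := fun x => M x [-] L x).
set (dN := fun x => dM x [-] L : bounded_op X Y).
set (kq := kh + op_norm L * kf).
pose proof (op_norm_ge0 L) as HL0.
assert (HN : C1_with N dN) by now apply (C1_minus_linear M dM L).
destruct (second_difference_bound (F := Y) A T HT HA p c1 c2 w Hp f (kf * rho) kf rho)
  with (N := N) (dN := dN) (q := fun x => h x [-] L (f x)) (kq := kq) as [K [HK HS]]; auto.
- nra.
- apply (differentiable_continuous f df f_diff).
- intros a b Ha Hb; apply (lipschitz_in_ball f df f_diff rho); auto.
  intros y Hy; apply Rle_trans with (1 := Sf y ltac:(lra)); nra.
- intros a b c Ha Hb Hc.
  pose proof (second_difference_in_ball f df f_diff rho kf Hkf
    (fun u v Hu Hv => Lf u v ltac:(lra) ltac:(lra)) a b c Ha Hb Hc) as H.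
  pose proof (Sf b ltac:(lra)) as H1; pose proof (norm_ge_0 (a [-] 2 [*] b [+] c)).
  assert (op_norm (df b) <= kf * rho) by nra.
  nra.
- change (M vzero) with (M zero) in *; unfold N.
  change (M vzero) with (M zero); rewrite M_zero, bo_0.
  change (vzero [-] vzero = (vzero : Y)); vec.
- intros x Hx; pose proof (M_eq x Hx) as E1.
  change (dM x (A x [+] f x) = C x [+] h x) in E1.
  change (dM x (A x [+] f x) [-] L (A x [+] f x) = h x [-] L (f x)).
  rewrite E1, bo_add; unfold L; rewrite differential_at_origin by auto; vec.
- intros x; apply (continuous_minus h (fun x => L (f x))).
    apply (differentiable_continuous h dh h_diff).
  apply (continuous_comp f L); [apply (differentiable_continuous f df f_diff)|].
  exact (bo_continuous L (f x)).
- unfold kq; nra.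
- intros a b c Ha Hb Hc.
  pose proof (second_difference_in_ball f df f_diff rho kf Hkf
    (fun u v Hu Hv => Lf u v ltac:(lra) ltac:(lra)) a b c Ha Hb Hc) as H1.
  pose proof (second_difference_in_ball h dh h_diff rho kh Hkh
    (fun u v Hu Hv => Lh u v ltac:(lra) ltac:(lra)) a b c Ha Hb Hc) as H2.
  pose proof (Sf b ltac:(lra)) as H3; pose proof (Sh b ltac:(lra)) as H4.
  set (D := norm (a [-] 2 [*] b [+] c)) in *.
  assert (HD : 0 <= D) by apply norm_ge_0.
  set (sq := norm (a [-] b) ^ 2 + norm (c [-] b) ^ 2) in *.
  pose proof (norm_ge_0 b).
  assert (B1 : op_norm (df b) <= kf) by nra.
  assert (B2 : op_norm (dh b) <= kh) by nra.
  set (F2 := f a [-] 2 [*] f b [+] f c) in *.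
  pose proof (norm_le_plus
    ((h a [-] L (f a)) [-] 2 [*] (h b [-] L (f b)) [+] (h c [-] L (f c)))
    (h a [-] 2 [*] h b [+] h c) (vopp (L F2)) ltac:(unfold F2; bo_linear; vec)) as H5.
  rewrite norm_vopp in H5; pose proof (op_norm_bound L F2).
  assert (norm F2 <= kf * D + kf * sq) by nra.
  assert (norm (h a [-] 2 [*] h b [+] h c) <= kh * D + kh * sq) by nra.
  assert (op_norm L * norm F2 <= op_norm L * (kf * D + kf * sq))
    by (apply Rmult_le_compat_l; lra).
  unfold kq; lra.
- set (rho' := rho * c1 / c2).
  assert (Hrho' : 0 < rho') by (apply Rdiv_lt_0_compat; nra).
  exists (rho' / 8), (6 * K); split; [lra|split; [lra|]]; intros x y Hx Hy.
  pose proof (differential_lipschitz_of_second_difference N dN (proj1 HN) rho' K HK HS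
    y x Hy Hx) as H.
  replace (dM x [-] dM y) with (dN x [-] dN y) by (unfold dN; vec); exact H.
Qed.

End FirstOrderEquation.

(** * Contraction of the closed loop near the origin *)

(** A coercive linear term makes the norm decay at first order, the quadratic
    term in [s] being negligible. *)
Lemma dini_coercive {Y : Hilbert} (Q0 : Y -> Y) (d : R -> Y) t (e : Y) c K :
  0 < c -> 0 <= K -> (forall eta, norm (Q0 eta) <= K * norm eta) ->
  (forall eta, c * norm eta ^ 2 <= inner (Q0 eta) eta) ->
  right_derivative d t (e [-] Q0 (d t)) ->
  dini_le (fun u => norm (d u)) t (- c * norm (d t) + norm e).
Proof.
intros Hc HK HQ Hco Ho eps Heps.
set (m := norm (d t)); assert (Hm : 0 <= m) by apply norm_ge_0.
destruct (Ho (eps / 2)) as [d1 [Hd1 H1]]; [lra|].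
set (k := K * K * m + 1); assert (Hk : 1 <= k) by (unfold k; nra).
exists (Rmin d1 (Rmin (/ (2 * c)) (eps / 2 / k))).
split; [repeat apply Rmin_glb_lt; [lra|apply Rinv_0_lt_compat; lra|apply Rdiv_lt_0_compat; lra]|].
intros s Hs.
pose proof (Rmin_l d1 (Rmin (/ (2 * c)) (eps / 2 / k))) as M1.
pose proof (Rmin_r d1 (Rmin (/ (2 * c)) (eps / 2 / k))) as M2.
pose proof (Rmin_l (/ (2 * c)) (eps / 2 / k)) as M3.
pose proof (Rmin_r (/ (2 * c)) (eps / 2 / k)) as M4.
specialize (H1 s ltac:(lra)).
assert (Hcs : c * s <= / 2).
  apply Rle_trans with (c * / (2 * c)); [apply Rmult_le_compat_l; lra|].
  right; field; lra.
assert (Hks : k * s <= eps / 2) by (apply mul_div_le; lra).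
set (a := d t) in *.
assert (Hlin : norm (a [-] s [*] Q0 a) <= (1 - c * s + s * s * (K * K)) * m).
{ assert (Hsq : norm (a [-] s [*] Q0 a) ^ 2 <= (1 - 2 * (c * s) + s * s * (K * K)) * m ^ 2).
    rewrite <- inner_self.
    rewrite inner_sub_l, !inner_sub_r, inner_scal_l, !inner_scal_r, inner_scal_l.
    rewrite (inner_sym Y a (Q0 a)), !inner_self.
    specialize (Hco a); specialize (HQ a); fold m in Hco, HQ |- *.
    pose proof (norm_ge_0 (Q0 a)).
    assert (norm (Q0 a) ^ 2 <= (K * m) ^ 2) by (apply pow_incr; lra).
    assert (s * (c * m ^ 2) <= s * inner (Q0 a) a) by (apply Rmult_le_compat_l; lra).
    assert (s * s * norm (Q0 a) ^ 2 <= s * s * (K * m) ^ 2) by (apply Rmult_le_compat_l; nra).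
    replace (s * s * (K * m) ^ 2) with (s * s * (K * K) * m ^ 2) in H3 by ring.
    lra.
  assert (Hss : 0 <= s * s * (K * K)) by (repeat apply Rmult_le_pos; lra).
  set (b := s * s * (K * K)) in *.
  assert (Hb : 0 <= (1 - c * s + b) * m) by (apply Rmult_le_pos; lra).
  apply Rsqr_incr_0_var; auto; unfold Rsqr.
  replace (norm (a [-] s [*] Q0 a) * norm (a [-] s [*] Q0 a))
    with (norm (a [-] s [*] Q0 a) ^ 2) by ring.
  apply Rle_trans with (1 := Hsq).
  replace ((1 - c * s + b) * m * ((1 - c * s + b) * m))
    with ((1 - c * s + b) * (1 - c * s + b) * m ^ 2) by ring.
  apply Rmult_le_compat_r; [apply pow2_ge_0|].
  pose proof (pow2_ge_0 (c * s)); nra. }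
pose proof (norm_le_plus (d (t + s)) ((a [-] s [*] Q0 a) [+] s [*] e)
  (d (t + s) [-] a [-] s [*] (e [-] Q0 a)) ltac:(vec)) as H2.
pose proof (norm_add_le (a [-] s [*] Q0 a) (s [*] e)) as H3.
rewrite norm_scal_pos in H3 by lra.
assert (H4 : s * s * (K * K) * m <= eps / 2 * s).
  apply Rle_trans with (k * s * s); [|apply Rmult_le_compat_r; lra].
  unfold k; assert (0 <= s * s) by nra; nra.
lra.
Qed.

Section ClosedLoop.
Context {X U Y : Hilbert} (A : unbounded_op X) (T : R -> bounded_op X X).
Hypotheses (HT : C0_semigroup T) (HA : generates A T).
Context (f : X -> X) (g : X -> bounded_op U X) (h : X -> Y) (C : X -> Y).
Context (M : X -> Y) (dM : X -> bounded_op X Y).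
Hypotheses (f_zero : f vzero = vzero) (M_zero : M vzero = vzero).
Hypotheses (f_cont : forall x, continuous f x) (h_cont : forall x, continuous h x).
Hypothesis M_C1 : C1_with M dM.
Hypothesis M_eq : forall x, uo_dom A x -> dM x (A x [+] f x) = C x [+] h x.
Hypothesis HL : forall x, uo_dom A x -> dM vzero (A x) = C x.
Context (p : X -> R) (c1 c2 w : R).
Hypothesis Hp : contracting_norm T p c1 c2 w.
(* Bounds for all the data in the ball of radius [rho1]. *)
Context (k rho1 cB : R).
Hypotheses (k_ge1 : 1 <= k) (rho1_pos : 0 < rho1) (rho1_le1 : rho1 <= 1).
Hypothesis g_bound : forall x, norm x <= rho1 -> op_norm (g x) <= k.
Hypothesis dM_bound : forall x, norm x <= rho1 -> op_norm (dM x) <= k.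
Hypothesis g_lip : forall x y, norm x <= rho1 -> norm y <= rho1 ->
  op_norm (g x [-] g y) <= k * norm (x [-] y).
Hypothesis dM_lip : forall x y, norm x <= rho1 -> norm y <= rho1 ->
  op_norm (dM x [-] dM y) <= k * norm (x [-] y).
Hypothesis h_lip : forall x y, norm x <= rho1 -> norm y <= rho1 ->
  norm (h x [-] h y) <= k * norm (x [-] y).
Hypothesis f_small : forall r x y, r <= rho1 -> norm x <= r -> norm y <= r ->
  norm (f x [-] f y) <= k * r * norm (x [-] y).
Hypothesis cB_pos : 0 < cB.
Hypothesis B_coercive : forall eta : Y,
  cB * norm eta <= norm (adjoint (g vzero) (adjoint (dM vzero) eta)).

Definition actuation (x : X) (eta : Y) : X :=
  g x (adjoint (g x) (adjoint (dM x) eta)).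

Definition damping (x : X) (eta : Y) : Y := dM x (actuation x eta).

Lemma actuation_sub x eta eta' :
  actuation x (eta [-] eta') = actuation x eta [-] actuation x eta'.
Proof. unfold actuation; now rewrite !adjoint_sub, bo_sub. Qed.

Lemma damping_sub x eta eta' :
  damping x (eta [-] eta') = damping x eta [-] damping x eta'.
Proof. unfold damping; now rewrite actuation_sub, bo_sub. Qed.

Lemma adjoint_bound_le {E F : Hilbert} (S : bounded_op E F) y b m :
  op_norm S <= b -> norm y <= m -> norm (adjoint S y) <= b * m.
Proof.
intros Hb Hm; apply Rle_trans with (1 := adjoint_bound S y).
apply Rmult_le_compat; auto; [apply op_norm_ge0|apply norm_ge_0].
Qed.

Lemma bo_bound_le {E F : NormedModule R_AbsRing} (S : bounded_op E F) y b m :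
  op_norm S <= b -> norm y <= m -> norm (S y) <= b * m.
Proof.
intros Hb Hm; apply Rle_trans with (1 := op_norm_bound S y).
apply Rmult_le_compat; auto; [apply op_norm_ge0|apply norm_ge_0].
Qed.

Lemma actuation_bound x eta :
  norm x <= rho1 -> norm (actuation x eta) <= k ^ 3 * norm eta.
Proof.
intros Hx; replace (k ^ 3 * norm eta) with (k * (k * (k * norm eta))) by ring.
apply bo_bound_le; auto; apply adjoint_bound_le; auto.
apply adjoint_bound_le; auto; lra.
Qed.

Lemma actuation_lipschitz x y eta : norm x <= rho1 -> norm y <= rho1 ->
  norm (actuation x eta [-] actuation y eta) <= 3 * k ^ 3 * norm (x [-] y) * norm eta.
Proof.
intros Hx Hy; unfold actuation.
set (a := adjoint (dM x) eta); set (b := adjoint (dM y) eta).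
set (u := adjoint (g x) a); set (v := adjoint (g y) b).
set (d := norm (x [-] y)); assert (Hd : 0 <= d) by apply norm_ge_0.
set (n := norm eta); assert (Hn : 0 <= n) by apply norm_ge_0.
assert (Ha : norm a <= k * n) by (apply adjoint_bound_le; auto; unfold n; lra).
assert (Hab : norm (a [-] b) <= k * d * n).
  unfold a, b; rewrite <- adjoint_op_sub.
  apply adjoint_bound_le; [now apply dM_lip|unfold n; lra].
assert (Hu : norm u <= k * (k * n)) by (apply adjoint_bound_le; auto).
assert (Huv : norm (u [-] v) <= 2 * k ^ 2 * d * n).
  pose proof (norm_le_plus (u [-] v) (adjoint (g x [-] g y) a) (adjoint (g y) (a [-] b))
    ltac:(rewrite adjoint_op_sub, adjoint_sub; unfold u, v; vec)) as H.
  pose proof (adjoint_bound_le (g x [-] g y) a (k * d) (k * n) (g_lip x y Hx Hy) Ha) as H1.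
  pose proof (adjoint_bound_le (g y) (a [-] b) k (k * d * n) (g_bound y Hy) Hab) as H2.
  simpl; lra.
pose proof (norm_le_plus (g x u [-] g y v) (bo_fun (g x [-] g y) u) (g y (u [-] v))
  ltac:(change (bo_fun (g x [-] g y) u) with (g x u [-] g y u); bo_linear; vec)) as H.
pose proof (bo_bound_le (g x [-] g y) u (k * d) (k * (k * n)) (g_lip x y Hx Hy) Hu) as H1.
pose proof (bo_bound_le (g y) (u [-] v) k _ (g_bound y Hy) Huv) as H2.
simpl in *; lra.
Qed.

Lemma damping_bound x eta :
  norm x <= rho1 -> norm (damping x eta) <= k ^ 4 * norm eta.
Proof.
intros Hx; replace (k ^ 4 * norm eta) with (k * (k ^ 3 * norm eta)) by ring.
apply bo_bound_le; auto; now apply actuation_bound.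
Qed.

Lemma damping_lipschitz x y eta : norm x <= rho1 -> norm y <= rho1 ->
  norm (damping x eta [-] damping y eta) <= 4 * k ^ 4 * norm (x [-] y) * norm eta.
Proof.
intros Hx Hy; unfold damping.
set (a := actuation x eta); set (b := actuation y eta).
pose proof (norm_le_plus (dM x a [-] dM y b) (bo_fun (dM x [-] dM y) a) (dM y (a [-] b))
  ltac:(change (bo_fun (dM x [-] dM y) a) with (dM x a [-] dM y a); bo_linear; vec)) as H.
pose proof (bo_bound_le (dM x [-] dM y) a _ _ (dM_lip x y Hx Hy) (actuation_bound x eta Hx)) as H1.
pose proof (bo_bound_le (dM y) (a [-] b) _ _ (dM_bound y Hy)
  (actuation_lipschitz x y eta Hx Hy)) as H2.
simpl in *; lra.
Qed.

(** The adjoint of [dM 0 (g 0)] turns the damping into a square. *)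
Lemma damping_coercive eta : cB ^ 2 * norm eta ^ 2 <= inner (damping vzero eta) eta.
Proof.
unfold damping, actuation; rewrite adjoint_spec, adjoint_spec, inner_self.
replace (cB ^ 2 * norm eta ^ 2) with ((cB * norm eta) ^ 2) by ring.
apply pow_incr; split; [|apply B_coercive].
apply Rmult_le_pos; [lra|apply norm_ge_0].
Qed.

Lemma M_lip x y : norm x <= rho1 -> norm y <= rho1 ->
  norm (M x [-] M y) <= k * norm (x [-] y).
Proof. now apply (lipschitz_in_ball M dM (proj1 M_C1)). Qed.

Definition error (v : X * Y) : Y := snd v [-] M (fst v).

Lemma closed_loop_error yref (v : X * Y) :
  closed_loop f g h M dM yref v =
    (f (fst v) [+] actuation (fst v) (error v), h (fst v) [-] yref).
Proof. now destruct v. Qed.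

(** The closed loop in the variables [x] and [z - M x], at the point [v t]. *)
Definition solves (yref : Y) (v : R -> X * Y) (t : R) : Prop :=
  mild_derivative T (fun s => fst (v s)) t
    (f (fst (v t)) [+] actuation (fst (v t)) (error (v t))) /\
  right_derivative (fun s => error (v s)) t
    (vopp yref [-] damping (fst (v t)) (error (v t))).

(** In these variables the unbounded operators [C] and [A] cancel from the second
    equation. *)
Lemma closed_loop_solves yref (v : R -> X * Y) t :
  mild_derivative (cascade_semigroup T (dM vzero)) v t
    (closed_loop f g h M dM yref (v t) : X * Y) ->
  solves yref v t.
Proof.
intros Ho; unfold mild_derivative in Ho; rewrite closed_loop_error in Ho.
assert (H1 := small_o_fst _ Ho); assert (H2 := small_o_snd _ Ho); clear Ho.
set (L := dM vzero) in *; set (x := fst (v t)) in *; set (z := snd (v t)) in *.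
set (b := f x [+] actuation x (error (v t))) in *.
change (small_o (fun s => fst (v (t + s)) [-] T s x [-] s [*] b)) in H1.
change (small_o (fun s => snd (v (t + s)) [-] (z [+] L (T s x [-] x))
  [-] s [*] (h x [-] yref))) in H2.
split; [exact H1|].
assert (HN := derivative_along_perturbed_semigroup A T HT HA (fun x => M x [-] L x)
  (fun x => dM x [-] L) (fun x => h x [-] dM x (f x)) (C1_minus_linear M dM L M_C1)).
assert (Hr : forall y, continuous (fun x => h x [-] dM x (f x)) y).
  intros y; apply (continuous_minus h (fun y => dM y (f y))); auto.
  apply (continuous_operator_apply dM f); auto; apply (proj2 M_C1).
assert (HNr : forall y, uo_dom A y -> bo_fun (dM y [-] L) (A y) = h y [-] dM y (f y)).
  intros y Hy; change (dM y (A y) [-] L (A y) = h y [-] dM y (f y)).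
  pose proof (M_eq y Hy) as E1; rewrite bo_add in E1.
  rewrite (HL y Hy : L (A y) = C y).
  transitivity ((dM y (A y) [+] dM y (f y)) [-] C y [-] dM y (f y)); [vec|].
  rewrite E1; vec.
specialize (HN Hr HNr x b (fun s => fst (v (t + s))) H1); cbv beta in HN.
apply small_o_ext with (2 := small_o_minus _ _
  (small_o_minus _ _ H2 (small_o_map L _ H1)) HN).
intros s _; unfold error at 1 2; fold x z.
change (bo_fun (dM x [-] L) b) with (dM x b [-] L b).
unfold damping.
replace (dM x b) with (dM x (f x) [+] dM x (actuation x (error (v t))))
  by (unfold b; now rewrite bo_add).
bo_linear; vec.
Qed.

(* [H] collects the constants of the perturbation estimates, and [kp] is the weight that
   makes the error dominate its effect on [x]. *)
Context (H kp rho : R).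
Hypotheses (H_1 : 4 * c2 * k ^ 3 <= H * c1) (H_2 : c2 * k ^ 3 <= H).
Hypotheses (H_3 : 4 * k ^ 4 <= H) (H_4 : 4 * k ^ 4 <= H * c1).
Hypothesis kp_def : kp * cB ^ 2 = 2 * H.
Hypotheses (rho_pos : 0 < rho) (rho_le : (2 + k) * rho <= rho1).
Hypotheses (rho_1 : H * rho * (1 + kp) <= w / 2) (rho_2 : H * rho <= cB ^ 2 / 4).

Lemma H_pos : 0 < H.
Proof. assert (1 <= k ^ 4) by now apply pow_R1_Rle. lra. Qed.

Lemma kp_pos : 0 < kp.
Proof.
pose proof H_pos; assert (0 < cB ^ 2) by (apply pow_lt; auto).
apply Rmult_lt_reg_r with (cB ^ 2); lra.
Qed.

Lemma rho_le_rho1 : rho <= rho1.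
Proof. nra. Qed.

Definition rate : R := Rmin (w / 2) (cB ^ 2 / 4).

Lemma rate_pos : 0 < rate.
Proof.
pose proof (cn_w Hp); assert (0 < cB ^ 2) by (apply pow_lt; auto).
apply Rmin_glb_lt; lra.
Qed.

Definition weight (x : X) (eta : Y) : R := p x + kp * norm eta.

Definition inside (v : X * Y) : Prop :=
  norm (fst v) <= rho /\ norm (error v) <= rho.

Definition gap (v1 v2 : R -> X * Y) (t : R) : R :=
  weight (fst (v1 t) [-] fst (v2 t)) (error (v1 t) [-] error (v2 t)).

(** Inside the ball, [p] of the gap in [x] decays but is driven by the gap of the errors; the
    latter decays because the damping is coercive at the origin. The remaining terms
    have a coefficient proportional to [rho]. *)
Lemma gap_dini (v1 v2 : R -> X * Y) (y1 y2 : Y) t :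
  inside (v1 t) -> inside (v2 t) -> solves y1 v1 t -> solves y2 v2 t ->
  dini_le (gap v1 v2) t (- rate * gap v1 v2 t + kp * norm (y1 [-] y2)).
Proof.
intros [Bx1 Be1] [Bx2 Be2] [Ex1 Ee1] [Ex2 Ee2].
set (x1 := fun s => fst (v1 s)) in *; set (x2 := fun s => fst (v2 s)) in *.
set (e1 := fun s => error (v1 s)) in *; set (e2 := fun s => error (v2 s)) in *.
change (norm (x1 t) <= rho) in Bx1; change (norm (x2 t) <= rho) in Bx2.
change (norm (e1 t) <= rho) in Be1; change (norm (e2 t) <= rho) in Be2.
change (mild_derivative T x1 t (f (x1 t) [+] actuation (x1 t) (e1 t))) in Ex1.
change (mild_derivative T x2 t (f (x2 t) [+] actuation (x2 t) (e2 t))) in Ex2.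
change (right_derivative e1 t (vopp y1 [-] damping (x1 t) (e1 t))) in Ee1.
change (right_derivative e2 t (vopp y2 [-] damping (x2 t) (e2 t))) in Ee2.
change (dini_le (fun u => weight (x1 u [-] x2 u) (e1 u [-] e2 u)) t
  (- rate * weight (x1 t [-] x2 t) (e1 t [-] e2 t) + kp * norm (y1 [-] y2))).
pose proof (cn_c1 Hp) as Hc1; pose proof (cn_c2 Hp) as Hc2.
pose proof H_pos as HH; pose proof kp_pos as Hkp; pose proof rho_le_rho1 as Hr1.
set (dx := x1 t [-] x2 t); set (de := e1 t [-] e2 t).
set (P := p dx); set (n := norm de).
assert (HP : 0 <= P) by apply (cn_nonneg Hp).
assert (Hn : 0 <= n) by apply norm_ge_0.
assert (Hdx : c1 * norm dx <= P) by apply (cn_lower Hp).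
assert (Hdx0 := norm_ge_0 dx).
assert (K3 : 1 <= k ^ 3) by now apply pow_R1_Rle.
assert (K4 : 1 <= k ^ 4) by now apply pow_R1_Rle.
assert (K13 : k <= k ^ 3) by (rewrite <- (pow_1 k) at 1; apply Rle_pow; auto).
set (lx := (f (x1 t) [-] f (x2 t)) [+] (actuation (x1 t) (e1 t) [-] actuation (x2 t) (e2 t))).
assert (Hlx : p lx <= H * rho * P + H * n).
{ apply Rle_trans with (1 := cn_upper Hp lx).
  pose proof (f_small rho (x1 t) (x2 t) Hr1 Bx1 Bx2) as F1; fold dx in F1.
  pose proof (actuation_lipschitz (x1 t) (x2 t) (e2 t) ltac:(lra) ltac:(lra)) as F2.
  fold dx in F2.
  pose proof (actuation_bound (x1 t) de ltac:(lra)) as F3; fold n in F3.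
  unfold de in F3; rewrite actuation_sub in F3.
  pose proof (norm_le_plus lx (f (x1 t) [-] f (x2 t))
    ((actuation (x1 t) (e2 t) [-] actuation (x2 t) (e2 t)) [+]
     (actuation (x1 t) (e1 t) [-] actuation (x1 t) (e2 t))) ltac:(unfold lx; vec)) as F4.
  pose proof (norm_add_le (actuation (x1 t) (e2 t) [-] actuation (x2 t) (e2 t))
     (actuation (x1 t) (e1 t) [-] actuation (x1 t) (e2 t))) as F5.
  assert (F6 : 3 * k ^ 3 * norm dx * norm (e2 t) <= 3 * k ^ 3 * norm dx * rho)
    by (apply Rmult_le_compat_l; [apply Rmult_le_pos; lra|auto]).
  assert (F7 : k * rho * norm dx <= k ^ 3 * rho * norm dx).
    apply Rmult_le_compat_r; auto; apply Rmult_le_compat_r; lra.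
  assert (F8 : norm lx <= 4 * k ^ 3 * rho * norm dx + k ^ 3 * n) by lra.
  apply Rle_trans with (c2 * (4 * k ^ 3 * rho * norm dx + k ^ 3 * n)).
    apply Rmult_le_compat_l; lra.
  replace (c2 * (4 * k ^ 3 * rho * norm dx + k ^ 3 * n))
    with (4 * c2 * k ^ 3 * (rho * norm dx) + c2 * k ^ 3 * n) by ring.
  apply Rplus_le_compat; [|apply Rmult_le_compat_r; lra].
  apply Rle_trans with (H * c1 * (rho * norm dx)).
    apply Rmult_le_compat_r; [apply Rmult_le_pos; lra|auto].
  replace (H * c1 * (rho * norm dx)) with (H * rho * (c1 * norm dx)) by ring.
  apply Rmult_le_compat_l; [apply Rmult_le_pos; lra|auto]. }
set (ee := vopp (y1 [-] y2) [-] ((damping (x1 t) de [-] damping vzero de)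
  [+] (damping (x1 t) (e2 t) [-] damping (x2 t) (e2 t)))).
assert (n0 : norm (vzero : X) <= rho1) by (rewrite norm_vzero; lra).
assert (Hee : norm ee <= norm (y1 [-] y2) + H * rho * n + H * rho * P).
{ pose proof (damping_lipschitz (x1 t) vzero de ltac:(lra) n0) as F1; fold n in F1.
  replace (x1 t [-] vzero) with (x1 t) in F1 by vec.
  pose proof (damping_lipschitz (x1 t) (x2 t) (e2 t) ltac:(lra) ltac:(lra)) as F2.
  fold dx in F2.
  pose proof (norm_minus_le (vopp (y1 [-] y2)) ((damping (x1 t) de [-] damping vzero de)
    [+] (damping (x1 t) (e2 t) [-] damping (x2 t) (e2 t)))) as F3; fold ee in F3.
  rewrite norm_vopp in F3.
  pose proof (norm_add_le (damping (x1 t) de [-] damping vzero de)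
    (damping (x1 t) (e2 t) [-] damping (x2 t) (e2 t))) as F4.
  assert (F5 : 4 * k ^ 4 * norm (x1 t) * n <= H * rho * n).
    apply Rmult_le_compat_r; auto; apply Rmult_le_compat; auto; [lra|apply norm_ge_0].
  assert (F6 : 4 * k ^ 4 * norm dx * norm (e2 t) <= H * rho * P).
    apply Rle_trans with (4 * k ^ 4 * norm dx * rho).
      apply Rmult_le_compat_l; [apply Rmult_le_pos; lra|auto].
    apply Rle_trans with (H * c1 * norm dx * rho).
      apply Rmult_le_compat_r; [lra|]; now apply Rmult_le_compat_r.
    replace (H * c1 * norm dx * rho) with (H * rho * (c1 * norm dx)) by ring.
    apply Rmult_le_compat_l; [apply Rmult_le_pos; lra|auto].
  lra. }
assert (D1 : dini_le (fun u => p (x1 u [-] x2 u)) t (- w * P + p lx)).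
  apply (dini_contracting Hp (fun u => x1 u [-] x2 u)).
  replace lx with ((f (x1 t) [+] actuation (x1 t) (e1 t))
    [-] (f (x2 t) [+] actuation (x2 t) (e2 t))) by (unfold lx; vec).
  now apply mild_derivative_sub.
assert (D2 : dini_le (fun u => norm (e1 u [-] e2 u)) t (- cB ^ 2 * n + norm ee)).
  apply (dini_coercive (damping vzero) (fun u => e1 u [-] e2 u) t ee (cB ^ 2) (k ^ 4)).
  - apply pow_lt; auto.
  - lra.
  - intros eta; now apply damping_bound.
  - apply damping_coercive.
  - fold de.
    replace (ee [-] damping vzero de) with ((vopp y1 [-] damping (x1 t) (e1 t))
      [-] (vopp y2 [-] damping (x2 t) (e2 t))).
      now apply right_derivative_sub.
    unfold ee, de; rewrite !damping_sub; vec.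
apply dini_mono with (2 := dini_plus _ _ _ _ _ D1 (dini_scale _ _ _ kp (Rlt_le _ _ Hkp) D2)).
fold dx de; unfold weight; fold P n.
assert (Hr2 : rate <= w / 2) by apply Rmin_l.
assert (Hr3 : rate <= cB ^ 2 / 4) by apply Rmin_r.
assert (E1 : kp * norm ee <= kp * (norm (y1 [-] y2) + H * rho * n + H * rho * P))
  by (apply Rmult_le_compat_l; lra).
assert (E2 : rate * P <= w / 2 * P) by now apply Rmult_le_compat_r.
assert (E3 : kp * n * rate <= kp * n * (cB ^ 2 / 4)).
  apply Rmult_le_compat_l; auto; apply Rmult_le_pos; lra.
assert (E4 : H * rho * (1 + kp) * P <= w / 2 * P) by now apply Rmult_le_compat_r.
assert (E5 : H * rho * (kp * n) <= cB ^ 2 / 4 * (kp * n)).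
  apply Rmult_le_compat_r; auto; apply Rmult_le_pos; lra.
assert (E6 : kp * cB ^ 2 * n = 2 * H * n) by (rewrite kp_def; ring).
lra.
Qed.

(** The ball of this radius for the weight is contained in the ball where the gap
    estimate holds. *)
Definition radius : R := Rmin (c1 * rho) (kp * rho).

Lemma radius_pos : 0 < radius.
Proof.
pose proof (cn_c1 Hp); pose proof kp_pos.
apply Rmin_glb_lt; apply Rmult_lt_0_compat; auto.
Qed.

Lemma weight_triangle x y eta eta' :
  weight (x [+] y) (eta [+] eta') <= weight x eta + weight y eta'.
Proof.
unfold weight; pose proof (cn_triangle Hp x y); pose proof kp_pos.
pose proof (norm_add_le eta eta').
assert (kp * norm (eta [+] eta') <= kp * (norm eta + norm eta'))
  by (apply Rmult_le_compat_l; lra).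
lra.
Qed.

Lemma weight_nonneg x eta : 0 <= weight x eta.
Proof.
unfold weight; pose proof (cn_nonneg Hp x); pose proof kp_pos.
pose proof (norm_ge_0 eta); nra.
Qed.

Lemma weight_lower x eta : norm x <= weight x eta / c1 /\ norm eta <= weight x eta / kp.
Proof.
pose proof (cn_c1 Hp) as Hc1; pose proof kp_pos as Hkp.
pose proof (cn_nonneg Hp x); pose proof (norm_ge_0 eta).
pose proof (cn_lower Hp x).
assert (0 <= kp * norm eta) by (apply Rmult_le_pos; lra).
split.
- apply Rmult_le_reg_r with c1; auto.
  replace (weight x eta / c1 * c1) with (weight x eta) by (field; lra).
  unfold weight; lra.
- apply Rmult_le_reg_r with kp; auto.
  replace (weight x eta / kp * kp) with (weight x eta) by (field; lra).
  unfold weight; lra.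
Qed.

Lemma weight_upper x eta : weight x eta <= c2 * norm x + kp * norm eta.
Proof. unfold weight; pose proof (cn_upper Hp x); lra. Qed.

Lemma weight_ball x eta : weight x eta < radius -> norm x < rho /\ norm eta < rho.
Proof.
intros Hw; pose proof (cn_c1 Hp) as Hc1; pose proof kp_pos as Hkp.
assert (radius <= c1 * rho) by apply Rmin_l; assert (radius <= kp * rho) by apply Rmin_r.
pose proof (cn_nonneg Hp x); pose proof (norm_ge_0 eta).
pose proof (cn_lower Hp x).
assert (0 <= kp * norm eta) by (apply Rmult_le_pos; lra).
unfold weight in Hw; split.
- apply Rmult_lt_reg_l with c1; lra.
- apply Rmult_lt_reg_l with kp; lra.
Qed.

Lemma state_norm_le (v : X * Y) : norm v <= norm (fst v) + norm (snd v).
Proof. exact (norm_pair_le v). Qed.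

Lemma state_fst_le (v : X * Y) : norm (fst v) <= norm v.
Proof. exact (norm_fst_le v). Qed.

Lemma state_snd_le (v : X * Y) : norm (snd v) <= norm v.
Proof. exact (norm_snd_le v). Qed.

Lemma weight_inside (v : X * Y) :
  weight (fst v) (error v) < radius -> inside v /\ norm v < rho1.
Proof.
intros Hw; destruct (weight_ball _ _ Hw) as [Hx He]; pose proof rho_le_rho1.
split; [split; lra|].
pose proof (M_lip (fst v) vzero ltac:(lra) ltac:(rewrite norm_vzero; lra)) as HM.
rewrite M_zero in HM.
replace (M (fst v) [-] vzero) with (M (fst v)) in HM by vec.
replace (fst v [-] vzero) with (fst v) in HM by vec.
pose proof (norm_le_plus (snd v) (error v) (M (fst v)) ltac:(unfold error; vec)).
pose proof (state_norm_le v).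
assert (k * norm (fst v) <= k * rho) by (apply Rmult_le_compat_l; lra).
lra.
Qed.

Lemma fst_continuous (v : R -> X * Y) t :
  continuous v t -> continuous (fun u => fst (v u)) t.
Proof. intros Hv; apply (continuous_comp v fst); auto; apply continuous_fst. Qed.

Lemma error_continuous (v : R -> X * Y) t :
  continuous v t -> continuous (fun u => error (v u)) t.
Proof.
intros Hv; unfold error.
apply (continuous_minus (fun u => snd (v u)) (fun u => M (fst (v u)))).
- apply (continuous_comp v snd); auto; apply continuous_snd.
- apply (continuous_comp (fun u => fst (v u)) M); [now apply fst_continuous|].
  apply (differentiable_continuous M dM (proj1 M_C1)).
Qed.

Lemma gap_continuous (v1 v2 : R -> X * Y) t :
  continuous v1 t -> continuous v2 t -> continuous (gap v1 v2) t.
Proof.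
intros C1 C2; unfold gap, weight.
apply (continuous_plus (V := R_NormedModule) (fun u => p (fst (v1 u) [-] fst (v2 u)))).
- apply (cn_continuous Hp (fun u => fst (v1 u) [-] fst (v2 u))).
  apply (continuous_minus (fun u => fst (v1 u)) (fun u => fst (v2 u)));
    now apply fst_continuous.
- apply (continuous_scal_r (V := R_NormedModule) kp).
  apply (continuous_comp (fun u => error (v1 u) [-] error (v2 u)) norm);
    [|exact (filterlim_norm _)].
  apply (continuous_minus (fun u => error (v1 u)) (fun u => error (v2 u)));
    now apply error_continuous.
Qed.

Lemma gap_nonneg v1 v2 t : 0 <= gap v1 v2 t.
Proof. apply weight_nonneg. Qed.

Context (yref : Y).
Hypothesis yref_small : kp * norm yref <= rate * (radius / 4).

Definition field (v : X * Y) : X * Y := closed_loop f g h M dM yref v.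

Lemma field_lipschitz (v v' : X * Y) : norm v <= rho1 -> norm v' <= rho1 ->
  norm (field v [-] field v') <= 10 * k ^ 4 * norm (v [-] v').
Proof.
intros Hv Hv'; unfold field; rewrite !closed_loop_error.
set (x := fst v); set (x' := fst v'); set (e := error v); set (e' := error v').
set (d := norm (v [-] v')).
assert (Hx : norm x <= rho1) by (pose proof (state_fst_le v); unfold x; lra).
assert (Hx' : norm x' <= rho1) by (pose proof (state_fst_le v'); unfold x'; lra).
assert (Hdx : norm (x [-] x') <= d) by exact (norm_fst_le (v [-] v')).
assert (Hdz : norm (snd v [-] snd v') <= d) by exact (norm_snd_le (v [-] v')).
assert (Hd0 := norm_ge_0 (x [-] x')).
assert (n0 : norm (vzero : X) <= rho1) by (rewrite norm_vzero; lra).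
pose proof (M_lip x x' Hx Hx') as HM.
assert (He : norm (e [-] e') <= d + k * d).
  pose proof (norm_le_plus (e [-] e') (snd v [-] snd v') (vopp (M x [-] M x'))
    ltac:(unfold e, e', error; fold x x'; vec)) as H0.
  rewrite norm_vopp in H0.
  assert (k * norm (x [-] x') <= k * d) by (apply Rmult_le_compat_l; lra); lra.
assert (He' : norm e' <= 2 * k).
  pose proof (M_lip x' vzero Hx' n0) as H0; rewrite M_zero in H0.
  replace (M x' [-] vzero) with (M x') in H0 by vec.
  replace (x' [-] vzero) with x' in H0 by vec.
  pose proof (norm_minus_le (snd v') (M x')) as H1.
  pose proof (state_snd_le v').
  assert (k * norm x' <= k * 1) by (apply Rmult_le_compat_l; lra).
  unfold e', error; fold x'; lra.
pose proof (actuation_lipschitz x x' e' Hx Hx') as H1.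
pose proof (actuation_bound x (e [-] e') Hx) as H2; rewrite actuation_sub in H2.
pose proof (f_small rho1 x x' (Rle_refl _) Hx Hx') as H3.
pose proof (h_lip x x' Hx Hx') as H4.
set (a := f x [+] actuation x e); set (a' := f x' [+] actuation x' e').
assert (Ha : norm (a [-] a') <= norm (f x [-] f x')
  + (norm (actuation x e [-] actuation x e') + norm (actuation x e' [-] actuation x' e'))).
  pose proof (norm_le_plus (a [-] a') (f x [-] f x')
    ((actuation x e [-] actuation x e') [+] (actuation x e' [-] actuation x' e'))
    ltac:(unfold a, a'; vec)).
  pose proof (norm_add_le (actuation x e [-] actuation x e')
    (actuation x e' [-] actuation x' e')).
  lra.
assert (Hb : norm ((h x [-] yref) [-] (h x' [-] yref)) <= k * d).
  replace ((h x [-] yref) [-] (h x' [-] yref)) with (h x [-] h x') by vec.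
  apply Rle_trans with (1 := H4); apply Rmult_le_compat_l; lra.
assert (K3 : 1 <= k ^ 3) by now apply pow_R1_Rle.
assert (K14 : k <= k ^ 4) by (rewrite <- (pow_1 k) at 1; apply Rle_pow; auto).
assert (K34 : k ^ 3 <= k ^ 4) by (apply Rle_pow; auto).
assert (Hd : 0 <= d) by apply norm_ge_0.
assert (E1 : norm (f x [-] f x') <= k ^ 4 * d).
  apply Rle_trans with (1 := H3); apply Rmult_le_compat; auto; [apply Rmult_le_pos; lra|].
  assert (k * rho1 <= k * 1) by (apply Rmult_le_compat_l; lra); lra.
assert (E2 : norm (actuation x e [-] actuation x e') <= 2 * k ^ 4 * d).
  apply Rle_trans with (1 := H2).
  apply Rle_trans with (k ^ 3 * (d + k * d)); [apply Rmult_le_compat_l; lra|].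
  replace (k ^ 3 * (d + k * d)) with (k ^ 3 * d + k ^ 4 * d) by ring.
  assert (k ^ 3 * d <= k ^ 4 * d) by now apply Rmult_le_compat_r.
  lra.
assert (E3 : norm (actuation x e' [-] actuation x' e') <= 6 * k ^ 4 * d).
  apply Rle_trans with (1 := H1).
  apply Rle_trans with (3 * k ^ 3 * d * (2 * k)).
    apply Rmult_le_compat; auto; [| |apply Rmult_le_compat_l; lra].
      apply Rmult_le_pos; lra.
    apply norm_ge_0.
  right; ring.
assert (E4 : k * d <= k ^ 4 * d) by now apply Rmult_le_compat_r.
apply Rle_trans with (1 := norm_pair_le _).
change (norm (a [-] a') + norm ((h x [-] yref) [-] (h x' [-] yref)) <= 10 * k ^ 4 * d).
lra.
Qed.

(** The field is known to be Lipschitz in the ball of radius [rho1] only, and solutions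
    are first constructed for its composition with the retraction. *)
Definition local_field (v : X * Y) : X * Y := field (retract rho1 v).

Lemma local_field_eq v : norm v <= rho1 -> local_field v = field v.
Proof. intros Hv; unfold local_field; now rewrite retract_inside. Qed.

Lemma local_field_lipschitz (v v' : X * Y) :
  norm (local_field v [-] local_field v') <= 20 * k ^ 4 * norm (v [-] v').
Proof.
apply Rle_trans with (10 * k ^ 4 * norm (retract rho1 v [-] retract rho1 v')).
  apply field_lipschitz; apply retract_norm; lra.
pose proof (retract_lipschitz rho1 v v' ltac:(lra)) as H0.
assert (K4 : 1 <= k ^ 4) by now apply pow_R1_Rle.
replace (20 * k ^ 4 * norm (v [-] v')) with (10 * k ^ 4 * (2 * norm (v [-] v'))) by ring.
apply Rmult_le_compat_l; lra.
Qed.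

Let S := cascade_semigroup T (dM vzero).

Lemma S_C0 : C0_semigroup S.
Proof. exact (cascade_semigroup_C0 T (dM vzero) HT). Qed.

Lemma S_generates : generates (cascade_op A C) S.
Proof. exact (cascade_generates A C T (dM vzero) HA HL). Qed.

Lemma field_continuous_inside (v : R -> X * Y) t :
  continuous v t -> norm (v t) < rho1 -> continuous (fun s => field (v s)) t.
Proof.
intros Hv Hb.
apply continuous_ext_loc with (fun s => local_field (v s)).
- destruct (proj1 (continuous_R_iff v t) Hv (rho1 - norm (v t))) as [d [Hd H0]]; [lra|].
  exists (mkposreal d Hd); intros s Hs; specialize (H0 s Hs).
  apply local_field_eq.
  pose proof (norm_le_plus (v s) (v s [-] v t) (v t) ltac:(vec)); lra.
- apply (continuous_comp v local_field); auto.
  exact (lipschitz_continuous (E := prod_NormedModule R_AbsRing X Y)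
    (F := prod_NormedModule R_AbsRing X Y) _ _ local_field_lipschitz _).
Qed.

Lemma duhamel_solves (b : R -> X * Y) (v0 : X * Y) (v : R -> X * Y) t :
  duhamel (E := prod_complete X Y) S b v0 v -> 0 <= t ->
  continuous b t -> b t = field (v t) -> solves yref v t.
Proof.
intros Hv Ht Hb Hbt; apply closed_loop_solves.
change (closed_loop f g h M dM yref (v t)) with (field (v t)); rewrite <- Hbt.
exact (duhamel_expansion (E := prod_complete X Y) S S_C0 b v0 v t Hv Ht Hb).
Qed.

Lemma origin_solves t : solves vzero (fun _ => (vzero, vzero)) t.
Proof.
assert (E0 : error (vzero, vzero) = vzero) by (unfold error; simpl; rewrite M_zero; vec).
assert (Z0 : actuation vzero vzero = vzero).
  transitivity (actuation vzero (vzero [-] vzero)); [f_equal; vec|].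
  rewrite actuation_sub; vec.
unfold solves; rewrite E0; simpl fst; unfold damping; rewrite Z0, bo_0, f_zero.
split; apply small_o_ext with (2 := small_o_zero); intros s _; bo_linear; vec.
Qed.

Lemma equilibrium_solves (q : X * Y) t :
  uo_dom (cascade_op A C) q -> cascade_op A C q = vopp (field q) ->
  solves yref (fun _ => q) t.
Proof.
intros Hd He; apply closed_loop_solves.
apply small_o_ext with (2 := small_o_scal (-1) _
  (generator_expansion (E := prod_complete X Y) (cascade_op A C) S S_generates q Hd)).
intros s _.
change ((-1) [*] (S s q [-] q [-] s [*] (cascade_op A C q : X * Y))
  = q [-] S s q [-] s [*] field q).
rewrite He; vec.
Qed.

(** The weight of the trajectory of the truncated field is its gap to the solution [0]
    for the reference [0]. It stays small, so that the truncation is not felt. *)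
Lemma trajectory_from_origin : exists v : R -> X * Y,
  (forall t, continuous v t) /\
  duhamel (E := prod_complete X Y) S (fun s => field (v s)) (vzero, vzero) v /\
  (forall t, 0 <= t -> weight (fst (v t)) (error (v t)) <= radius / 4).
Proof.
pose proof rate_pos as Hrate; pose proof radius_pos as Hrad.
pose proof (cn_c1 Hp) as Hc1; pose proof (cn_c2 Hp) as Hc2.
assert (K4 : 1 <= k ^ 4) by now apply pow_R1_Rle.
destruct (cascade_semigroup_bound T (dM vzero) (c2 / c1)) as [K [HK HSK]].
  intros t x Ht; now apply (cn_semigroup_bound Hp).
  apply Rlt_le, Rdiv_lt_0_compat; lra.
destruct (mild_existence (E := prod_complete X Y) S S_C0 local_field K (20 * k ^ 4)
  (vzero, vzero)) as [v [Hc Hv]]; auto; [lra|exact local_field_lipschitz|].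
assert (Hc' : forall t, continuous (v : R -> X * Y) t) by exact Hc.
assert (Hv0 : v 0 = (vzero, vzero)).
  exact (duhamel_initial (E := prod_complete X Y) S S_C0 _ _ _ Hv).
set (c := kp * norm yref / rate).
assert (Hcr : rate * c = kp * norm yref) by (unfold c; field; lra).
assert (Hc0 : 0 <= c).
  apply Rdiv_le_0_compat; auto; apply Rmult_le_pos; [apply Rlt_le, kp_pos|apply norm_ge_0].
assert (Hcrad : c <= radius / 4) by (apply Rmult_le_reg_l with rate; lra).
set (o := fun _ : R => (vzero, vzero) : X * Y).
assert (Hgap : forall u, gap v o u = weight (fst (v u)) (error (v u))).
  intros u; unfold gap, o, error; simpl; rewrite M_zero; f_equal; vec.
assert (Hgap0 : gap v o 0 = 0).
  unfold gap, weight; rewrite Hv0; unfold o.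
  match goal with |- p ?a + kp * norm ?b = 0 =>
    replace a with (vzero : X) by vec; replace b with (vzero : Y) by vec end.
  rewrite (cn_zero Hp), norm_vzero; ring.
assert (Hbound : forall t, 0 <= t -> gap v o t <= c).
{ intros t Ht.
  pose proof (dini_decay (gap v o) rate c radius) as Hd.
  rewrite Hgap0, Rmax_left in Hd by lra.
  rewrite <- (Rplus_0_r c), <- (Rmult_0_r (exp (- rate * t))).
  apply Hd; try lra; clear Hd.
  - intros u; apply gap_continuous; [apply Hc'|apply continuous_const].
  - intros u Hu Hlt; rewrite Hgap in Hlt; destruct (weight_inside (v u) Hlt) as [Bi Bv].
    apply dini_mono with (- rate * gap v o u + kp * norm (yref [-] vzero)).
      replace (yref [-] vzero) with yref by vec; lra.
    apply gap_dini; auto; [| |apply origin_solves].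
    + split; unfold o, error; simpl; rewrite ?M_zero, ?norm_vzero; [lra|].
      replace (vzero [-] vzero) with (vzero : Y) by vec; rewrite norm_vzero; lra.
    + apply (duhamel_solves (fun s => local_field (v s)) (vzero, vzero)); auto.
        apply (continuous_comp v local_field); [apply Hc'|].
        exact (lipschitz_continuous (E := prod_NormedModule R_AbsRing X Y)
          (F := prod_NormedModule R_AbsRing X Y) _ _ local_field_lipschitz _).
      apply local_field_eq; lra. }
exists v; split; [exact Hc|split].
- intros t Ht.
  apply is_RInt_ext with (2 := Hv t Ht); intros s Hs.
  rewrite Rmin_left, Rmax_right in Hs by lra.
  rewrite local_field_eq; [reflexivity|].
  specialize (Hbound s ltac:(lra)); rewrite Hgap in Hbound.
  apply Rlt_le, weight_inside; lra.
- intros t Ht; rewrite <- Hgap; specialize (Hbound t Ht); lra.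
Qed.

(** By the gap estimate, the trajectory and its translates in time approach each other
    exponentially: it is Cauchy. *)
Lemma trajectory_limit (v : R -> X * Y) :
  (forall t, continuous v t) ->
  duhamel (E := prod_complete X Y) S (fun s => field (v s)) (vzero, vzero) v ->
  (forall t, 0 <= t -> weight (fst (v t)) (error (v t)) <= radius / 4) ->
  exists q : X * Y,
    (forall e, 0 < e -> exists N, forall t, N <= t -> norm (v t [-] q) < e) /\
    weight (fst q) (error q) < radius / 2 /\
    uo_dom (cascade_op A C) q /\ cascade_op A C q = vopp (field q).
Proof.
intros Hc Hv Hb.
pose proof rate_pos as Hrate; pose proof radius_pos as Hrad; pose proof kp_pos as Hkp.
pose proof (cn_c1 Hp) as Hc1; pose proof (cn_c2 Hp) as Hc2.
assert (HB : forall t, 0 <= t -> inside (v t) /\ norm (v t) < rho1).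
  intros t Ht; apply weight_inside; specialize (Hb t Ht); lra.
assert (Hsol : forall t, 0 <= t -> solves yref v t).
  intros t Ht; apply (duhamel_solves (fun s => field (v s)) (vzero, vzero)); auto.
  apply field_continuous_inside; auto; now apply HB.
assert (Hshift : forall t hh, 0 <= t -> 0 <= hh ->
  gap (fun s => v (s + hh)) v t <= exp (- rate * t) * (radius / 2)).
{ intros t hh Ht Hh.
  apply Rle_trans with (exp (- rate * t) * gap (fun s => v (s + hh)) v 0).
  - apply dini_decay_global; auto; [|lra|apply gap_nonneg|].
    + intros u; apply gap_continuous; auto.
      now apply (continuous_time_shift (E := prod_NormedModule R_AbsRing X Y)).
    + intros u Hu.
      apply dini_mono with
        (- rate * gap (fun s => v (s + hh)) v u + kp * norm (yref [-] yref)).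
        replace (yref [-] yref) with (vzero : Y) by vec; rewrite norm_vzero; lra.
      destruct (Hsol (u + hh) ltac:(lra)) as [Ex Ee].
      apply gap_dini; [apply HB; lra|apply HB; lra| |auto].
      split; [now apply (mild_derivative_time_shift T (fun s => fst (v s)))|].
      now apply (right_derivative_time_shift (fun s => error (v s))).
  - apply Rmult_le_compat_l; [apply Rlt_le, exp_pos|].
    pose proof (weight_triangle (fst (v (0 + hh))) (vopp (fst (v 0)))
      (error (v (0 + hh))) (vopp (error (v 0)))) as Ht0.
    replace (weight (vopp (fst (v 0))) (vopp (error (v 0))))
      with (weight (fst (v 0)) (error (v 0))) in Ht0
      by (unfold weight; now rewrite (cn_opp Hp), norm_vopp).
    change (gap (fun s => v (s + hh)) v 0
      <= weight (fst (v (0 + hh))) (error (v (0 + hh))) + weight (fst (v 0)) (error (v 0)))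
      in Ht0.
    pose proof (Hb 0 ltac:(lra)); pose proof (Hb (0 + hh) ltac:(lra)); lra. }
assert (Hcauchy : forall t hh, 0 <= t -> 0 <= hh ->
  norm (fst (v (t + hh)) [-] fst (v t)) <= radius / 2 / c1 * exp (- rate * t) /\
  norm (error (v (t + hh)) [-] error (v t)) <= radius / 2 / kp * exp (- rate * t)).
{ intros t hh Ht Hh; specialize (Hshift t hh Ht Hh).
  destruct (weight_lower (fst (v (t + hh)) [-] fst (v t)) (error (v (t + hh)) [-] error (v t)))
    as [W1 W2].
  fold (gap (fun s => v (s + hh)) v t) in W1, W2; split.
  - apply Rle_trans with (1 := W1).
    replace (radius / 2 / c1 * exp (- rate * t))
      with (exp (- rate * t) * (radius / 2) / c1) by (field; lra).
    apply Rmult_le_compat_r; [apply Rlt_le, Rinv_0_lt_compat|]; auto.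
  - apply Rle_trans with (1 := W2).
    replace (radius / 2 / kp * exp (- rate * t))
      with (exp (- rate * t) * (radius / 2) / kp) by (field; lra).
    apply Rmult_le_compat_r; [apply Rlt_le, Rinv_0_lt_compat|]; auto. }
destruct (exponential_cauchy (fun t => fst (v t)) (radius / 2 / c1) rate Hrate)
  as [xs Hxs]; [apply Rdiv_le_0_compat; lra|now apply Hcauchy|].
destruct (exponential_cauchy (fun t => error (v t)) (radius / 2 / kp) rate Hrate)
  as [es Hes]; [apply Rdiv_le_0_compat; lra|now apply Hcauchy|].
set (q := (xs, es [+] M xs) : X * Y).
assert (Hq : error q = es) by (unfold q, error; simpl; vec).
assert (Hlim : forall e, 0 < e -> exists N, forall t, N <= t -> norm (v t [-] q) < e).
  intros e He.
  destruct (proj1 (continuous_ball_iff M xs)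
    (differentiable_continuous M dM (proj1 M_C1) xs) (e / 3)) as [d [Hd HM]]; [lra|].
  destruct (Hxs (Rmin d (e / 3))) as [N1 HN1]; [apply Rmin_glb_lt; lra|].
  destruct (Hes (e / 3)) as [N2 HN2]; [lra|].
  exists (Rmax N1 N2); intros t Ht.
  pose proof (Rmax_l N1 N2); pose proof (Rmax_r N1 N2).
  specialize (HN1 t ltac:(lra)); specialize (HN2 t ltac:(lra)); cbv beta in HN1, HN2.
  pose proof (Rmin_l d (e / 3)); pose proof (Rmin_r d (e / 3)).
  specialize (HM (fst (v t)) ltac:(lra)).
  pose proof (state_norm_le (v t [-] q)) as H4.
  change (norm (v t [-] q)
    <= norm (fst (v t) [-] xs) + norm (snd (v t) [-] (es [+] M xs))) in H4.
  pose proof (norm_le_plus (snd (v t) [-] (es [+] M xs)) (error (v t) [-] es)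
    (M (fst (v t)) [-] M xs) ltac:(unfold error; vec)).
  lra.
assert (Hwq : weight (fst q) (error q) < radius / 2).
  rewrite Hq; simpl fst.
  destruct (Hxs (radius / 16 / c2)) as [N1 HN1]; [apply Rdiv_lt_0_compat; lra|].
  destruct (Hes (radius / 16 / kp)) as [N2 HN2]; [apply Rdiv_lt_0_compat; lra|].
  set (t := Rmax 0 (Rmax N1 N2)).
  assert (Ht : 0 <= t) by apply Rmax_l.
  assert (Ht1 : N1 <= t) by (eapply Rle_trans; [apply Rmax_l|apply Rmax_r]).
  assert (Ht2 : N2 <= t) by (eapply Rle_trans; [apply Rmax_r|apply Rmax_r]).
  specialize (HN1 t Ht1); specialize (HN2 t Ht2); cbv beta in HN1, HN2.
  pose proof (weight_triangle (fst (v t)) (xs [-] fst (v t)) (error (v t)) (es [-] error (v t)))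
    as H0.
  replace (fst (v t) [+] (xs [-] fst (v t))) with xs in H0 by vec.
  replace (error (v t) [+] (es [-] error (v t))) with es in H0 by vec.
  pose proof (weight_upper (xs [-] fst (v t)) (es [-] error (v t))) as H5.
  rewrite (norm_minus_sym xs), (norm_minus_sym es) in H5; specialize (Hb t Ht).
  assert (c2 * norm (fst (v t) [-] xs) < radius / 16) by (apply mul_div_lt; lra).
  assert (kp * norm (error (v t) [-] es) < radius / 16) by (apply mul_div_lt; lra).
  lra.
destruct (weight_inside q) as [_ Bq]; [lra|].
exists q; split; [exact Hlim|split; [exact Hwq|]].
apply (duhamel_limit (E := prod_complete X Y) S S_C0 (cascade_op A C)
  (fun s => field (v s)) (vzero, vzero) v q (field q) S_generates Hv Hlim).
intros e He.
assert (K4 : 1 <= k ^ 4) by now apply pow_R1_Rle.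
destruct (Hlim (Rmin (rho1 - norm q) (e / (10 * k ^ 4)))) as [N HN].
  apply Rmin_glb_lt; [lra|apply Rdiv_lt_0_compat; lra].
exists N; intros t Ht; specialize (HN t Ht).
pose proof (Rmin_l (rho1 - norm q) (e / (10 * k ^ 4))).
pose proof (Rmin_r (rho1 - norm q) (e / (10 * k ^ 4))).
pose proof (norm_le_plus (v t) (v t [-] q) q ltac:(vec)).
apply Rle_lt_trans with (1 := field_lipschitz (v t) q ltac:(lra) ltac:(lra)).
apply mul_div_lt; lra.
Qed.

Lemma error_gap (v v' : X * Y) : norm (fst v) <= rho1 -> norm (fst v') <= rho1 ->
  norm (error v [-] error v') <= (1 + k) * norm (v [-] v') /\
  norm (snd v [-] snd v')
    <= norm (error v [-] error v') + k * norm (fst v [-] fst v').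
Proof.
intros Bv Bv'; pose proof (M_lip (fst v) (fst v') Bv Bv') as HM.
assert (D1 : norm (fst v [-] fst v') <= norm (v [-] v')) by exact (norm_fst_le (v [-] v')).
assert (D2 : norm (snd v [-] snd v') <= norm (v [-] v')) by exact (norm_snd_le (v [-] v')).
assert (k * norm (fst v [-] fst v') <= k * norm (v [-] v')) by (apply Rmult_le_compat_l; lra).
pose proof (norm_le_plus (error v [-] error v') (snd v [-] snd v')
  (vopp (M (fst v) [-] M (fst v'))) ltac:(unfold error; vec)) as D3.
rewrite norm_vopp in D3.
pose proof (norm_le_plus (snd v [-] snd v') (error v [-] error v')
  (M (fst v) [-] M (fst v')) ltac:(unfold error; vec)).
split; lra.
Qed.

(** A solution is not known in advance to remain in the ball where the weight is
    contracted; the gap decreases as long as it does, which keeps it there. *)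
Lemma equilibrium_stable (q : X * Y) :
  weight (fst q) (error q) < radius / 2 ->
  uo_dom (cascade_op A C) q -> cascade_op A C q = vopp (field q) ->
  locally_exponentially_stable (cascade_op A C) field q.
Proof.
intros Hwq Hqd Hqe.
pose proof rate_pos as Hrate; pose proof radius_pos as Hrad; pose proof kp_pos as Hkp.
pose proof (cn_c1 Hp) as Hc1; pose proof (cn_c2 Hp) as Hc2.
destruct (weight_inside q) as [Bq _]; [lra|].
pose proof rho_le_rho1 as Hr1.
set (KW := c2 + kp * (1 + k)); assert (HKW : 0 < KW) by (unfold KW; nra).
set (KN := (1 + k) / c1 + / kp).
assert (HKN : 0 < KN).
  apply Rplus_lt_0_compat; [apply Rdiv_lt_0_compat; lra|now apply Rinv_0_lt_compat].
exists (Rmin rho (radius / 2 / KW)), (KN * KW), rate.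
split; [apply Rmin_glb_lt; [auto|apply Rdiv_lt_0_compat; lra]|].
split; [nra|split; [auto|]].
enough (Hmain : forall (w0 : X * Y) (ww : R -> X * Y),
  norm (w0 [-] q) < Rmin rho (radius / 2 / KW) ->
  mild_solution (E := prod_NormedModule R_AbsRing X Y) (cascade_op A C) field w0 ww ->
  forall t, 0 <= t ->
    norm (ww t [-] q) <= KN * KW * exp (- rate * t) * norm (w0 [-] q)) by exact Hmain.
intros w0 ww Hw0 Hmild t Ht.
pose proof (Rmin_l rho (radius / 2 / KW)); pose proof (Rmin_r rho (radius / 2 / KW)).
destruct (mild_solution_duhamel (E := prod_complete X Y) (cascade_op A C) S field w0 ww
  S_C0 S_generates Hmild) as [Hc Hv].
set (v := fun t => ww (Rmax 0 t)) in *.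
assert (Hc' : forall t, continuous (v : R -> X * Y) t) by exact Hc; clear Hc.
assert (Hv0 : v 0 = w0).
  exact (duhamel_initial (E := prod_complete X Y) S S_C0 _ _ _ Hv).
replace (ww t) with (v t) by (unfold v; now rewrite Rmax_right by lra).
set (phi := gap v (fun _ => q)).
assert (D1 : norm (fst w0 [-] fst q) <= norm (w0 [-] q)) by exact (norm_fst_le (w0 [-] q)).
assert (B0 : norm (fst w0) <= rho1).
  pose proof (norm_le_plus (fst w0) (fst w0 [-] fst q) (fst q) ltac:(vec)).
  destruct Bq as [Bq _]; nra.
assert (Hphi0 : phi 0 <= KW * norm (w0 [-] q)).
  unfold phi, gap; rewrite Hv0; apply Rle_trans with (1 := weight_upper _ _).
  destruct (error_gap w0 q B0 (Rle_trans _ _ _ (proj1 Bq) Hr1)) as [D3 _].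
  assert (c2 * norm (fst w0 [-] fst q) <= c2 * norm (w0 [-] q))
    by (apply Rmult_le_compat_l; lra).
  assert (kp * norm (error w0 [-] error q) <= kp * ((1 + k) * norm (w0 [-] q)))
    by (apply Rmult_le_compat_l; lra).
  unfold KW; lra.
assert (Hphi0' : phi 0 < radius / 2).
  apply Rle_lt_trans with (1 := Hphi0); apply mul_div_lt; lra.
assert (HB : forall u, phi u < radius / 2 -> inside (v u) /\ norm (v u) < rho1).
  intros u Hu; apply weight_inside.
  pose proof (weight_triangle (fst (v u) [-] fst q) (fst q) (error (v u) [-] error q) (error q))
    as G1.
  replace (fst (v u) [-] fst q [+] fst q) with (fst (v u)) in G1 by vec.
  replace (error (v u) [-] error q [+] error q) with (error (v u)) in G1 by vec.
  unfold phi, gap in Hu; lra.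
assert (Hpos : 0 <= phi 0) by apply gap_nonneg.
assert (Hphi : phi t <= exp (- rate * t) * phi 0).
{ pose proof (dini_decay phi rate 0 (radius / 2)) as Hd.
  rewrite Rminus_0_r, Rmax_right in Hd by auto.
  rewrite <- (Rplus_0_l (exp _ * _)); apply Hd; try lra; clear Hd.
  - intros u; apply gap_continuous; [apply Hc'|apply continuous_const].
  - intros u Hu Hlt; destruct (HB u Hlt) as [Bu Bv].
    apply dini_mono with (- rate * phi u + kp * norm (yref [-] yref)).
      replace (yref [-] yref) with (vzero : Y) by vec; rewrite norm_vzero; lra.
    apply gap_dini; auto; [|now apply equilibrium_solves].
    apply (duhamel_solves (fun s => field (v s)) w0); auto.
    now apply field_continuous_inside. }
assert (Hpt : phi t < radius / 2).
  pose proof (exp_decay_le_1 rate t ltac:(lra) Ht).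
  assert (exp (- rate * t) * phi 0 <= 1 * phi 0) by now apply Rmult_le_compat_r.
  lra.
destruct (HB t Hpt) as [[Bt _] _].
destruct (weight_lower (fst (v t) [-] fst q) (error (v t) [-] error q)) as [W1 W2].
fold (gap v (fun _ => q) t) in W1, W2; fold phi in W1, W2.
assert (Hfin : norm (v t [-] q) <= KN * phi t).
  pose proof (state_norm_le (v t [-] q)) as G1.
  change (norm (v t [-] q)
    <= norm (fst (v t) [-] fst q) + norm (snd (v t) [-] snd q)) in G1.
  destruct (error_gap (v t) q (Rle_trans _ _ _ Bt Hr1) (Rle_trans _ _ _ (proj1 Bq) Hr1))
    as [_ G2].
  assert (k * norm (fst (v t) [-] fst q) <= k * (phi t / c1))
    by (apply Rmult_le_compat_l; lra).
  unfold KN; replace (((1 + k) / c1 + / kp) * phi t)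
    with (phi t / c1 + k * (phi t / c1) + phi t / kp) by (field; lra).
  lra.
apply Rle_trans with (1 := Hfin).
apply Rle_trans with (KN * (exp (- rate * t) * (KW * norm (w0 [-] q)))); [|right; ring].
apply Rmult_le_compat_l; [lra|].
apply Rle_trans with (1 := Hphi); apply Rmult_le_compat_l; auto; apply Rlt_le, exp_pos.
Qed.

Lemma small_reference_regulation :
  exists (xs : X) (zs : Y),
    equilibrium (cascade_op A C) field (xs, zs) /\
    locally_exponentially_stable (cascade_op A C) field (xs, zs) /\
    plus (C xs) (h xs) = yref /\
    basin_of_attraction (cascade_op A C) field (xs, zs) (zero, zero).
Proof.
destruct trajectory_from_origin as [v [Hc [Hv Hb]]].
destruct (trajectory_limit v Hc Hv Hb) as [[xs zs] [Hlim [Hw [Hd He]]]].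
exists xs, zs; split; [|split; [|split]].
- split; [exact Hd|].
  change (cascade_op A C (xs, zs) [+] field (xs, zs) = vzero); rewrite He.
  change (vopp (field (xs, zs)) [+] field (xs, zs) = vzero); vec.
- now apply equilibrium_stable.
- assert (H2 : C xs = vopp (h xs [-] yref)).
    change (snd (cascade_op A C (xs, zs)) = snd (vopp (field (xs, zs)))).
    exact (f_equal snd He).
  change (C xs [+] h xs = yref); rewrite H2; vec.
- exists v; split.
  + exists S; split; [exact S_C0|split; [exact S_generates|split]].
    * intros t _.
      apply filterlim_filter_le_1 with (2 := Hc t).
      intros P HP; now apply filter_le_within.
    * intros t Ht; exact (Hv t Ht).
  + apply (proj2 (filterlim_locally_ball_norm (K := R_AbsRing)
      (F := Rbar_locally p_infty) (U := prod_NormedModule R_AbsRing X Y) v (xs, zs))).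
    intros [e Hepos]; destruct (Hlim e Hepos) as [N HN].
    exists N; intros t Ht; exact (HN t (Rlt_le _ _ Ht)).
Qed.

End ClosedLoop.

(** * Choice of the constants *)

Lemma op_norm_le_of_lipschitz {E F G : NormedModule R_AbsRing} (S : E -> bounded_op F G) k r x :
  0 <= k -> 0 <= r -> norm x <= r ->
  op_norm (S x [-] S vzero) <= k * norm (x [-] vzero) ->
  op_norm (S x) <= op_norm (S vzero) + k * r.
Proof.
intros Hk Hr Hx H; replace (x [-] vzero) with x in H by vec.
pose proof (norm_le_plus (E := bo_NormedModule F G) (S x) (S x [-] S vzero) (S vzero)
  ltac:(vec)) as H1.
change (op_norm (S x) <= op_norm (S x [-] S vzero) + op_norm (S vzero)) in H1.
assert (k * norm x <= k * r) by (apply Rmult_le_compat_l; lra); lra.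
Qed.

Theorem theorem5 (X U Y : Hilbert)
    (A : unbounded_op X) (f : X -> X) (g : X -> bounded_op U X) (h : X -> Y)
    (C : X -> Y)
    (A_gen : infinitesimal_generator A)
    (f_lip : locally_lipschitz f) (f_zero : f zero = zero)
    (g_lip : locally_lipschitz g)
    (h_lip : locally_lipschitz h) (h_zero : h zero = zero)
    (C_bounded : bounded_on_domain A C)
    (iss : ISS A f g)
    (f_smooth : smooth_with_zero_differential f)
    (h_smooth : smooth_with_zero_differential h)
    (lyap : Lyap A)
    (M : X -> Y) (dM : X -> bounded_op X Y)
    (M_C1 : C1_with M dM) (M_zero : M zero = zero)
    (M_eq : forall x, uo_dom A x ->
       dM x (plus (A x) (f x)) = plus (C x) (h x))
    (range : forall y : Y, exists u : U, C (uo_inv A (g zero u)) = y) :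
  exists r : R, 0 < r /\
  forall yref : Y, norm yref < r ->
  exists (xs : X) (zs : Y),
    let Acl := cascade_op A C in
    let Fcl := closed_loop f g h M dM yref in
    equilibrium Acl Fcl (xs, zs) /\
    locally_exponentially_stable Acl Fcl (xs, zs) /\
    plus (C xs) (h xs) = yref /\
    basin_of_attraction Acl Fcl (xs, zs) (zero, zero).
Proof.
destruct A_gen as [T [HT HA]].
destruct f_smooth as [df [f_diff [df_lip df_zero]]].
destruct h_smooth as [dh [h_diff [dh_lip dh_zero]]].
destruct (lyapunov_contracting_norm A T HT HA lyap) as [p [c1 [c2 [w Hp]]]].
pose proof (cn_c1 Hp) as Hc1; pose proof (cn_c2 Hp) as Hc2.
pose proof (cn_w Hp) as Hw.
assert (C_scal : forall (a : R) x, uo_dom A x -> C (scal a x) = scal a (C x))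
  by (intros a x; apply (proj1 (proj2 C_bounded))).
assert (HL : forall x, uo_dom A x -> dM vzero (A x) = C x).
  exact (differential_at_origin A T HA f h C M dM df dh f_diff df_zero f_zero
    h_diff dh_zero h_zero C_scal M_C1 M_eq).
destruct (differential_lipschitz_near_origin A T HT HA f h C M dM df dh f_diff df_lip
  df_zero f_zero h_diff dh_lip dh_zero h_zero C_scal M_C1 M_zero M_eq p c1 c2 w Hp)
  as [rM [kM [HrM [HkM LM]]]].
destruct (lipschitz_on_unit_ball g g_lip) as [kg [Hkg Lg]].
destruct (lipschitz_on_unit_ball h h_lip) as [kh [Hkh Lh]].
destruct (lipschitz_on_unit_ball df df_lip) as [kf [Hkf Lf]].
assert (Hsurj : forall y : Y, exists u : U, bo_comp (dM vzero) (g vzero) u = y).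
  intros y; destruct (range y) as [u Hu]; exists u.
  destruct (uo_inv_spec A T HT HA p c1 c2 w Hp (g zero u) lyap) as [Hd HAx].
  rewrite <- Hu, <- HL, HAx by exact Hd; reflexivity.
destruct (surjective_adjoint_coercive _ Hsurj) as [cB [HcB HB]].
(* One constant bounds all the data, and their Lipschitz constants, on the ball of radius [rho1]. *)
set (k := 1 + kg + kM + kh + kf + op_norm (g vzero) + op_norm (dM vzero)).
pose proof (op_norm_ge0 (g vzero)) as Hg0; pose proof (op_norm_ge0 (dM vzero)) as HM0.
assert (Hk : 1 <= k) by (unfold k; lra).
set (rho1 := Rmin 1 rM).
assert (Hrho1 : 0 < rho1) by (apply Rmin_glb_lt; lra).
assert (Hr1 : rho1 <= 1) by apply Rmin_l.
assert (HrM1 : rho1 <= rM) by apply Rmin_r.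
assert (n0 : norm (vzero : X) <= rho1) by (rewrite norm_vzero; lra).
assert (Hmono : forall a b c : R, a <= b -> 0 <= c -> a * c <= b * c)
  by (intros a b c Hab Hc; now apply Rmult_le_compat_r).
set (H := 4 * k ^ 4 * (c2 / c1 + c2 + 1 + / c1)).
assert (K3 : 1 <= k ^ 3) by now apply pow_R1_Rle.
assert (K34 : k ^ 3 <= k ^ 4) by (apply Rle_pow; auto).
assert (Hic1 : 0 < / c1) by now apply Rinv_0_lt_compat.
assert (Hcc : 0 < c2 / c1) by now apply Rdiv_lt_0_compat.
assert (HH : 4 * k ^ 4 <= H).
  unfold H; rewrite <- (Rmult_1_r (4 * k ^ 4)) at 1; apply Rmult_le_compat_l; lra.
assert (HHc : H * c1 = 4 * k ^ 4 * (c2 + c2 * c1 + c1 + 1)) by (unfold H; field; lra).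
(* The damping of the error, [kp * cB ^ 2], is twice the action [H] of the error on [x]; the
   other terms are proportional to [rho], which is chosen last. *)
set (kp := 2 * H / cB ^ 2).
assert (HcB2 : 0 < cB ^ 2) by now apply pow_lt.
assert (Hkp : 0 < kp) by (apply Rdiv_lt_0_compat; lra).
set (rho := Rmin (rho1 / (2 + k)) (Rmin (w / (2 * H * (1 + kp))) (cB ^ 2 / (4 * H)))).
assert (HH1 : 0 < 2 * H * (1 + kp)) by (apply Rmult_lt_0_compat; lra).
assert (Hrho : 0 < rho).
  repeat apply Rmin_glb_lt; apply Rdiv_lt_0_compat; lra.
assert (R1 : rho <= rho1 / (2 + k)) by apply Rmin_l.
assert (R2 : rho <= w / (2 * H * (1 + kp)))
  by (eapply Rle_trans; [apply Rmin_r|apply Rmin_l]).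
assert (R3 : rho <= cB ^ 2 / (4 * H))
  by (eapply Rle_trans; [apply Rmin_r|apply Rmin_r]).
assert (R1' : (2 + k) * rho <= rho1).
  apply Rle_trans with ((2 + k) * (rho1 / (2 + k))); [apply Rmult_le_compat_l; lra|].
  right; field; lra.
assert (R2' : H * rho * (1 + kp) <= w / 2).
  replace (H * rho * (1 + kp)) with (H * (1 + kp) * rho) by ring.
  apply Rle_trans with (H * (1 + kp) * (w / (2 * H * (1 + kp)))); [|right; field; lra].
  apply Rmult_le_compat_l; lra.
assert (R3' : H * rho <= cB ^ 2 / 4).
  apply Rle_trans with (H * (cB ^ 2 / (4 * H))); [apply Rmult_le_compat_l; lra|].
  right; field; lra.
assert (g_bd : forall x, norm x <= rho1 -> op_norm (g x) <= k).
  intros x Hx; apply Rle_trans with (op_norm (g vzero) + kg * 1); [|unfold k; lra].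
  apply op_norm_le_of_lipschitz; try lra; apply Lg; lra.
assert (dM_bd : forall x, norm x <= rho1 -> op_norm (dM x) <= k).
  intros x Hx; apply Rle_trans with (op_norm (dM vzero) + kM * 1); [|unfold k; lra].
  apply op_norm_le_of_lipschitz; try lra; apply LM; lra.
assert (g_lp : forall x y, norm x <= rho1 -> norm y <= rho1 ->
  op_norm (g x [-] g y) <= k * norm (x [-] y)).
  intros x y Hx Hy; apply Rle_trans with (kg * norm (x [-] y)).
    apply Lg; lra.
  apply Hmono; [unfold k; lra|apply norm_ge_0].
assert (dM_lp : forall x y, norm x <= rho1 -> norm y <= rho1 ->
  op_norm (dM x [-] dM y) <= k * norm (x [-] y)).
  intros x y Hx Hy; apply Rle_trans with (kM * norm (x [-] y)).
    apply LM; lra.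
  apply Hmono; [unfold k; lra|apply norm_ge_0].
assert (h_lp : forall x y, norm x <= rho1 -> norm y <= rho1 ->
  norm (h x [-] h y) <= k * norm (x [-] y)).
  intros x y Hx Hy; apply Rle_trans with (kh * norm (x [-] y)).
    apply Lh; lra.
  apply Hmono; [unfold k; lra|apply norm_ge_0].
assert (f_sm : forall r x y, r <= rho1 -> norm x <= r -> norm y <= r ->
  norm (f x [-] f y) <= k * r * norm (x [-] y)).
  intros r x y Hr Hx Hy.
  apply (lipschitz_in_ball f df f_diff r); auto; intros v Hv.
  pose proof (norm_ge_0 v).
  pose proof (op_norm_le_of_lipschitz df kf r v Hkf ltac:(lra) Hv
    (Lf v vzero ltac:(lra) ltac:(lra))) as H1.
  replace (op_norm (df vzero)) with 0 in H1.
    apply Rle_trans with (kf * r); [lra|apply Hmono; [unfold k|]; lra].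
  rewrite (df_zero : df vzero = vzero); symmetry.
  exact (norm_vzero (E := bo_NormedModule X X)).
assert (B_co : forall eta : Y,
  cB * norm eta <= norm (adjoint (g vzero) (adjoint (dM vzero) eta))).
  intros eta; rewrite <- (adjoint_unique (bo_comp (dM vzero) (g vzero)) eta
    (adjoint (g vzero) (adjoint (dM vzero) eta))); [apply HB|].
  intros u; change (bo_comp (dM vzero) (g vzero) u) with (dM vzero (g vzero u)).
  now rewrite !adjoint_spec.
set (rad := radius c1 kp rho).
assert (Hrad : 0 < rad) by (apply Rmin_glb_lt; apply Rmult_lt_0_compat; lra).
set (wr := rate w cB).
assert (Hwr : 0 < wr) by (apply Rmin_glb_lt; lra).
exists (wr * (rad / 4) / kp); split.
  apply Rdiv_lt_0_compat; auto; apply Rmult_lt_0_compat; lra.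
intros yref Hy.
apply (small_reference_regulation A T HT HA f g h C M dM f_zero M_zero
  (differentiable_continuous f df f_diff) (differentiable_continuous h dh h_diff)
  M_C1 M_eq HL p c1 c2 w Hp k rho1 cB Hk Hrho1 Hr1 g_bd dM_bd g_lp dM_lp h_lp f_sm
  HcB B_co H kp rho); auto.
- rewrite HHc.
  assert (4 * c2 * k ^ 3 <= 4 * c2 * k ^ 4) by (apply Rmult_le_compat_l; lra).
  assert (0 <= k ^ 4 * (c2 * c1 + c1 + 1)) by (apply Rmult_le_pos; nra); lra.
- assert (c2 * k ^ 3 <= c2 * k ^ 4) by (apply Rmult_le_compat_l; lra).
  assert (0 <= k ^ 4 * (4 * (c2 / c1) + 3 * c2 + 4 + 4 * / c1))
    by (apply Rmult_le_pos; lra).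
  unfold H; lra.
- rewrite HHc; rewrite <- (Rmult_1_r (4 * k ^ 4)) at 1; apply Rmult_le_compat_l; nra.
- unfold kp; field; lra.
- fold rad wr; apply Rle_trans with (kp * (wr * (rad / 4) / kp)).
    apply Rmult_le_compat_l; lra.
  right; field; lra.
Qed.
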